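(* Let $\rho_1,\rho_2\colon\mathrm{Isom}(\mathbf H^1_{\mathbb C})_o\to\mathrm{Isom}(\mathbf H^\infty_{\mathbb C})_o$ be irreducible representations with $\ell(\rho_1)=\ell(\rho_2)=t$. Suppose they have the same distinguished boundary points: there are $\eta_1,\eta_2\in\partial\mathbf H^\infty_{\mathbb C}$ such that for $i=1,2$, $\eta_1$ is fixed by $\rho_i(g(\lambda,b))$ for all $\lambda>0,b\in\mathbb R$ and $\eta_2$ is fixed by $\rho_i(g(\lambda,0))$ for all $\lambda>0$. Fix isotropic representatives with $B(\eta_1,\eta_2)=1$ and let $K_i(1)$ be the quantity $K(1)$ of $\rho_i$ computed with these representatives. Then there exists an irreducible representation $\rho\colon\mathrm{Isom}(\mathbf H^1_{\mathbb C})_o\to\mathrm{Isom}(\mathbf H^\infty_{\mathbb C})_o$ with $\ell(\rho)=t$ and $\mathrm{Arg}(\rho)=\arg\big(K_1(1)+K_2(1)\big)$.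
   Context: Complex hyperbolic spaces: $\mathcal H$ a separable complex Hilbert space with a strongly non-degenerate Hermitian form $B$ (linear in the first variable) of signature $(1,n)$; $\mathbf H^n_{\mathbb C}=\{[v]:B(v,v)>0\}$ with $\cosh d([v],[w])=|B(v,w)|/\sqrt{B(v,v)B(w,w)}$, boundary = isotropic lines, $\mathrm{Isom}(\mathbf H^n_{\mathbb C})_o=PU(B)$; complex hyperbolic subspaces are projectivizations of closed complex subspaces of signature $(1,m')$. For $\mathbf H^1_{\mathbb C}$: $\mathbb C^2$ with $B(z,w)=z_1\bar w_1-z_2\bar w_2$, $\xi_1=(e_1+e_2)/\sqrt2,\ \xi_2=(e_1-e_2)/\sqrt2$; $g(\lambda,b)\in SU(1,1)$ ($\lambda>0,b\in\mathbb R$) has matrix $\begin{pmatrix}\lambda&ib\\0&\lambda^{-1}\end{pmatrix}$ in the basis $(\xi_1,\xi_2)$; the same symbol denotes the induced isometry. Representations are orbitally continuous homomorphisms; non-elementary = no fixed point in $\mathbf H^\infty_{\mathbb C}\cup\partial\mathbf H^\infty_{\mathbb C}$ and no invariant pair of boundary points; irreducible = non-elementary with no proper invariant complex hyperbolic subspace. For non-elementary $\rho$, the point $\eta_1$ fixed by all $\rho(g(\lambda,b))$ is unique, and $\eta_2$ is the other endpoint of the common axis of the hyperbolic isometries $\rho(g(\lambda,0))$, $\lambda\neq 1$. With isotropic representatives $B(\eta_1,\eta_2)=1$ and $E=\eta_1^\perp\cap\eta_2^\perp$: for $b\in\mathbb R$ let $T_b\in U(B)$ be the lift of $\rho(g(1,b))$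 with $T_b\eta_1=\eta_1$; then $T_b\eta_2=K(b)\eta_1+\eta_2+c(b)$ with $K(b)\in\mathbb C$, $c(b)\in E$. $\ell(\rho)$ is the $t>0$ with $\inf_xd(\rho(g(\lambda,0))x,x)=t|\ln\lambda|$ for all $\lambda>0$; $\mathrm{Arg}(\rho)$ is the argument of $K(1)$ (independent of choices). *)

(* Defs.v *)
From Stdlib Require Import Reals.
From Coquelicot Require Import Coquelicot.
Open Scope R_scope.

Definition vec := nat -> C.
Definition inH (u : vec) : Prop := ex_series (fun n => (Cmod (u n)) ^ 2).
Definition vzero : vec := fun _ => RtoC 0.
Definition vadd (u v : vec) : vec := fun n => Cplus (u n) (v n).
Definition vscal (a : C) (u : vec) : vec := fun n => Cmult a (u n).
Definition vsub (u v : vec) : vec := fun n => Cminus (u n) (v n).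

Definition CSeries (s : nat -> C) : C :=
  (Series (fun n => fst (s n)), Series (fun n => snd (s n))).

Definition hnorm (u : vec) : R := sqrt (Series (fun n => (Cmod (u n)) ^ 2)).

Definition B (u v : vec) : C :=
  Cminus (Cmult (u 0%nat) (Cconj (v 0%nat)))
         (CSeries (fun n => Cmult (u (S n)) (Cconj (v (S n))))).

Definition unitaryB (T : vec -> vec) : Prop :=
  (forall u, inH u -> inH (T u)) /\
  (forall a u v, inH u -> inH v -> T (vadd (vscal a u) v) = vadd (vscal a (T u)) (T v)) /\
  (exists M, forall u, inH u -> hnorm (T u) <= M * hnorm u) /\
  (forall w, inH w -> exists u, inH u /\ T u = w) /\
  (forall u v, inH u -> inH v -> B (T u) (T v) = B u v).

Definition posv (v : vec) : Prop := inH v /\ 0 < fst (B v v).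
Definition isotropic (v : vec) : Prop := inH v /\ v <> vzero /\ B v v = RtoC 0.
Definition acosh (x : R) : R := ln (x + sqrt (x * x - 1)).
Definition hdist (v w : vec) : R :=
  acosh (Cmod (B v w) / sqrt (fst (B v v) * fst (B w w))).
Definition propto (u v : vec) : Prop := exists c : C, u = vscal c v.
Definition fixes (T : vec -> vec) (v : vec) : Prop := propto (T v) v.

(* ---------- Isom(H^1_C)_o = PU(1,1) = SU(1,1)/{+-1} ----------
   An element of SU(1,1) (for B(z,w) = z1 conj w1 - z2 conj w2 on C^2) is the matrix
   [[a, b], [conj b, conj a]] with |a|^2 - |b|^2 = 1, encoded as the pair (a,b). *)
Definition SU11 : Type := (C * C)%type.
Definition inSU11 (g : SU11) : Prop := (Cmod (fst g)) ^ 2 - (Cmod (snd g)) ^ 2 = 1.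
Definition su_mul (g h : SU11) : SU11 :=
  (Cplus (Cmult (fst g) (fst h)) (Cmult (snd g) (Cconj (snd h))),
   Cplus (Cmult (fst g) (snd h)) (Cmult (snd g) (Cconj (fst h)))).
Definition su_one : SU11 := (RtoC 1, RtoC 0).
Definition su_mone : SU11 := (RtoC (-1), RtoC 0).
(* g(lambda,b): matrix [[lambda, i b],[0, 1/lambda]] in the basis
   xi1 = (e1+e2)/sqrt2, xi2 = (e1-e2)/sqrt2; in the standard basis this is
   a = (lambda + 1/lambda + i b)/2, b' = (lambda - 1/lambda - i b)/2. *)
Definition gLB (lam b : R) : SU11 :=
  (((lam + / lam) / 2, b / 2), ((lam - / lam) / 2, - b / 2)).

(* ---------- Representations PU(1,1) -> PU(B) = Isom(H^oo_C)_o ----------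
   rho g is a lift in U(B) of the image of [g]; lifts are determined up to a unit
   scalar, so the homomorphism property holds up to unit scalars, and -1 acts by a
   scalar (so rho factors through PU(1,1)). Orbital continuity: g |-> rho(g) x is
   continuous for every x in H^oo_C. *)
Definition isRep (rho : SU11 -> vec -> vec) : Prop :=
  (forall g, inSU11 g -> unitaryB (rho g)) /\
  (forall g h, inSU11 g -> inSU11 h -> exists c : C, Cmod c = 1 /\
      forall u, inH u -> rho (su_mul g h) u = vscal c (rho g (rho h u))) /\
  (exists c : C, Cmod c = 1 /\ forall u, inH u -> rho su_mone u = vscal c u) /\
  (forall v, posv v -> forall g0, inSU11 g0 -> forall eps, 0 < eps ->
      exists delta, 0 < delta /\ forall g, inSU11 g ->
        Cmod (Cminus (fst g) (fst g0)) < delta ->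
        Cmod (Cminus (snd g) (snd g0)) < delta ->
        hdist (rho g v) (rho g0 v) < eps).

Definition nonElementary (rho : SU11 -> vec -> vec) : Prop :=
  ~ (exists v, inH v /\ v <> vzero /\ 0 <= fst (B v v) /\
        forall g, inSU11 g -> fixes (rho g) v) /\
  ~ (exists v w, isotropic v /\ isotropic w /\ ~ propto w v /\
        forall g, inSU11 g ->
          (fixes (rho g) v /\ fixes (rho g) w) \/
          (propto (rho g v) w /\ propto (rho g w) v)).

Definition closedSubspace (W : vec -> Prop) : Prop :=
  (forall u, W u -> inH u) /\ W vzero /\
  (forall a u v, W u -> W v -> W (vadd (vscal a u) v)) /\
  (forall (s : nat -> vec) u, (forall k, W (s k)) -> inH u ->
      is_lim_seq (fun k => hnorm (vsub (s k) u)) 0 -> W u).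

(* closed complex subspace of signature (1,m') (m' finite or infinite):
   W = C v (+) W' with B(v,v) > 0 and B negative definite on W' = W cap v^perp.
   Its projectivization is a complex hyperbolic subspace. *)
Definition hypSubspace (W : vec -> Prop) : Prop :=
  closedSubspace W /\
  exists v, W v /\ 0 < fst (B v v) /\
    forall w, W w -> B w v = RtoC 0 -> w <> vzero -> fst (B w w) < 0.

Definition irreducible (rho : SU11 -> vec -> vec) : Prop :=
  nonElementary rho /\
  ~ (exists W, hypSubspace W /\ (exists u, inH u /\ ~ W u) /\
        forall g, inSU11 g -> forall u, W u -> W (rho g u)).

Definition translen (T : vec -> vec) : Rbar :=
  Glb_Rbar (fun r => exists v, posv v /\ r = hdist (T v) v).

Definition ellIs (rho : SU11 -> vec -> vec) (t : R) : Prop :=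
  0 < t /\ forall lam, 0 < lam -> translen (rho (gLB lam 0)) = Finite (t * Rabs (ln lam)).

Definition isArg (z : C) (theta : R) : Prop :=
  z <> RtoC 0 /\ - PI < theta <= PI /\
  z = (Cmod z * cos theta, Cmod z * sin theta).

(* K is K(1) of rho computed with isotropic representatives eta1, eta2:
   T = c rho(g(1,1)) is the lift with T eta1 = eta1, and
   T eta2 = K eta1 + eta2 + e with e in E = eta1^perp cap eta2^perp. *)
Definition K1of (rho : SU11 -> vec -> vec) (eta1 eta2 : vec) (K : C) : Prop :=
  exists (c : C) (e : vec), Cmod c = 1 /\ inH e /\
    B e eta1 = RtoC 0 /\ B e eta2 = RtoC 0 /\
    vscal c (rho (gLB 1 1) eta1) = eta1 /\
    vscal c (rho (gLB 1 1) eta2) = vadd (vadd (vscal K eta1) eta2) e.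

Definition distinguished (rho : SU11 -> vec -> vec) (eta1 eta2 : vec) : Prop :=
  isotropic eta1 /\ isotropic eta2 /\ B eta1 eta2 = RtoC 1 /\
  (forall lam b, 0 < lam -> fixes (rho (gLB lam b)) eta1) /\
  (forall lam, 0 < lam -> fixes (rho (gLB lam 0)) eta2).

Definition ArgIs (rho : SU11 -> vec -> vec) (theta : R) : Prop :=
  exists eta1 eta2 K, distinguished rho eta1 eta2 /\ K1of rho eta1 eta2 K /\
    isArg K theta.

(* Main.v *)
Require Import Defs.
From Stdlib Require Import Reals Lra Lia ZArith List FunctionalExtensionality ClassicalEpsilon Classical Cantor.
From Coquelicot Require Import Coquelicot.
Open Scope R_scope.

(* Let rho be irreducible with distinguished points eta1, eta2. The orbit of eta1 consists of eta1
   and of the points v_x = T_x eta2, x real, and B(v_x, v_y) = K(x - y), where K(x) = |x|^t K(1)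
   for x > 0 and K(-x) is the conjugate of K(x). Hence K(x) + conj K(y) - K(x - y) is a positive
   semidefinite kernel. For two representations with the same t the sum of the kernels has the
   same homogeneous shape, with K(1) = K1(1) + K2(1), so Gram-Schmidt realises it by new vectors
   v_x spanning a hyperbolic space; irreducibility of rho1 forces this space to be infinite
   dimensional. The maps x -> x + b, x -> l^2 x and x -> -1/x change K(x - y) only by a factor
   f(x) conj f(y), hence act by elements of U(B) which are unique up to a unit scalar. These
   generate the required representation of PU(1,1). *)

(** Translation lengths only give |ln m| = t |ln lam| for the modulus m of the eigenvalue of
    g(lam,0) at eta1. That m is lam^t and not lam^(-t) comes from orbital continuity: the other sign
    would make Re K(x) blow up as x tends to 0, provided Re K(1) > 0. This positivity is proved
    first: if Re K(1) = 0, every c(x) is null and E would contain no nonzero vector. It is stable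
    under addition, so K1(1) + K2(1) has an argument and the new kernel vanishes only on the
    diagonal. Lifts to U(B) carry an undetermined unit scalar, and no cocycle is ever computed. For
    the given representations T_b is pinned down by T_b eta1 = eta1, which makes it an honest
    one-parameter group. For the new one, rho(g) is any chosen operator that permutes the lines of
    the boundary vectors as g does; uniqueness up to a unit scalar then yields the homomorphism law,
    and continuity may be tested on whichever lift is convenient, because [hdist] only sees |B|. *)

Lemma C_eq (z w : C) : fst z = fst w -> snd z = snd w -> z = w.
Proof. destruct z, w; simpl; intros; subst; reflexivity. Qed.

Ltac c2r := unfold Cminus, Cplus, Cmult, Copp, Cconj, RtoC, Re, Im in *; simpl in *.
Ltac creq := apply C_eq; c2r; try ring.
Ltac conjs := repeat first [rewrite Cplus_conj | rewrite Cmult_conj | rewrite Cminus_conj | rewrite Copp_conj | rewrite Cconj_conj].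
Ltac vext := apply functional_extensionality; intro; unfold vadd, vscal, vsub, vzero.

Lemma Cconj_R (x : R) : Cconj (RtoC x) = RtoC x.
Proof. creq. Qed.

Lemma Cmod_sq (z : C) : Cmod z ^ 2 = fst z ^ 2 + snd z ^ 2.
Proof. apply Cmod2_alt. Qed.

Lemma Cmult_conj_self (z : C) : Cmult z (Cconj z) = RtoC (Cmod z ^ 2).
Proof. rewrite Cmod_sq. destruct z. creq. Qed.

Lemma Cmod_sq_mult (z w : C) : Cmod (Cmult z w) ^ 2 = Cmod z ^ 2 * Cmod w ^ 2.
Proof. rewrite Cmod_mult. ring. Qed.

Lemma Cmod_sq_add (z w : C) : Cmod (Cplus z w) ^ 2 <= 2 * Cmod z ^ 2 + 2 * Cmod w ^ 2.
Proof.
  rewrite !Cmod_sq. destruct z as [a b], w as [c d]; simpl.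
  pose proof (pow2_ge_0 (a - c)). pose proof (pow2_ge_0 (b - d)). nra.
Qed.

Lemma Cmod_sq_0 (z : C) : Cmod z ^ 2 = 0 -> z = RtoC 0.
Proof. intro H. apply Cmod_eq_0. pose proof (Cmod_ge_0 z). nra. Qed.

Lemma Cmod_le_sqrt (z : C) (M : R) : Cmod z ^ 2 <= M -> Cmod z <= sqrt M.
Proof.
  intro H. rewrite <- (sqrt_pow2 (Cmod z)) by apply Cmod_ge_0. now apply sqrt_le_1_alt.
Qed.

(** * The space [inH] and the form [B] *)

Definition nsq (u : vec) : R := Series (fun n => Cmod (u n) ^ 2).
Definition ip (u v : vec) : C := CSeries (fun n => Cmult (u n) (Cconj (v n))).
Definition vtail (u : vec) : vec := fun n => u (S n).

Definition Csummable (s : nat -> C) : Prop :=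
  ex_series (fun n => fst (s n)) /\ ex_series (fun n => snd (s n)).

Lemma ex_series_Rle (a b : nat -> R) :
  (forall n, Rabs (a n) <= b n) -> ex_series b -> ex_series a.
Proof. intros H Hb. apply (@ex_series_le R_AbsRing R_CompleteNormedModule a b); auto. Qed.

Lemma ex_series_Rplus (a b : nat -> R) :
  ex_series a -> ex_series b -> ex_series (fun n => a n + b n).
Proof. intros. apply (ex_series_plus (K := R_AbsRing) (V := R_NormedModule) a b); auto. Qed.

Lemma ex_series_Rscal (c : R) (a : nat -> R) :
  ex_series a -> ex_series (fun n => c * a n).
Proof. intros. apply (ex_series_scal (K := R_AbsRing) (V := R_NormedModule) c a); auto. Qed.

Lemma sum_n_single (a : nat -> R) (m : nat) : (forall n, n <> m -> a n = 0) ->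
  forall N, (m <= N)%nat -> sum_n a N = a m.
Proof.
  intros H. induction N; intro HN.
  - rewrite sum_O. f_equal. lia.
  - rewrite sum_Sn. unfold plus; simpl. destruct (Nat.eq_dec m (S N)) as [->|E].
    + assert (forall k, (k <= N)%nat -> sum_n a k = 0) as Z.
      { induction k; intro; [rewrite sum_O; apply H; lia|].
        rewrite sum_Sn, IHk, H by lia. unfold plus; simpl; ring. }
      rewrite Z by lia. ring.
    + rewrite IHN, (H (S N)) by lia. ring.
Qed.

Lemma is_series_single (a : nat -> R) (m : nat) : (forall n, n <> m -> a n = 0) ->
  is_series a (a m).
Proof.
  intro H. unfold is_series. apply filterlim_ext_loc with (fun _ => a m).
  - exists m. intros N HN. symmetry. now apply sum_n_single.
  - apply filterlim_const.
Qed.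

Lemma Series_single (a : nat -> R) (m : nat) : (forall n, n <> m -> a n = 0) -> Series a = a m.
Proof. intro H. apply is_series_unique, is_series_single, H. Qed.

Lemma Series_0 (a : nat -> R) : (forall n, a n = 0) -> Series a = 0.
Proof. intro H. rewrite (Series_single a 0); auto. Qed.

Lemma inH_vzero : inH vzero.
Proof.
  eexists. apply (is_series_single (fun n => Cmod (vzero n) ^ 2) 0).
  intros n _. unfold vzero. rewrite Cmod_0. simpl. ring.
Qed.

Lemma inH_vadd (u v : vec) : inH u -> inH v -> inH (vadd u v).
Proof.
  intros Hu Hv.
  apply ex_series_Rle with (fun n => 2 * Cmod (u n) ^ 2 + 2 * Cmod (v n) ^ 2).
  - intro n. rewrite Rabs_pos_eq by apply pow2_ge_0. apply Cmod_sq_add.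
  - apply ex_series_Rplus; now apply ex_series_Rscal.
Qed.

Lemma inH_vscal (a : C) (u : vec) : inH u -> inH (vscal a u).
Proof.
  intro Hu. apply ex_series_ext with (fun n => Cmod a ^ 2 * Cmod (u n) ^ 2).
  - intro n. unfold vscal. now rewrite Cmod_sq_mult.
  - now apply ex_series_Rscal.
Qed.

Lemma inH_vtail (u : vec) : inH u -> inH (vtail u).
Proof. intro H. apply (ex_series_incr_1 (fun n => Cmod (u n) ^ 2)). exact H. Qed.

Lemma Csummable_prod (u v : vec) :
  inH u -> inH v -> Csummable (fun n => Cmult (u n) (Cconj (v n))).
Proof.
  intros Hu Hv. split;
  (apply ex_series_Rle with (fun n => Cmod (u n) ^ 2 + Cmod (v n) ^ 2);
    [|now apply ex_series_Rplus]);
  intro n; rewrite !Cmod_sq; destruct (u n) as [a b], (v n) as [c d]; simpl; apply Rabs_le;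
  pose proof (pow2_ge_0 (a - c)); pose proof (pow2_ge_0 (a + c));
  pose proof (pow2_ge_0 (b - d)); pose proof (pow2_ge_0 (b + d));
  pose proof (pow2_ge_0 (a - d)); pose proof (pow2_ge_0 (a + d));
  pose proof (pow2_ge_0 (b - c)); pose proof (pow2_ge_0 (b + c)); nra.
Qed.

Lemma CSeries_add (s s' : nat -> C) : Csummable s -> Csummable s' ->
  CSeries (fun n => Cplus (s n) (s' n)) = Cplus (CSeries s) (CSeries s').
Proof. intros [H1 H2] [H3 H4]. apply C_eq; simpl; symmetry; rewrite <- Series_plus; auto. Qed.

Lemma CSeries_scal (a : C) (s : nat -> C) : Csummable s ->
  CSeries (fun n => Cmult a (s n)) = Cmult a (CSeries s).
Proof.
  intros [H1 H2]. destruct a as [a b]. apply C_eq; simpl.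
  - rewrite Series_minus by now apply ex_series_Rscal. now rewrite !Series_scal_l.
  - rewrite Series_plus by now apply ex_series_Rscal. now rewrite !Series_scal_l.
Qed.

Lemma CSeries_ext (s s' : nat -> C) : (forall n, s n = s' n) -> CSeries s = CSeries s'.
Proof. intro H. apply C_eq; simpl; apply Series_ext; intro; now rewrite H. Qed.

Lemma ip_add_l (u v w : vec) : inH u -> inH v -> inH w ->
  ip (vadd u v) w = Cplus (ip u w) (ip v w).
Proof.
  intros. unfold ip. rewrite <- CSeries_add by now apply Csummable_prod.
  apply CSeries_ext. intro n. unfold vadd. ring.
Qed.

Lemma ip_scal_l (a : C) (u w : vec) : inH u -> inH w -> ip (vscal a u) w = Cmult a (ip u w).
Proof.
  intros. unfold ip. rewrite <- CSeries_scal by now apply Csummable_prod.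
  apply CSeries_ext. intro n. unfold vscal. ring.
Qed.

Lemma ip_conj (u v : vec) : ip v u = Cconj (ip u v).
Proof.
  apply C_eq; simpl.
  - apply Series_ext. intro n. c2r. ring.
  - rewrite <- Series_opp. apply Series_ext. intro n. c2r. ring.
Qed.

Lemma ip_self (u : vec) : ip u u = RtoC (nsq u).
Proof.
  unfold ip, nsq, CSeries, RtoC. apply C_eq; cbn [fst snd].
  - apply Series_ext. intro n. rewrite Cmod_sq. c2r. ring.
  - apply Series_0. intro n. c2r. ring.
Qed.

Lemma B_ip (u v : vec) :
  B u v = Cminus (Cmult (u 0%nat) (Cconj (v 0%nat))) (ip (vtail u) (vtail v)).
Proof. reflexivity. Qed.

#[local] Hint Resolve inH_vzero inH_vadd inH_vscal inH_vtail : inH.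
Ltac hh := auto 10 with inH.

Lemma B_add_l (u v w : vec) : inH u -> inH v -> inH w ->
  B (vadd u v) w = Cplus (B u w) (B v w).
Proof.
  intros. rewrite !B_ip. change (vtail (vadd u v)) with (vadd (vtail u) (vtail v)).
  rewrite ip_add_l by hh. unfold vadd. ring.
Qed.

Lemma B_scal_l (a : C) (u w : vec) : inH u -> inH w -> B (vscal a u) w = Cmult a (B u w).
Proof.
  intros. rewrite !B_ip. change (vtail (vscal a u)) with (vscal a (vtail u)).
  rewrite ip_scal_l by hh. unfold vscal. ring.
Qed.

Lemma B_conj (u v : vec) : B v u = Cconj (B u v).
Proof. rewrite !B_ip. conjs. rewrite <- ip_conj. ring. Qed.

Lemma B_add_r (u v w : vec) : inH u -> inH v -> inH w ->
  B w (vadd u v) = Cplus (B w u) (B w v).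
Proof.
  intros. rewrite B_conj, B_add_l, Cplus_conj, <- !B_conj by hh. reflexivity.
Qed.

Lemma B_scal_r (a : C) (u w : vec) : inH u -> inH w ->
  B w (vscal a u) = Cmult (Cconj a) (B w u).
Proof.
  intros. rewrite B_conj, B_scal_l, Cmult_conj, <- !B_conj by hh. reflexivity.
Qed.

Lemma nsq_ge_0 (u : vec) : inH u -> 0 <= nsq u.
Proof.
  intro H. unfold nsq. rewrite <- (Series_0 (fun _ => 0)) by auto.
  apply Series_le; auto. intro n. pose proof (pow2_ge_0 (Cmod (u n))). lra.
Qed.

Lemma nsq_tail (u : vec) : inH u -> nsq u = Cmod (u 0%nat) ^ 2 + nsq (vtail u).
Proof. intro H. unfold nsq. now rewrite Series_incr_1. Qed.

Lemma nsq_coord (n : nat) : forall u, inH u -> Cmod (u n) ^ 2 <= nsq u.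
Proof.
  induction n; intros u H; rewrite nsq_tail by hh.
  - pose proof (nsq_ge_0 (vtail u)). assert (inH (vtail u)) by hh. intuition lra.
  - pose proof (IHn (vtail u) (inH_vtail u H)). unfold vtail at 1 in H0.
    pose proof (pow2_ge_0 (Cmod (u 0%nat))). lra.
Qed.

Lemma nsq_eq_0 (u : vec) : inH u -> nsq u <= 0 -> u = vzero.
Proof.
  intros H H0. vext. apply Cmod_sq_0. pose proof (nsq_coord x u H).
  pose proof (pow2_ge_0 (Cmod (u x))). lra.
Qed.

Lemma B_self (u : vec) : B u u = RtoC (Cmod (u 0%nat) ^ 2 - nsq (vtail u)).
Proof. rewrite B_ip, ip_self, Cmult_conj_self, RtoC_minus. reflexivity. Qed.

Lemma B_self_fst (u : vec) : B u u = RtoC (fst (B u u)).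
Proof. now rewrite B_self. Qed.

Lemma nsq_B (u : vec) : inH u -> nsq u = 2 * Cmod (u 0%nat) ^ 2 - fst (B u u).
Proof. intro H. rewrite nsq_tail, B_self by auto. simpl. ring. Qed.

Lemma nsq_scal (a : C) (u : vec) : nsq (vscal a u) = Cmod a ^ 2 * nsq u.
Proof.
  unfold nsq. rewrite <- Series_scal_l. apply Series_ext. intro n. apply Cmod_sq_mult.
Qed.

Lemma nsq_add (u v : vec) : inH u -> inH v -> nsq (vadd u v) <= 2 * nsq u + 2 * nsq v.
Proof.
  intros Hu Hv. unfold nsq. rewrite <- !Series_scal_l, <- Series_plus by now apply ex_series_Rscal.
  apply Series_le.
  - intro n. split; [apply pow2_ge_0 | apply Cmod_sq_add].
  - apply ex_series_Rplus; now apply ex_series_Rscal.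
Qed.

Lemma hnorm_nsq (u : vec) : hnorm u = sqrt (nsq u).
Proof. reflexivity. Qed.

(** The last step of Cauchy-Schwarz, with [m] = |<u,v>|^2: expanding |u - r<u,v>v|^2 leaves a factor
    [m] in both terms in [r]. The choice [r = / c] is optimal; when [c = 0], a large [r] rules out
    [m > 0] instead. *)
Lemma quad_discr (a c m : R) : 0 <= c -> 0 <= m ->
  (forall r, 0 <= a - 2 * r * m + r * r * m * c) -> m <= a * c.
Proof.
  intros Hc Hm H. destruct (Req_dec c 0) as [->|Hc0].
  - destruct (Req_dec m 0) as [->|Hm0]; [lra|]. exfalso.
    specialize (H ((a + 1) / (2 * m))).
    replace (a - 2 * ((a + 1) / (2 * m)) * m + (a + 1) / (2 * m) * ((a + 1) / (2 * m)) * m * 0)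
      with (-1) in H by (field; auto). lra.
  - specialize (H (/ c)).
    replace (a - 2 * / c * m + / c * / c * m * c) with (a - m / c) in H by (field; auto).
    assert (0 < c) by lra. apply Rmult_le_compat_r with (r := c) in H; auto.
    replace ((a - m / c) * c) with (a * c - m) in H by (field; auto). lra.
Qed.

Lemma ip_cauchy_schwarz (u v : vec) : inH u -> inH v -> Cmod (ip u v) ^ 2 <= nsq u * nsq v.
Proof.
  intros Hu Hv. apply quad_discr; [now apply nsq_ge_0 | apply pow2_ge_0 |].
  intro r. pose (z := Copp (Cmult (RtoC r) (ip u v))).
  assert (E : nsq (vadd u (vscal z v)) =
     nsq u - 2 * r * Cmod (ip u v) ^ 2 + r * r * Cmod (ip u v) ^ 2 * nsq v).
  { apply RtoC_inj. rewrite <- ip_self.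
    assert (forall w w', inH w -> inH w' -> inH (vadd w w')) by hh.
    rewrite ip_add_l by hh. rewrite ip_scal_l by hh.
    rewrite (ip_conj _ u), (ip_conj _ v). rewrite !ip_add_l, !ip_scal_l by hh.
    rewrite (ip_conj u v), !ip_self, Cmod_sq. unfold z.
    destruct (ip u v) as [p q]. creq. }
  rewrite <- E. apply nsq_ge_0. hh.
Qed.

Lemma B_bound (u v : vec) : inH u -> inH v -> Cmod (B u v) ^ 2 <= 4 * (nsq u * nsq v).
Proof.
  intros Hu Hv. rewrite B_ip. unfold Cminus.
  eapply Rle_trans; [apply Cmod_sq_add|]. rewrite Cmod_opp, Cmod_sq_mult, Cmod_conj.
  pose proof (ip_cauchy_schwarz (vtail u) (vtail v) (inH_vtail _ Hu) (inH_vtail _ Hv)).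
  rewrite (nsq_tail u), (nsq_tail v) by hh.
  pose proof (nsq_ge_0 (vtail u) (inH_vtail _ Hu)). pose proof (nsq_ge_0 (vtail v) (inH_vtail _ Hv)).
  pose proof (pow2_ge_0 (Cmod (u 0%nat))). pose proof (pow2_ge_0 (Cmod (v 0%nat))).
  nra.
Qed.

(** Signature (1, infinity): the complement of a positive vector is negative definite.
    Cauchy-Schwarz on the tails gives |e0|^2 |p0|^2 <= |e'|^2 |p'|^2, while |p0| > |p'| and |e0| >=
    |e'|; only e = 0 allows this. *)
Lemma B_neg (p e : vec) : inH p -> inH e -> 0 < fst (B p p) -> B e p = RtoC 0 ->
  0 <= fst (B e e) -> e = vzero.
Proof.
  intros Hp He Hpos Hort H0. apply nsq_eq_0; auto.
  rewrite B_self in Hpos, H0. simpl in Hpos, H0. rewrite nsq_tail by auto.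
  rewrite B_ip in Hort. apply Ceq_minus in Hort.
  pose proof (ip_cauchy_schwarz (vtail e) (vtail p) (inH_vtail _ He) (inH_vtail _ Hp)) as H.
  rewrite <- Hort, Cmod_sq_mult, Cmod_conj in H.
  pose proof (nsq_ge_0 (vtail e) (inH_vtail _ He)). pose proof (nsq_ge_0 (vtail p) (inH_vtail _ Hp)).
  pose proof (pow2_ge_0 (Cmod (e 0%nat))). pose proof (pow2_ge_0 (Cmod (p 0%nat))).
  nra.
Qed.

(** * Coordinate vectors, finite combinations and truncation *)

Definition delta (m : nat) : vec := fun n => if Nat.eqb n m then RtoC 1 else RtoC 0.
#[local] Arguments delta : simpl never.
Definition sgnB (m : nat) : R := match m with O => 1 | S _ => -1 end.

Lemma delta_neq (m n : nat) : n <> m -> delta m n = RtoC 0.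
Proof. intro H. unfold delta. apply Nat.eqb_neq in H. now rewrite H. Qed.

Lemma delta_eq (m : nat) : delta m m = RtoC 1.
Proof. unfold delta. now rewrite Nat.eqb_refl. Qed.

Lemma inH_delta (m : nat) : inH (delta m).
Proof.
  eexists. apply is_series_single with (m := m). intros n Hn. rewrite delta_neq by auto.
  rewrite Cmod_0. ring.
Qed.
#[local] Hint Resolve inH_delta : inH.

Lemma ip_delta (u : vec) (m : nat) : ip u (delta m) = u m.
Proof.
  unfold ip, CSeries. apply C_eq; cbn [fst snd].
  - rewrite (Series_single _ m).
    + rewrite delta_eq. c2r. ring.
    + intros n Hn. rewrite delta_neq by auto. c2r. ring.
  - rewrite (Series_single _ m).
    + rewrite delta_eq. c2r. ring.
    + intros n Hn. rewrite delta_neq by auto. c2r. ring.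
Qed.

Lemma B_delta (u : vec) (m : nat) : B u (delta m) = Cmult (RtoC (sgnB m)) (u m).
Proof.
  rewrite B_ip. destruct m as [|m].
  - rewrite delta_eq. replace (vtail (delta 0)) with vzero by reflexivity.
    replace (ip (vtail u) vzero) with (RtoC 0).
    + simpl. creq.
    + unfold ip, vzero, CSeries. symmetry. apply C_eq; cbn [fst snd];
      apply Series_0; intro; c2r; ring.
  - replace (vtail (delta (S m))) with (delta m) by reflexivity.
    rewrite ip_delta, delta_neq by lia. unfold vtail. simpl. creq.
Qed.

Lemma sgnB_sq (m : nat) : sgnB m * sgnB m = 1.
Proof. destruct m; simpl; ring. Qed.

Lemma B_nondeg (z : vec) : (forall m, B z (delta m) = RtoC 0) -> z = vzero.
Proof.
  intro H. vext. specialize (H x). rewrite B_delta in H.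
  replace (z x) with (Cmult (RtoC (sgnB x)) (Cmult (RtoC (sgnB x)) (z x))).
  - rewrite H. ring.
  - rewrite Cmult_assoc, <- RtoC_mult, sgnB_sq. ring.
Qed.

Definition trunc (N : nat) (u : vec) : vec :=
  fun n => if Nat.ltb n N then u n else RtoC 0.

(** A list stands for a formal finite combination, with repetitions allowed; the same type of lists
    later serves as the space on which the summed kernel defines a form. *)
Definition lincomb {I : Type} (v : I -> vec) (l : list (C * I)) : vec :=
  fold_right (fun p acc => vadd (vscal (fst p) (v (snd p))) acc) vzero l.

Lemma lincomb_cons {I : Type} (v : I -> vec) (p : C * I) (l : list (C * I)) :
  lincomb v (p :: l) = vadd (vscal (fst p) (v (snd p))) (lincomb v l).
Proof. reflexivity. Qed.

Lemma lincomb_app {I : Type} (v : I -> vec) (l l' : list (C * I)) :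
  lincomb v (l ++ l') = vadd (lincomb v l) (lincomb v l').
Proof.
  induction l as [|p l IH]; simpl.
  - vext. ring.
  - rewrite IH. vext. ring.
Qed.

Lemma inH_lincomb {I : Type} (v : I -> vec) (l : list (C * I)) :
  (forall i, inH (v i)) -> inH (lincomb v l).
Proof. intro H. induction l as [|p l IH]; [|rewrite lincomb_cons]; hh. Qed.
#[local] Hint Resolve inH_lincomb : inH.

Lemma trunc_S (u : vec) (N : nat) :
  trunc (S N) u = vadd (trunc N u) (vscal (u N) (delta N)).
Proof.
  vext. unfold trunc. destruct (Nat.ltb_spec x (S N)), (Nat.ltb_spec x N); try lia.
  - rewrite delta_neq by lia. ring.
  - replace x with N by lia. rewrite delta_eq. ring.
  - rewrite delta_neq by lia. ring.
Qed.

Definition coords (N : nat) (u : vec) : list (C * nat) := map (fun m => (u m, m)) (seq 0 N).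

Lemma coords_S (N : nat) (u : vec) : coords (S N) u = coords N u ++ (u N, N) :: nil.
Proof. unfold coords. rewrite seq_S, map_app. reflexivity. Qed.

Lemma lincomb_coords (u : vec) (N : nat) : lincomb delta (coords N u) = trunc N u.
Proof.
  induction N; [reflexivity|]. rewrite coords_S, lincomb_app, IHN, trunc_S.
  simpl. vext. ring.
Qed.

Lemma inH_trunc (N : nat) (u : vec) : inH (trunc N u).
Proof. rewrite <- lincomb_coords. hh. Qed.
#[local] Hint Resolve inH_trunc : inH.

Lemma nsq_trunc_S (u : vec) (N : nat) :
  nsq (trunc (S N) u) = nsq (trunc N u) + Cmod (u N) ^ 2.
Proof.
  unfold nsq. replace (Cmod (u N) ^ 2) with (Series (fun n => Cmod (vscal (u N) (delta N) n) ^ 2)).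
  - rewrite <- Series_plus; [|exact (inH_trunc N u)|exact (inH_vscal _ _ (inH_delta N))].
    apply Series_ext. intro n. unfold trunc, vscal.
    destruct (Nat.ltb_spec n (S N)), (Nat.ltb_spec n N); try lia.
    + rewrite delta_neq, Cmult_0_r, Cmod_0 by lia. ring.
    + replace n with N by lia. rewrite delta_eq, Cmult_1_r, Cmod_0. ring.
    + rewrite delta_neq, Cmult_0_r, Cmod_0 by lia. ring.
  - rewrite (Series_single _ N); unfold vscal.
    + now rewrite delta_eq, Cmult_1_r.
    + intros n Hn. rewrite delta_neq, Cmult_0_r, Cmod_0 by auto. ring.
Qed.

Lemma nsq_trunc_0 (u : vec) : nsq (trunc 0 u) = 0.
Proof. apply Series_0. intro n. unfold trunc. simpl. rewrite Cmod_0. ring. Qed.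

Definition vdiff (u v : vec) : vec := vadd u (vscal (RtoC (-1)) v).

Lemma vsub_vdiff (u v : vec) : vsub u v = vdiff u v.
Proof. unfold vdiff. vext. creq. Qed.

Lemma inH_vdiff (u v : vec) : inH u -> inH v -> inH (vdiff u v).
Proof. intros. unfold vdiff. hh. Qed.
#[local] Hint Resolve inH_vdiff : inH.

Lemma B_vdiff_l (u v w : vec) : inH u -> inH v -> inH w ->
  B (vdiff u v) w = Cminus (B u w) (B v w).
Proof. intros. unfold vdiff. rewrite B_add_l, B_scal_l by hh. creq. Qed.

Lemma nsq_trunc (u : vec) (N : nat) : inH u ->
  nsq (vdiff u (trunc N u)) = Series (fun k => Cmod (u (N + k)%nat) ^ 2).
Proof.
  intro Hu. unfold nsq. rewrite (Series_incr_n_aux _ N).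
  - apply Series_ext. intro k. unfold vdiff, vadd, vscal, trunc.
    destruct (Nat.ltb_spec (N + k) N); [lia|]. f_equal. f_equal. ring.
  - intros k Hk. unfold vdiff, vadd, vscal, trunc.
    destruct (Nat.ltb_spec k N); [|lia].
    replace (Cplus (u k) (Cmult (RtoC (-1)) (u k))) with (RtoC 0) by (creq).
    rewrite Cmod_0. ring.
Qed.

Lemma nsq_trunc_lim (u : vec) : inH u ->
  is_lim_seq (fun N => nsq (vdiff u (trunc N u))) 0.
Proof.
  intro Hu. apply is_lim_seq_incr_1.
  apply is_lim_seq_ext with
    (fun N => Series (fun n => Cmod (u n) ^ 2) - sum_n (fun n => Cmod (u n) ^ 2) N).
  - intro N. rewrite nsq_trunc by auto.
    rewrite (Series_incr_n (fun n => Cmod (u n) ^ 2) (S N)) by (auto; lia).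
    rewrite sum_n_Reals. simpl Init.Nat.pred. ring.
  - replace 0 with (Series (fun n => Cmod (u n) ^ 2) - Series (fun n => Cmod (u n) ^ 2)) by ring.
    apply is_lim_seq_minus'; [apply is_lim_seq_const|]. apply (Series_correct _ Hu).
Qed.

Lemma trunc_approx (u : vec) (eps : R) : inH u -> 0 < eps ->
  exists N, nsq (vdiff u (trunc N u)) < eps.
Proof.
  intros Hu He. pose proof (nsq_trunc_lim u Hu) as H.
  apply is_lim_seq_spec in H. destruct (H (mkposreal eps He)) as [N HN].
  exists N. specialize (HN N (le_n N)). simpl in HN. rewrite Rminus_0_r in HN.
  apply Rabs_lt_between in HN. lra.
Qed.

Lemma inH_of_bound (u : vec) (M : R) : (forall N, nsq (trunc N u) <= M) ->
  inH u /\ nsq u <= M.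
Proof.
  intro H.
  assert (E : forall N, sum_n (fun n => Cmod (u n) ^ 2) N = nsq (trunc (S N) u)).
  { induction N.
    - rewrite sum_O, nsq_trunc_S, nsq_trunc_0, Rplus_0_l. reflexivity.
    - rewrite sum_Sn, IHN, (nsq_trunc_S u (S N)). reflexivity. }
  assert (S0 : forall N, sum_n (fun n => Cmod (u n) ^ 2) N <= M).
  { intro N. rewrite E. apply H. }
  assert (L : ex_finite_lim_seq (sum_n (fun n => Cmod (u n) ^ 2))).
  { apply ex_finite_lim_seq_incr with M; auto. intro n. rewrite sum_Sn.
    unfold plus; simpl. pose proof (pow2_ge_0 (Cmod (u (S n)))). simpl in *. lra. }
  destruct L as [l Hl]. assert (Hu : inH u) by (exists l; exact Hl).
  split; auto. unfold nsq. rewrite (is_series_unique _ l Hl).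
  apply (is_lim_seq_le (sum_n (fun n => Cmod (u n) ^ 2)) (fun _ => M) l M); auto.
  apply is_lim_seq_const.
Qed.

Lemma vscal_1 (u : vec) : vscal (RtoC 1) u = u.
Proof. vext. ring. Qed.
Lemma vscal_0 (u : vec) : vscal (RtoC 0) u = vzero.
Proof. vext. ring. Qed.
Lemma vscal_vzero (a : C) : vscal a vzero = vzero.
Proof. vext. ring. Qed.
Lemma vscal_vscal (a b : C) (u : vec) : vscal a (vscal b u) = vscal (Cmult a b) u.
Proof. vext. ring. Qed.
Lemma vadd_0_r (u : vec) : vadd u vzero = u.
Proof. vext. ring. Qed.
Lemma vadd_comm (u v : vec) : vadd u v = vadd v u.
Proof. vext. ring. Qed.
Lemma vdiff_0 (u v : vec) : vdiff u v = vzero -> u = v.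
Proof.
  intro H. vext. assert (E := f_equal (fun f => f x) H). cbv beta in E.
  unfold vdiff, vadd, vscal, vzero in E.
  replace (u x) with (Cplus (Cplus (u x) (Cmult (RtoC (-1)) (v x))) (v x)) by creq.
  rewrite E. ring.
Qed.

(** * Isometries determined by Gram matrices *)

Definition krow {I : Type} (k : I -> C) (l : list (C * I)) : C :=
  fold_right (fun p acc => Cplus (Cmult (Cconj (fst p)) (k (snd p))) acc) (RtoC 0) l.
Definition kform {I J : Type} (k : I -> J -> C) (l : list (C * I)) (l' : list (C * J)) : C :=
  fold_right (fun p acc => Cplus (Cmult (fst p) (krow (k (snd p)) l')) acc) (RtoC 0) l.

Lemma B_vzero_l (u : vec) : inH u -> B vzero u = RtoC 0.
Proof. intro. rewrite <- (vscal_0 u), B_scal_l by hh. ring. Qed.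
Lemma B_vzero_r (u : vec) : inH u -> B u vzero = RtoC 0.
Proof. intro. rewrite B_conj, B_vzero_l by hh. creq. Qed.

Lemma B_lincomb_r {I : Type} (v : I -> vec) (u : vec) (l : list (C * I)) :
  inH u -> (forall i, inH (v i)) -> B u (lincomb v l) = krow (fun i => B u (v i)) l.
Proof.
  intros Hu Hv. induction l as [|p l IH].
  - now apply B_vzero_r.
  - rewrite lincomb_cons, B_add_r, B_scal_r, IH by hh. reflexivity.
Qed.

Lemma B_lincomb {I J : Type} (v : I -> vec) (w : J -> vec) l l' :
  (forall i, inH (v i)) -> (forall i, inH (w i)) ->
  B (lincomb v l) (lincomb w l') = kform (fun i j => B (v i) (w j)) l l'.
Proof.
  intros Hv Hw. induction l as [|p l IH].
  - apply B_vzero_l. hh.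
  - rewrite lincomb_cons, B_add_l, B_scal_l, IH, B_lincomb_r by hh. reflexivity.
Qed.

Lemma krow_ext {I : Type} (k k' : I -> C) l : (forall i, k i = k' i) -> krow k l = krow k' l.
Proof. intro H. induction l; simpl; [|rewrite H, IHl]; reflexivity. Qed.

Lemma kform_ext {I J : Type} (k k' : I -> J -> C) l l' :
  (forall i j, k i j = k' i j) -> kform k l l' = kform k' l l'.
Proof.
  intro H. induction l as [|p l IH]; simpl; [reflexivity|].
  rewrite IH, (krow_ext _ (k' (snd p))); auto.
Qed.

Lemma gram_lincomb {I J : Type} (v v' : I -> vec) (w w' : J -> vec) l l' :
  (forall i, inH (v i)) -> (forall i, inH (w i)) ->
  (forall i, inH (v' i)) -> (forall i, inH (w' i)) ->
  (forall i j, B (v i) (w j) = B (v' i) (w' j)) ->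
  B (lincomb v l) (lincomb w l') = B (lincomb v' l) (lincomb w' l').
Proof. intros. rewrite !B_lincomb by auto. now apply kform_ext. Qed.

Lemma Cmod_sq_small (z : C) (M : R) :
  (forall eps, 0 < eps -> Cmod z ^ 2 <= M * eps) -> z = RtoC 0.
Proof.
  intro H. apply Cmod_sq_0. pose proof (pow2_ge_0 (Cmod z)).
  destruct (Req_dec (Cmod z ^ 2) 0); auto. exfalso.
  assert (0 < Cmod z ^ 2) by lra. set (m := Cmod z ^ 2) in *.
  pose proof (H 1 Rlt_0_1). assert (0 < M) by lra.
  assert (He : 0 < m / (2 * M)) by (apply Rdiv_lt_0_compat; lra).
  specialize (H _ He). replace (M * (m / (2 * M))) with (m / 2) in H by (field; lra). lra.
Qed.

Lemma lin_lincomb {I : Type} (T : vec -> vec) (v : I -> vec) l :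
  (forall a u w, inH u -> inH w -> T (vadd (vscal a u) w) = vadd (vscal a (T u)) (T w)) ->
  (forall i, inH (v i)) -> T (lincomb v l) = lincomb (fun i => T (v i)) l.
Proof.
  intros HT Hv. induction l as [|p l IH].
  - simpl. replace vzero with (vadd (vscal (RtoC (-1)) vzero) vzero) at 1 by (vext; ring).
    rewrite HT by hh. vext. creq.
  - rewrite !lincomb_cons, HT, IH by hh. reflexivity.
Qed.

Lemma functional_lincomb (phi : vec -> C) l :
  (forall a u v, inH u -> inH v -> phi (vadd (vscal a u) v) = Cplus (Cmult a (phi u)) (phi v)) ->
  (forall m, phi (delta m) = RtoC 0) -> phi (lincomb delta l) = RtoC 0.
Proof.
  intros Hl Hd. induction l as [|p l IH].
  - simpl. replace vzero with (vadd (vscal (RtoC (-1)) vzero) vzero) by (vext; ring).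
    rewrite Hl by hh. creq.
  - rewrite lincomb_cons, Hl, IH, Hd by hh. ring.
Qed.

(** Truncations are dense, so a bounded functional is determined by its values on the coordinate
    vectors. *)
Lemma functional_zero (phi : vec -> C) (M : R) :
  (forall a u v, inH u -> inH v -> phi (vadd (vscal a u) v) = Cplus (Cmult a (phi u)) (phi v)) ->
  (forall u, inH u -> Cmod (phi u) ^ 2 <= M * nsq u) ->
  (forall m, phi (delta m) = RtoC 0) ->
  forall u, inH u -> phi u = RtoC 0.
Proof.
  intros Hl Hb Hd u Hu. apply Cmod_sq_small with M. intros eps He.
  (* The sign of [M] is read off from the bound at [delta 0], a vector of norm 1. *)
  assert (HM : 0 <= M).
  { pose proof (Hb (delta 0) (inH_delta 0)). rewrite Hd, Cmod_0 in H.
    assert (nsq (delta 0) = 1).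
    { apply RtoC_inj. rewrite <- ip_self, ip_delta, delta_eq. reflexivity. }
    rewrite H0 in H. simpl in H. lra. }
  destruct (trunc_approx u eps Hu He) as [N HN].
  replace (phi u) with (phi (vdiff u (trunc N u))).
  - eapply Rle_trans; [apply Hb; hh|]. apply Rmult_le_compat_l; lra.
  - unfold vdiff. rewrite vadd_comm, Hl by hh.
    rewrite <- lincomb_coords, functional_lincomb by auto. ring.
Qed.

(** [unitaryB] without surjectivity, which [gram_unitary] recovers from an isometry built in the
    opposite direction. *)
Definition isometryB (T : vec -> vec) : Prop :=
  (forall u, inH u -> inH (T u)) /\
  (forall a u v, inH u -> inH v -> T (vadd (vscal a u) v) = vadd (vscal a (T u)) (T v)) /\
  (exists M, forall u, inH u -> hnorm (T u) <= M * hnorm u) /\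
  (forall u v, inH u -> inH v -> B (T u) (T v) = B u v).

Lemma hnorm_bound (T : vec -> vec) (M : R) : 0 <= M ->
  (forall u, inH u -> nsq (T u) <= M * nsq u) ->
  exists M', forall u, inH u -> hnorm (T u) <= M' * hnorm u.
Proof.
  intros HM H. exists (sqrt M). intros u Hu. rewrite !hnorm_nsq, <- sqrt_mult_alt by auto.
  apply sqrt_le_1_alt. auto.
Qed.

(* [T u] is determined by its coordinates [B (T u) (delta m) = B u (T^-1 (delta m))], and
   [T^-1 (delta m)] is known once [delta m] is a combination of the [v' i]. *)
Lemma gram_isometry {I : Type} (v v' : I -> vec) :
  (forall i, inH (v i)) -> (forall i, inH (v' i)) ->
  (forall i j, B (v i) (v j) = B (v' i) (v' j)) ->
  (forall m, exists l, delta m = lincomb v l) ->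
  (forall m, exists l, delta m = lincomb v' l) ->
  exists T, isometryB T /\ forall i, T (v i) = v' i.
Proof.
  intros Hv Hv' HB Hs Hs'.
  assert (Hl' : exists l' : nat -> list (C * I), forall m, delta m = lincomb v' (l' m)).
  { exists (fun m => proj1_sig (constructive_indefinite_description _ (Hs' m))).
    intro m. apply (proj2_sig (constructive_indefinite_description _ (Hs' m))). }
  destruct Hl' as [l' Hl']. clear Hs'.
  pose (q := fun m => lincomb v (l' m)).
  assert (Hq : forall m, inH (q m)) by (intro; apply inH_lincomb, Hv).
  assert (Bq : forall i m, B (v i) (q m) = B (v' i) (delta m)).
  { intros i m. rewrite Hl'. unfold q. rewrite !B_lincomb_r by auto. apply krow_ext. auto. }
  assert (Bqq : forall m n, B (q m) (q n) = B (delta m) (delta n)).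
  { intros m n. rewrite !Hl'. apply gram_lincomb; auto. }
  pose (T := fun u : vec => (fun m => Cmult (RtoC (sgnB m)) (B u (q m))) : vec).
  assert (Tlin : forall a u w, inH u -> inH w ->
     T (vadd (vscal a u) w) = vadd (vscal a (T u)) (T w)).
  { intros. unfold T. apply functional_extensionality. intro m.
    rewrite B_add_l, B_scal_l by hh. unfold vadd, vscal. ring. }
  assert (Tv : forall i, T (v i) = v' i).
  { intro i. unfold T. vext. rewrite Bq, B_delta, Cmult_assoc, <- RtoC_mult, sgnB_sq. ring. }
  destruct (Hs 0%nat) as [l0 Hl0].
  (* [d0] is the vector to which [T] is going to send [delta 0]. *)
  pose (d0 := lincomb v' l0). assert (Hd0 : inH d0) by (unfold d0; hh).
  pose (M := 4 * (8 * nsq d0 + 1)).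
  assert (HM : 0 <= M) by (pose proof (nsq_ge_0 d0 Hd0); unfold M; lra).
  (* Boundedness by duality: [w] plays the part of the preimage of a truncation of [T u] with signs
     adjusted, so that [B u w] equals the squared norm [s] of that truncation. Since [nsq w] is at
     most a constant times [s], the estimate [B_bound] gives s^2 <= M (nsq u) s. *)
  assert (Tb : forall u, inH u -> inH (T u) /\ nsq (T u) <= M * nsq u).
  { intros u Hu. apply inH_of_bound. intro N.
    pose (y := fun m => Cmult (RtoC (sgnB m)) (T u m)).
    pose (w := lincomb q (coords N y)).
    assert (Hw : inH w) by (unfold w; hh).
    set (s := nsq (trunc N (T u))).
    assert (Es : nsq (trunc N y) = s).
    { unfold s. clear w Hw s. induction N; [now rewrite !nsq_trunc_0|].
      rewrite !nsq_trunc_S, IHN. unfold y. rewrite Cmod_sq_mult, Cmod_R.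
      destruct N; simpl; rewrite ?Rabs_R1, ?Rabs_m1; ring. }
    assert (E1 : B u w = RtoC s).
    { unfold w, s. clear w Hw s Es. induction N.
      - rewrite nsq_trunc_0. apply B_vzero_r. auto.
      - rewrite coords_S, lincomb_app, nsq_trunc_S, RtoC_plus, B_add_r, IHN by hh. f_equal.
        rewrite lincomb_cons. cbn [fst snd]. change (lincomb q nil) with vzero.
        rewrite vadd_0_r, B_scal_r by hh. unfold y.
        rewrite <- Cmult_conj_self, Cmult_conj, Cconj_R. unfold T at 2. ring. }
    assert (E2 : nsq w <= (8 * nsq d0 + 1) * s).
    { rewrite nsq_B by auto.
      assert (F1 : B w w = B (trunc N y) (trunc N y)).
      { rewrite <- lincomb_coords. unfold w. apply gram_lincomb; hh. }
      assert (F2 : w 0%nat = B (trunc N y) d0).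
      { transitivity (B w (delta 0)); [rewrite B_delta; simpl; ring|].
        rewrite <- lincomb_coords, Hl0. unfold w, d0. apply gram_lincomb; hh.
        intros m i. rewrite B_conj, Bq, <- B_conj. reflexivity. }
      rewrite F1, F2.
      pose proof (B_bound (trunc N y) d0 (inH_trunc _ _) Hd0).
      pose proof (nsq_B (trunc N y) (inH_trunc _ _)).
      pose proof (pow2_ge_0 (Cmod (trunc N y 0%nat))). rewrite Es in *. nra. }
    pose proof (B_bound u w Hu Hw) as E3. rewrite E1, Cmod_R, <- Rsqr_pow2, <- Rsqr_abs in E3.
    unfold Rsqr in E3.
    assert (0 <= s) by (apply nsq_ge_0; hh). assert (Nu := nsq_ge_0 u Hu).
    destruct (Req_dec s 0) as [->|Hs0].
    - pose proof (nsq_ge_0 d0 Hd0). unfold M. nra.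
    - apply Rmult_le_reg_l with s; [lra|]. unfold M.
      apply Rle_trans with (4 * (nsq u * nsq w)); auto.
      assert (nsq u * nsq w <= nsq u * ((8 * nsq d0 + 1) * s)) by (apply Rmult_le_compat_l; auto).
      lra. }
  assert (TH : forall u, inH u -> inH (T u)) by (intros; now apply Tb).
  exists T. split; [|exact Tv]. repeat split; auto.
  - apply hnorm_bound with M; auto. intros u Hu. apply Tb, Hu.
  - assert (Bd : forall m n, B (T (delta m)) (T (delta n)) = B (delta m) (delta n)).
    { intros m n. destruct (Hs m) as [l1 ->], (Hs n) as [l2 ->].
      rewrite !lin_lincomb by auto. symmetry. apply gram_lincomb; auto.
      intros i j. now rewrite !Tv. }
    (* Invariance of [B] passes from coordinate vectors to all vectors one argument at a time;
       conjugate symmetry exchanges the two arguments. *)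
    assert (K : forall w, inH w -> (forall m, B (T (delta m)) (T w) = B (delta m) w) ->
      forall u, inH u -> B (T u) (T w) = B u w).
    { intros w Hw H u Hu. apply Ceq_minus.
      apply functional_zero with (phi := fun u => Cminus (B (T u) (T w)) (B u w))
        (M := 8 * (M * nsq (T w)) + 8 * nsq w); auto.
      - intros. rewrite Tlin, !B_add_l, !B_scal_l by hh. ring.
      - intros x Hx. unfold Cminus. eapply Rle_trans; [apply Cmod_sq_add|]. rewrite Cmod_opp.
        pose proof (B_bound (T x) (T w) (TH _ Hx) (TH _ Hw)). pose proof (B_bound x w Hx Hw).
        assert (nsq (T x) * nsq (T w) <= (M * nsq x) * nsq (T w)).
        { apply Rmult_le_compat_r; [apply nsq_ge_0; auto | apply Tb, Hx]. }
        lra.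
      - intro m. rewrite H. ring. }
    intros u w Hu Hw. apply K; auto. intro m. rewrite (B_conj (T w)), (B_conj w). f_equal.
    apply K; auto. hh.
Qed.

(** B(Su - Tu, T v_i) = B(Su, S v_i) - B(Tu, T v_i) = 0, and the vectors T v_i reach every
    [delta m], so nondegeneracy of [B] concludes. *)
Lemma isometryB_unique {I : Type} (S T : vec -> vec) (v : I -> vec) :
  isometryB S -> isometryB T -> (forall i, inH (v i)) ->
  (forall m, exists l, delta m = lincomb (fun i => T (v i)) l) ->
  (forall i, S (v i) = T (v i)) -> forall u, inH u -> S u = T u.
Proof.
  intros (S1 & _ & _ & S4) (T1 & _ & _ & T4) Hv Hs E u Hu.
  apply vdiff_0, B_nondeg. intro m. destruct (Hs m) as [l ->].
  rewrite B_lincomb_r by hh.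
  rewrite (krow_ext _ (fun _ => RtoC 0)).
  - induction l; simpl; [reflexivity|]. rewrite IHl. ring.
  - intro i. rewrite B_vdiff_l by hh. rewrite <- E at 1. rewrite S4, T4 by auto. ring.
Qed.

(** The isometries from [v] to [v'] and back compose to a map fixing every [v' i], hence to the
    identity by uniqueness; this gives surjectivity. *)
Theorem gram_unitary {I : Type} (v v' : I -> vec) :
  (forall i, inH (v i)) -> (forall i, inH (v' i)) ->
  (forall i j, B (v i) (v j) = B (v' i) (v' j)) ->
  (forall m, exists l, delta m = lincomb v l) ->
  (forall m, exists l, delta m = lincomb v' l) ->
  exists T, unitaryB T /\ forall i, T (v i) = v' i.
Proof.
  intros Hv Hv' HB Hs Hs'.
  destruct (gram_isometry v v') as (T & HT & Tv); auto.
  destruct (gram_isometry v' v) as (T' & HT' & Tv'); auto.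
  assert (E : forall u, inH u -> T (T' u) = u).
  { intros u Hu. refine (isometryB_unique (fun u => T (T' u)) (fun u => u) v' _ _ Hv' Hs' _ u Hu).
    - destruct HT as (A1 & A2 & [M1 A3] & A4), HT' as (B1 & B2 & [M2 B3] & B4).
      repeat split; auto.
      + intros. rewrite B2, A2; auto.
      + exists (Rabs M1 * M2). intros x Hx. eapply Rle_trans; [apply A3; auto|].
        assert (0 <= hnorm (T' x)) by apply sqrt_pos. pose proof (Rle_abs M1).
        assert (0 <= Rabs M1) by apply Rabs_pos.
        specialize (B3 x Hx). nra.
      + intros. rewrite A4, B4; auto.
    - repeat split; auto. exists 1. intros. lra.
    - intro i. now rewrite Tv', Tv. }
  exists T. split; auto. destruct HT as (A1 & A2 & A3 & A4), HT' as (B1 & _).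
  repeat split; auto. intros w Hw. exists (T' w). auto.
Qed.

(** * Gram-Schmidt in a semi-inner product space *)

Lemma least_nat (P : nat -> Prop) : (exists n, P n) ->
  exists n, P n /\ forall i, (i < n)%nat -> ~ P i.
Proof.
  intros [n Hn]. revert Hn. induction n as [n IH] using (well_founded_induction Wf_nat.lt_wf).
  intro Hn. destruct (classic (exists i, (i < n)%nat /\ P i)) as [[i [Hi Pi]]|H].
  - eapply IH; eauto.
  - exists n. split; auto. intros i Hi Pi. apply H. eauto.
Qed.

Section GramSchmidt.
Context {X : Type} (add : X -> X -> X) (scal : C -> X -> X) (f : X -> X -> C).
Context (f_add : forall x y z, f (add x y) z = Cplus (f x z) (f y z))
        (f_scal : forall a x z, f (scal a x) z = Cmult a (f x z))
        (f_conj : forall x y, f y x = Cconj (f x y))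
        (f_pos : forall x, 0 <= fst (f x x)).

Let sub_mul (x : X) (a : C) (y : X) : X := add x (scal (Copp a) y).

Lemma semi_self (x : X) : f x x = RtoC (fst (f x x)).
Proof.
  apply C_eq; simpl; auto. pose proof (f_equal snd (f_conj x x)) as H. simpl in H. lra.
Qed.

Lemma semi_add_r (x y z : X) : f z (add x y) = Cplus (f z x) (f z y).
Proof. rewrite f_conj, f_add, Cplus_conj, <- !f_conj. reflexivity. Qed.

Lemma semi_scal_r (a : C) (x z : X) : f z (scal a x) = Cmult (Cconj a) (f z x).
Proof. rewrite f_conj, f_scal, Cmult_conj, <- !f_conj. reflexivity. Qed.

Lemma semi_sub_l (x y z : X) (a : C) : f (sub_mul x a y) z = Cminus (f x z) (Cmult a (f y z)).
Proof. unfold sub_mul. rewrite f_add, f_scal. ring. Qed.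

Lemma semi_sub_r (x y z : X) (a : C) :
  f z (sub_mul x a y) = Cminus (f z x) (Cmult (Cconj a) (f z y)).
Proof. unfold sub_mul. rewrite semi_add_r, semi_scal_r, Copp_conj. ring. Qed.

Lemma semi_cauchy_schwarz (x y : X) : Cmod (f x y) ^ 2 <= fst (f x x) * fst (f y y).
Proof.
  apply quad_discr; [apply f_pos | apply pow2_ge_0 |]. intro r.
  pose proof (f_pos (sub_mul x (Cmult (RtoC r) (f x y)) y)) as H.
  rewrite semi_sub_l, !semi_sub_r, (f_conj x y), (semi_self x), (semi_self y) in H.
  rewrite Cmod_sq. destruct (f x y) as [p q]. c2r. lra.
Qed.

(** For an orthonormal list this is the component of [x] orthogonal to it. [X] is a bare type with
    two operations, so linear identities only make sense once seen through [f]. *)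
Fixpoint residual (es : list X) (x : X) : X :=
  match es with
  | nil => x
  | e :: es' => let r := residual es' x in sub_mul r (f r e) e
  end.

Context (s : nat -> X)
  (s_free : forall es, exists j, 0 < fst (f (residual es (s j)) (residual es (s j)))).

Let pick_spec (es : list X) (j : nat) : Prop :=
  0 < fst (f (residual es (s j)) (residual es (s j))) /\
  forall i, (i < j)%nat -> ~ 0 < fst (f (residual es (s i)) (residual es (s i))).

Let pick_ex (es : list X) : exists j, pick_spec es j := least_nat _ (s_free es).

Let pick (es : list X) : nat :=
  proj1_sig (constructive_indefinite_description _ (pick_ex es)).

Let pickP (es : list X) : pick_spec es (pick es) :=
  proj2_sig (constructive_indefinite_description _ (pick_ex es)).

Let next (es : list X) : X :=
  let r := residual es (s (pick es)) in scal (RtoC (/ sqrt (fst (f r r)))) r.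

Fixpoint gs (k : nat) : list X :=
  match k with O => nil | S k' => next (gs k') :: gs k' end.

Let e (k : nat) : X := next (gs k).
Let res (k : nat) (x : X) : X := residual (gs k) x.

Lemma res_S (k : nat) (x : X) : res (S k) x = sub_mul (res k x) (f (res k x) (e k)) (e k).
Proof. reflexivity. Qed.

Lemma e_unit (k : nat) : f (e k) (e k) = RtoC 1.
Proof.
  unfold e, next. set (r := residual _ _).
  assert (H : 0 < fst (f r r)) by apply (pickP (gs k)).
  rewrite f_scal, semi_scal_r, Cconj_R.
  pose proof (sqrt_lt_R0 _ H). pose proof (sqrt_sqrt (fst (f r r))) as H1.
  set (g := sqrt (fst (f r r))) in *.
  rewrite semi_self, <- H1, <- !RtoC_mult by lra. f_equal. field. lra.
Qed.

Lemma res_orth (k : nat) : forall i x, (i < k)%nat -> f (res k x) (e i) = RtoC 0.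
Proof.
  induction k; intros i x Hi; [lia|]. rewrite res_S, semi_sub_l.
  destruct (Nat.eq_dec i k) as [->|Hik].
  - rewrite e_unit. ring.
  - rewrite (IHk i x) by lia.
    assert (E : f (e k) (e i) = Cmult (RtoC (/ sqrt (fst (f (res k (s (pick (gs k)))) (res k (s (pick (gs k))))))))
      (f (res k (s (pick (gs k)))) (e i))) by apply f_scal.
    rewrite E, (IHk i (s (pick (gs k)))) by lia. ring.
Qed.

Lemma e_orth_lt (i k : nat) : (i < k)%nat -> f (e k) (e i) = RtoC 0.
Proof.
  intro H.
  assert (E : f (e k) (e i) = Cmult (RtoC (/ sqrt (fst (f (res k (s (pick (gs k)))) (res k (s (pick (gs k))))))))
    (f (res k (s (pick (gs k)))) (e i))) by apply f_scal.
  rewrite E, res_orth by auto. ring.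
Qed.

Lemma e_orth (i k : nat) : f (e i) (e k) = if Nat.eqb k i then RtoC 1 else RtoC 0.
Proof.
  destruct (Nat.eqb_spec k i) as [->|H]; [apply e_unit|].
  destruct (Nat.lt_ge_cases k i); [now apply e_orth_lt|].
  rewrite f_conj, e_orth_lt by lia. creq.
Qed.

Lemma res_e (k n : nat) (x : X) : (k <= n)%nat -> f (res k x) (e n) = f x (e n).
Proof.
  induction k; intro H; [reflexivity|].
  rewrite res_S, semi_sub_l, IHk, e_orth by lia.
  destruct (Nat.eqb_spec n k); [lia|]. ring.
Qed.

Lemma res_form_S (k : nat) (x y : X) : f (res (S k) x) (res (S k) y) =
  Cminus (f (res k x) (res k y)) (Cmult (f x (e k)) (Cconj (f y (e k)))).
Proof.
  rewrite !res_S, semi_sub_l, !semi_sub_r, !res_e, e_unit by lia.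
  rewrite (f_conj (res k y) (e k)), res_e by lia. ring.
Qed.

(** Additivity cannot be stated in [X] itself; under [f] it follows by induction, because each step
    removes a rank-one term that is additive in [x]. *)
Lemma res_add (k : nat) (x y z : X) : f (res k (add x y)) (res k z) =
  Cplus (f (res k x) (res k z)) (f (res k y) (res k z)).
Proof.
  induction k; [apply f_add|]. rewrite !res_form_S, IHk, f_add. ring.
Qed.

Lemma res_scal (k : nat) (a : C) (x z : X) : f (res k (scal a x)) (res k z) =
  Cmult a (f (res k x) (res k z)).
Proof.
  induction k; [apply f_scal|]. rewrite !res_form_S, IHk, f_scal. ring.
Qed.

Lemma res_norm_S (k : nat) (x : X) : fst (f (res (S k) x) (res (S k) x)) =
  fst (f (res k x) (res k x)) - Cmod (f x (e k)) ^ 2.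
Proof. rewrite res_form_S, Cmult_conj_self. reflexivity. Qed.

Lemma res_norm_decr (k : nat) (x : X) :
  fst (f (res (S k) x) (res (S k) x)) <= fst (f (res k x) (res k x)).
Proof. rewrite res_norm_S. pose proof (pow2_ge_0 (Cmod (f x (e k)))). lra. Qed.

Lemma res_norm_le (k : nat) (x : X) : fst (f (res k x) (res k x)) <= fst (f x x).
Proof. induction k; [apply Rle_refl|]. pose proof (res_norm_decr k x). lra. Qed.

(* [pick] takes the least index whose residual is not null, so after [k] steps the first [k]
   vectors of [s] are exhausted. *)
Lemma res_s (k j : nat) : (j < k)%nat -> fst (f (res k (s j)) (res k (s j))) = 0.
Proof.
  revert j. induction k; intros j Hj; [lia|].
  assert (H0 : fst (f (res k (s j)) (res k (s j))) = 0 \/ pick (gs k) = j).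
  { destruct (Nat.lt_ge_cases j k) as [H|H]; [left; apply IHk, H|].
    destruct (pickP (gs k)) as [P1 P2].
    destruct (Nat.lt_trichotomy j (pick (gs k))) as [L|[L|L]]; auto.
    - left. specialize (P2 j L). pose proof (f_pos (res k (s j))). unfold res in *. lra.
    - exfalso. assert (pick (gs k) < k)%nat as L' by lia. specialize (IHk _ L').
      unfold res in IHk. lra. }
  destruct H0 as [H0|H0].
  - pose proof (res_norm_decr k (s j)). pose proof (f_pos (res (S k) (s j))). lra.
  - rewrite res_norm_S. rewrite <- (res_e k k) by lia.
    unfold e, next. rewrite H0. fold (res k (s j)). set (r := res k (s j)).
    assert (H : 0 < fst (f r r)) by (unfold r, res; rewrite <- H0; apply (pickP (gs k))).
    rewrite semi_scal_r, Cconj_R.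
    pose proof (sqrt_lt_R0 _ H). pose proof (sqrt_sqrt (fst (f r r))) as Hg.
    set (g := sqrt (fst (f r r))) in *.
    rewrite (semi_self r), <- RtoC_mult, Cmod_R, <- Rsqr_pow2, <- Rsqr_abs.
    cbn [fst RtoC]. unfold Rsqr. rewrite <- Hg by lra. field. lra.
Qed.

Definition approximable (x : X) : Prop :=
  forall eps, 0 < eps -> exists j, fst (f (add x (scal (RtoC (-1)) (s j))) (add x (scal (RtoC (-1)) (s j)))) < eps.

Lemma res_lim (x : X) : approximable x ->
  forall eps, 0 < eps -> exists K, forall k, (K <= k)%nat -> fst (f (res k x) (res k x)) < eps.
Proof.
  intros Hx eps He. destruct (Hx (eps / 2)) as [j Hj]; [lra|]. exists (S j). intros k Hk.
  pose proof (res_s k j Hk) as Hs.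
  pose proof (res_norm_le k (add x (scal (RtoC (-1)) (s j)))) as H1.
  (* The residual of [s j] is null, so the norm of the residual of x + a s_j is affine in a.
     Positivity at a = -2 controls the cross term, and smallness at a = -1 then bounds the value at
     a = 0. *)
  pose proof (f_pos (res k (add x (scal (RtoC (-2)) (s j))))) as H2.
  assert (R : forall a, fst (f (res k (add x (scal (RtoC a) (s j)))) (res k (add x (scal (RtoC a) (s j))))) =
    fst (f (res k x) (res k x)) + 2 * a * fst (f (res k x) (res k (s j))) +
    a * a * fst (f (res k (s j)) (res k (s j)))).
  { intro a. rewrite res_add, res_scal, (f_conj _ (res k x)), (f_conj _ (res k (s j))).
    rewrite !res_add, !res_scal, (f_conj (res k x) (res k (s j))). c2r. ring. }
  rewrite R in H1, H2. lra.
Qed.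

Let crd (x : X) : vec := fun n => f x (e n).

Lemma nsq_trunc_crd (k : nat) (x : X) :
  nsq (trunc k (crd x)) = fst (f x x) - fst (f (res k x) (res k x)).
Proof.
  induction k; [rewrite nsq_trunc_0; unfold res; simpl; ring|].
  rewrite nsq_trunc_S, IHk, res_norm_S. unfold crd. ring.
Qed.

Lemma inH_crd (x : X) : inH (crd x).
Proof.
  apply inH_of_bound with (fst (f x x)). intro N. rewrite nsq_trunc_crd.
  pose proof (f_pos (res N x)). lra.
Qed.

Lemma ip_trunc_crd (k : nat) (x y : X) :
  ip (trunc k (crd x)) (crd y) = Cminus (f x y) (f (res k x) (res k y)).
Proof.
  pose proof (inH_crd x). pose proof (inH_crd y).
  induction k.
  - unfold res, trunc. simpl. unfold ip, CSeries. apply C_eq; cbn [fst snd].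
    + rewrite Series_0; [c2r; ring|]. intro n. c2r. ring.
    + rewrite Series_0; [c2r; ring|]. intro n. c2r. ring.
  - rewrite trunc_S, ip_add_l, IHk, ip_scal_l, (ip_conj (crd y)), ip_delta, res_form_S by hh.
    unfold crd. ring.
Qed.

(** Parseval. The defect is the pairing of the tail of [crd x] with [crd y], minus the pairing of
    the two residuals; by Cauchy-Schwarz both are small as soon as [x] alone is approximable. *)
Lemma ip_crd (x y : X) : approximable x -> ip (crd x) (crd y) = f x y.
Proof.
  intro Hx. apply Ceq_minus. apply Cmod_sq_small with (2 * nsq (crd y) + 2 * fst (f y y)).
  intros eps He. pose proof (inH_crd x) as Ix. pose proof (inH_crd y) as Iy.
  destruct (res_lim x Hx eps He) as [K1 HK1].
  pose proof (nsq_trunc_lim (crd x) Ix) as L. apply is_lim_seq_spec in L.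
  destruct (L (mkposreal eps He)) as [K2 HK2].
  set (k := max K1 K2). specialize (HK1 k (Nat.le_max_l _ _)).
  specialize (HK2 k (Nat.le_max_r _ _)). simpl in HK2. rewrite Rminus_0_r in HK2.
  apply Rabs_lt_between in HK2.
  replace (Cminus (ip (crd x) (crd y)) (f x y)) with
    (Cplus (ip (vdiff (crd x) (trunc k (crd x))) (crd y)) (Copp (f (res k x) (res k y)))).
  - eapply Rle_trans; [apply Cmod_sq_add|]. rewrite Cmod_opp.
    pose proof (ip_cauchy_schwarz (vdiff (crd x) (trunc k (crd x))) (crd y)
      (inH_vdiff _ _ Ix (inH_trunc _ _)) Iy).
    pose proof (semi_cauchy_schwarz (res k x) (res k y)).
    pose proof (res_norm_le k y). pose proof (f_pos (res k x)). pose proof (f_pos (res k y)).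
    pose proof (nsq_ge_0 (crd y) Iy).
    pose proof (nsq_ge_0 _ (inH_vdiff _ _ Ix (inH_trunc k (crd x)))). nra.
  - unfold vdiff. rewrite ip_add_l, ip_scal_l, ip_trunc_crd by hh. creq.
Qed.

(** Each [delta n] is the exact image of a Gram-Schmidt vector, not just a limit. Hence the
    generators span the coordinate vectors algebraically, which is what [gram_unitary] asks for. *)
Theorem hilbert_coordinates : exists crd : X -> vec,
  (forall x, inH (crd x)) /\
  (forall x y, crd (add x y) = vadd (crd x) (crd y)) /\
  (forall a x, crd (scal a x) = vscal a (crd x)) /\
  (forall n, exists x, delta n = crd x) /\
  (forall x y, approximable x -> ip (crd x) (crd y) = f x y).
Proof.
  exists crd. split; [exact inH_crd|]. repeat split.
  - intros. unfold crd. vext. apply f_add.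
  - intros. unfold crd. vext. apply f_scal.
  - intro n. exists (e n). apply functional_extensionality. intro m. unfold delta, crd. symmetry. apply e_orth.
  - exact ip_crd.
Qed.

End GramSchmidt.

Ltac Bexp := repeat first [rewrite B_add_l by hh | rewrite B_add_r by hh | rewrite B_scal_l by hh | rewrite B_scal_r by hh].

(** * Isometries of the form *)

Lemma uni_inH T u : unitaryB T -> inH u -> inH (T u).
Proof. intros (H & _). apply H. Qed.
#[local] Hint Resolve uni_inH : inH.

Lemma uni_lin T a u v : unitaryB T -> inH u -> inH v ->
  T (vadd (vscal a u) v) = vadd (vscal a (T u)) (T v).
Proof. intros (_ & H & _). apply H. Qed.

Lemma uni_B T u v : unitaryB T -> inH u -> inH v -> B (T u) (T v) = B u v.
Proof. intros (_ & _ & _ & _ & H). apply H. Qed.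

Lemma uni_surj T w : unitaryB T -> inH w -> exists u, inH u /\ T u = w.
Proof. intros (_ & _ & _ & H & _). apply H. Qed.

Lemma uni_lincomb {I : Type} T (v : I -> vec) l : unitaryB T -> (forall i, inH (v i)) ->
  T (lincomb v l) = lincomb (fun i => T (v i)) l.
Proof. intros H Hv. apply lin_lincomb; auto. intros. now apply uni_lin. Qed.

Lemma uni_vzero T : unitaryB T -> T vzero = vzero.
Proof. intro H. exact (uni_lincomb T delta nil H inH_delta). Qed.

Lemma uni_vscal T a u : unitaryB T -> inH u -> T (vscal a u) = vscal a (T u).
Proof.
  intros H Hu. rewrite <- (vadd_0_r (vscal a u)), uni_lin, uni_vzero, vadd_0_r by hh. reflexivity.
Qed.

Lemma uni_vadd T u v : unitaryB T -> inH u -> inH v -> T (vadd u v) = vadd (T u) (T v).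
Proof.
  intros H Hu Hv. rewrite <- (vscal_1 u) at 1. now rewrite uni_lin, vscal_1.
Qed.

Lemma uni_vdiff T u v : unitaryB T -> inH u -> inH v -> T (vdiff u v) = vdiff (T u) (T v).
Proof. intros. unfold vdiff. now rewrite uni_vadd, uni_vscal by hh. Qed.

(** By nsq w = 2|w_0|^2 - B(w,w), only the 0-th coordinate can grow under an isometry. That
    coordinate of [T u] is [B u q] with [T q = delta 0], and the same identity gives [q] the norm of
    [T (delta 0)]. The explicit constant later yields bounds uniform over families of operators. *)
Lemma uni_bound_aux T :
  (forall u, inH u -> inH (T u)) ->
  (forall w, inH w -> exists u, inH u /\ T u = w) ->
  (forall u v, inH u -> inH v -> B (T u) (T v) = B u v) ->
  forall u, inH u -> nsq (T u) <= (8 * nsq (T (delta 0)) + 1) * nsq u.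
Proof.
  intros HH Hs HB u Hu. destruct (Hs (delta 0)) as (q & Hq & Eq); [hh|].
  assert (D : forall w, inH w -> w 0%nat = B w (delta 0)) by (intros; rewrite B_delta; simpl; ring).
  assert (E1 : T u 0%nat = B u q) by (rewrite D, <- Eq, HB by hh; reflexivity).
  assert (E2 : nsq q = nsq (T (delta 0))).
  { rewrite !nsq_B by hh. rewrite HB by hh. rewrite (D q), (D (T (delta 0))) by hh.
    rewrite <- (HB q (delta 0)), Eq, (B_conj (T (delta 0))), Cmod_conj by hh.
    f_equal. rewrite <- (HB q q), Eq by hh. reflexivity. }
  rewrite nsq_B, E1, HB by hh. rewrite <- E2.
  pose proof (B_bound u q Hu Hq). pose proof (nsq_B u Hu).
  pose proof (pow2_ge_0 (Cmod (u 0%nat))). lra.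
Qed.

Lemma uni_bound T u : unitaryB T -> inH u -> nsq (T u) <= (8 * nsq (T (delta 0)) + 1) * nsq u.
Proof. intros (H1 & _ & _ & H2 & H3). now apply uni_bound_aux. Qed.

Lemma unitaryB_intro T :
  (forall u, inH u -> inH (T u)) ->
  (forall a u v, inH u -> inH v -> T (vadd (vscal a u) v) = vadd (vscal a (T u)) (T v)) ->
  (forall w, inH w -> exists u, inH u /\ T u = w) ->
  (forall u v, inH u -> inH v -> B (T u) (T v) = B u v) -> unitaryB T.
Proof.
  intros H1 H2 H3 H4. repeat split; auto.
  apply hnorm_bound with (8 * nsq (T (delta 0)) + 1).
  - pose proof (nsq_ge_0 (T (delta 0)) (H1 _ (inH_delta 0))). lra.
  - now apply uni_bound_aux.
Qed.

Lemma unitaryB_id : unitaryB (fun u => u).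
Proof. apply unitaryB_intro; eauto. Qed.

Lemma unitaryB_comp S T : unitaryB S -> unitaryB T -> unitaryB (fun u => S (T u)).
Proof.
  intros HS HT. apply unitaryB_intro.
  - hh.
  - intros. now rewrite !uni_lin by hh.
  - intros w Hw. destruct (uni_surj S w HS Hw) as (u & Hu & <-).
    destruct (uni_surj T u HT Hu) as (u' & Hu' & <-). eauto.
  - intros. now rewrite !uni_B by hh.
Qed.

Lemma unit_conj (c : C) : Cmod c = 1 -> Cmult c (Cconj c) = RtoC 1.
Proof. intro H. rewrite Cmult_conj_self, H. f_equal. ring. Qed.

Lemma unit_conj_l (c : C) : Cmod c = 1 -> Cmod (Cconj c) = 1 /\ Cmult (Cconj c) c = RtoC 1.
Proof. intro H. rewrite Cmod_conj, Cmult_comm. split; auto. now apply unit_conj. Qed.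

Lemma unitaryB_scal c T : Cmod c = 1 -> unitaryB T -> unitaryB (fun u => vscal c (T u)).
Proof.
  intros Hc HT. apply unitaryB_intro.
  - hh.
  - intros. rewrite uni_lin by hh. vext. ring.
  - intros w Hw. destruct (uni_surj T (vscal (Cconj c) w) HT) as (u & Hu & E); [hh|].
    exists u. split; auto. rewrite E, vscal_vscal, unit_conj, vscal_1; auto.
  - intros. Bexp. rewrite uni_B by hh.
    rewrite Cmult_assoc, unit_conj by auto. ring.
Qed.

Lemma uni_inj T u v : unitaryB T -> inH u -> inH v -> T u = T v -> u = v.
Proof.
  intros HT Hu Hv E. apply vdiff_0, B_nondeg. intro m.
  rewrite <- (uni_B T), uni_vdiff, E by hh. unfold vdiff. Bexp. creq.
Qed.

Lemma vscal_inj (a b : C) (u : vec) : u <> vzero -> vscal a u = vscal b u -> a = b.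
Proof.
  intros Hu E. destruct (Ceq_dec a b) as [|N]; auto. exfalso. apply Hu.
  vext. assert (E' := f_equal (fun f => f x) E). cbv beta in E'. unfold vscal in E'.
  apply Ceq_minus in E'.
  destruct (Ceq_dec (u x) (RtoC 0)) as [|N2]; auto. exfalso.
  apply (Cmult_neq_0 (Cminus a b) (u x)); auto.
  - now apply Cminus_eq_contra.
  - rewrite <- E'. ring.
Qed.

(* Induction on [ws]: two solutions for the tail with disjoint supports combine into a
   solution for the whole list. *)
Lemma exists_orthogonal_supp (ws : list vec) : (forall w, In w ws -> inH w) -> forall N,
  exists z M, inH z /\ z <> vzero /\ (forall w, In w ws -> B z w = RtoC 0) /\
    (forall n, (n < N)%nat -> z n = RtoC 0) /\ (forall n, (M <= n)%nat -> z n = RtoC 0).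
Proof.
  induction ws as [|w ws IH]; intros Hws N.
  - exists (delta N), (S N). repeat split; hh.
    + intro E. apply (f_equal (fun f => f N)) in E. cbv beta in E. rewrite delta_eq in E.
      now apply C1_nz.
    + intros w [].
    + intros n Hn. apply delta_neq. lia.
    + intros n Hn. apply delta_neq. lia.
  - destruct (IH (fun w h => Hws w (or_intror h)) N) as (z1 & M1 & H1 & Z1 & O1 & L1 & R1).
    destruct (IH (fun w h => Hws w (or_intror h)) (max M1 N)) as (z2 & M2 & H2 & Z2 & O2 & L2 & R2).
    assert (Hw : inH w) by (apply Hws; left; reflexivity).
    assert (Hws' : forall v, In v ws -> inH v) by (intros v Hv; apply Hws; right; exact Hv).
    destruct (Ceq_dec (B z1 w) (RtoC 0)) as [E|E].
    + exists z1, M1. repeat split; auto. intros v [<-|Hv]; auto.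
    + exists (vadd (vscal (B z1 w) z2) (vscal (Copp (B z2 w)) z1)), (max M1 M2).
      repeat split; hh.
      * intro F. apply Z2. vext. assert (F' := f_equal (fun f => f x) F). cbv beta in F'.
        unfold vadd, vscal, vzero in F'.
        destruct (Nat.lt_ge_cases x (max M1 N)) as [Lt|Ge]; [now apply L2|].
        rewrite (R1 x) in F' by lia.
        destruct (Ceq_dec (z2 x) (RtoC 0)) as [|Nz]; auto. exfalso.
        apply (Cmult_neq_0 _ _ E Nz). rewrite <- F'. ring.
      * intros v [<-|Hv]; Bexp; [ring|]. rewrite (O1 v), (O2 v) by auto. ring.
      * intros n Hn. unfold vadd, vscal. rewrite L1, L2 by lia. ring.
      * intros n Hn. unfold vadd, vscal. rewrite R1, R2 by lia. ring.
Qed.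

Lemma exists_orthogonal (ws : list vec) : (forall w, In w ws -> inH w) ->
  exists z, inH z /\ z <> vzero /\ forall w, In w ws -> B z w = RtoC 0.
Proof.
  intro H. destruct (exists_orthogonal_supp ws H 0) as (z & _ & H1 & H2 & H3 & _). eauto.
Qed.

(** * Isotropic pairs *)

Definition hyp_pair (eta1 eta2 : vec) : Prop :=
  isotropic eta1 /\ isotropic eta2 /\ B eta1 eta2 = RtoC 1.

Lemma B_nonpos (p e : vec) : inH p -> inH e -> 0 < fst (B p p) -> B e p = RtoC 0 ->
  fst (B e e) <= 0.
Proof.
  intros Hp He H1 H2. destruct (Rle_lt_dec 0 (fst (B e e))) as [H|H]; [|lra].
  rewrite (B_neg p e) by auto. rewrite B_vzero_l by hh. simpl. lra.
Qed.

Lemma B_neg_cauchy_schwarz (p e w : vec) : inH p -> inH e -> inH w -> 0 < fst (B p p) ->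
  B e p = RtoC 0 -> B w p = RtoC 0 -> Cmod (B e w) ^ 2 <= fst (B e e) * fst (B w w).
Proof.
  intros Hp He Hw H1 H2 H3.
  replace (fst (B e e) * fst (B w w)) with ((- fst (B e e)) * (- fst (B w w))) by ring.
  pose proof (B_nonpos p w Hp Hw H1 H3).
  apply quad_discr; [lra | apply pow2_ge_0 |]. intro r.
  assert (H4 := B_nonpos p (vadd e (vscal (Cmult (RtoC r) (B e w)) w)) Hp ltac:(hh) H1).
  revert H4. Bexp. rewrite H2, H3, (B_conj e w), (B_self_fst e), (B_self_fst w), Cmod_sq.
  intro H4. assert (H5 := H4 ltac:(ring)). clear H4. destruct (B e w) as [x y]. c2r. lra.
Qed.

Section Pair.
Context (eta1 eta2 : vec) (Hpair : hyp_pair eta1 eta2).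

Lemma pair_inH1 : inH eta1.
Proof. apply Hpair. Qed.
Lemma pair_inH2 : inH eta2.
Proof. apply Hpair. Qed.
Hint Resolve pair_inH1 pair_inH2 : inH.

Lemma pair_11 : B eta1 eta1 = RtoC 0.
Proof. apply Hpair. Qed.
Lemma pair_22 : B eta2 eta2 = RtoC 0.
Proof. apply Hpair. Qed.
Lemma pair_12 : B eta1 eta2 = RtoC 1.
Proof. apply Hpair. Qed.
Lemma pair_21 : B eta2 eta1 = RtoC 1.
Proof. rewrite B_conj, pair_12. creq. Qed.
Lemma pair_nz1 : eta1 <> vzero.
Proof. apply Hpair. Qed.
Lemma pair_nz2 : eta2 <> vzero.
Proof. apply Hpair. Qed.

Definition perp (v : vec) : vec :=
  vadd v (vadd (vscal (Copp (B v eta2)) eta1) (vscal (Copp (B v eta1)) eta2)).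

Lemma inH_perp v : inH v -> inH (perp v).
Proof. unfold perp. hh. Qed.
Hint Resolve inH_perp : inH.

Lemma perp_1 v : inH v -> B (perp v) eta1 = RtoC 0.
Proof. intro. unfold perp. Bexp. rewrite pair_11, pair_21. ring. Qed.
Lemma perp_2 v : inH v -> B (perp v) eta2 = RtoC 0.
Proof. intro. unfold perp. Bexp. rewrite pair_22, pair_12. ring. Qed.

Lemma perp_decomp v :
  v = vadd (vadd (vscal (B v eta2) eta1) (vscal (B v eta1) eta2)) (perp v).
Proof. unfold perp. vext. ring. Qed.

(** A positive vector orthogonal to E, which makes E negative definite. *)
Lemma pair_pos : 0 < fst (B (vadd eta1 eta2) (vadd eta1 eta2)).
Proof. Bexp. rewrite pair_11, pair_12, pair_21, pair_22. simpl. lra. Qed.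

Definition ortho (e : vec) : Prop := inH e /\ B e eta1 = RtoC 0 /\ B e eta2 = RtoC 0.

Lemma ortho_perp v : inH v -> ortho (perp v).
Proof. intro. repeat split; [hh | now apply perp_1 | now apply perp_2]. Qed.

Lemma ortho_sum e : ortho e -> B e (vadd eta1 eta2) = RtoC 0.
Proof. intros (H & H1 & H2). Bexp. rewrite H1, H2. ring. Qed.

Lemma ortho_nonpos e : ortho e -> fst (B e e) <= 0.
Proof.
  intro H. apply B_nonpos with (vadd eta1 eta2); [hh | apply H | apply pair_pos | now apply ortho_sum].
Qed.

Lemma ortho_zero e : ortho e -> 0 <= fst (B e e) -> e = vzero.
Proof.
  intros H H0. apply B_neg with (vadd eta1 eta2); auto; [hh | apply H | apply pair_pos | now apply ortho_sum].
Qed.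

Lemma ortho_cs e w : ortho e -> ortho w -> Cmod (B e w) ^ 2 <= fst (B e e) * fst (B w w).
Proof.
  intros H H'. apply B_neg_cauchy_schwarz with (vadd eta1 eta2);
    [hh | apply H | apply H' | apply pair_pos | now apply ortho_sum | now apply ortho_sum].
Qed.

Lemma B_decomp v w : inH v -> inH w ->
  B v w = Cplus (Cplus (Cmult (B v eta2) (Cconj (B w eta1))) (Cmult (B v eta1) (Cconj (B w eta2))))
                (B (perp v) (perp w)).
Proof.
  intros Hv Hw. rewrite (perp_decomp v) at 1. rewrite (perp_decomp w) at 1.
  Bexp. rewrite pair_11, pair_22, pair_12, pair_21, perp_1, perp_2 by hh.
  rewrite (B_conj (perp w) eta1), (B_conj (perp w) eta2), perp_1, perp_2 by hh.
  conjs. rewrite Cconj_R. ring.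
Qed.

Context (T : vec -> vec) (alpha beta : C) (HT : unitaryB T)
  (T1 : T eta1 = vscal alpha eta1) (T2 : T eta2 = vscal beta eta2).

Lemma axis_ab : Cmult alpha (Cconj beta) = RtoC 1.
Proof.
  rewrite <- pair_12, <- (uni_B T), T1, T2 by hh. Bexp. rewrite pair_12. ring.
Qed.

Lemma axis_alpha_nz : alpha <> RtoC 0.
Proof. intro E. pose proof axis_ab as H. rewrite E in H. apply C1_nz. rewrite <- H. ring. Qed.

Lemma axis_mod : 0 < Cmod alpha.
Proof. apply Cmod_gt_0, axis_alpha_nz. Qed.

Lemma axis_beta : beta = Cmult (RtoC (/ Cmod alpha ^ 2)) alpha.
Proof.
  pose proof axis_mod. assert (Cmod alpha ^ 2 <> 0) by (apply pow_nonzero; lra).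
  assert (E : Cmult (RtoC (Cmod alpha ^ 2)) beta = alpha).
  { rewrite <- Cmult_conj_self. pose proof (f_equal Cconj axis_ab) as H1.
    rewrite Cmult_conj, Cconj_conj, Cconj_R in H1.
    rewrite <- Cmult_assoc, H1. ring. }
  rewrite <- E at 2. rewrite Cmult_assoc, <- RtoC_mult, Rinv_l by auto. ring.
Qed.

Lemma axis_coord2 v : inH v -> B (T v) eta2 = Cmult alpha (B v eta2).
Proof.
  intro Hv. pose proof (uni_B T v eta2 HT Hv ltac:(hh)) as H. rewrite T2, B_scal_r in H by hh.
  rewrite <- H, Cmult_assoc, axis_ab. ring.
Qed.

Lemma axis_coord1 v : inH v -> B (T v) eta1 = Cmult beta (B v eta1).
Proof.
  intro Hv. pose proof (uni_B T v eta1 HT Hv ltac:(hh)) as H. rewrite T1, B_scal_r in H by hh.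
  rewrite <- H, Cmult_assoc. pose proof (f_equal Cconj axis_ab) as H1.
  rewrite Cmult_conj, Cconj_conj, Cconj_R, Cmult_comm in H1. rewrite H1. ring.
Qed.

Lemma axis_perp v : inH v -> perp (T v) = T (perp v).
Proof.
  intro Hv. unfold perp. rewrite axis_coord1, axis_coord2, !(uni_vadd T), !(uni_vscal T), T1, T2 by hh.
  vext. ring.
Qed.

(** Put a = |alpha|, z = B(v,eta2) conj B(v,eta1), and let e be the part of v in E. Then B(v,v) = 2
    Re z + B(e,e), while |B(Tv,v)| >= (a + 1/a) Re z + B(e,e). Since B(e,e) <= 0 and (a + 1/a)/2 >=
    1, the bound follows. *)
Lemma axis_lower v : posv v -> (Cmod alpha + / Cmod alpha) / 2 * fst (B v v) <= Cmod (B (T v) v).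
Proof.
  intros [Hv Hpos]. pose proof axis_mod as Ha. set (a := Cmod alpha) in *.
  pose proof (ortho_perp v Hv) as He. pose proof (ortho_nonpos _ He) as Hs.
  set (e := perp v) in *. set (z := Cmult (B v eta2) (Cconj (B v eta1))).
  assert (Ev : fst (B v v) = 2 * fst z + fst (B e e)).
  { rewrite (B_decomp v v) by auto. fold e. unfold z. c2r. ring. }
  assert (Et : B (T v) v = Cplus (Cmult alpha (Cplus z (Cmult (RtoC (/ a ^ 2)) (Cconj z)))) (B (T e) e)).
  { rewrite (B_decomp (T v) v), axis_perp, axis_coord1, axis_coord2, axis_beta by hh.
    fold e a. unfold z. conjs. ring. }
  assert (HTe : ortho (T e)).
  { unfold e. rewrite <- axis_perp by auto. apply ortho_perp. hh. }
  assert (H1 : Cmod (B (T e) e) <= - fst (B e e)).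
  { pose proof (ortho_cs _ _ HTe He) as H. assert (He0 : inH e) by apply He.
    rewrite (uni_B T e e HT He0 He0) in H.
    pose proof (Cmod_ge_0 (B (T e) e)). nra. }
  assert (H2 : a * ((1 + / a ^ 2) * fst z) <=
     Cmod (Cmult alpha (Cplus z (Cmult (RtoC (/ a ^ 2)) (Cconj z))))).
  { rewrite Cmod_mult. fold a. apply Rmult_le_compat_l; [lra|].
    eapply Rle_trans; [|apply re_le_Cmod]. eapply Rle_trans; [|apply Rle_abs].
    unfold Re. c2r. lra. }
  assert (H3 : Cmod (B (T v) v) >= a * ((1 + / a ^ 2) * fst z) + fst (B e e)).
  { pose proof (Cmod_triangle (B (T v) v) (Copp (B (T e) e))) as H.
    rewrite Cmod_opp, Et in H at 1.
    replace (Cplus (Cplus (Cmult alpha (Cplus z (Cmult (RtoC (/ a ^ 2)) (Cconj z)))) (B (T e) e)) (Copp (B (T e) e)))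
      with (Cmult alpha (Cplus z (Cmult (RtoC (/ a ^ 2)) (Cconj z)))) in H by ring.
    lra. }
  replace (a * ((1 + / a ^ 2) * fst z)) with ((a + / a) * fst z) in H3 by (field; lra).
  assert (2 <= a + / a).
  { apply Rmult_le_reg_r with a; auto. replace ((a + / a) * a) with (a * a + 1) by (field; lra).
    pose proof (pow2_ge_0 (a - 1)). lra. }
  rewrite Ev. nra.
Qed.

Lemma axis_attained : Cmod (B (T (vadd eta1 eta2)) (vadd eta1 eta2)) = Cmod alpha + / Cmod alpha.
Proof.
  pose proof axis_mod as Ha.
  rewrite (uni_vadd T), T1, T2 by hh. Bexp. rewrite pair_11, pair_12, pair_21, pair_22, axis_beta.
  replace (Cplus (Cplus (Cmult alpha 0) (Cmult alpha 1)) _)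
    with (Cmult alpha (RtoC (1 + / Cmod alpha ^ 2))) by (rewrite RtoC_plus; ring).
  assert (0 < / Cmod alpha ^ 2) by (apply Rinv_0_lt_compat, pow_lt, Ha).
  rewrite Cmod_mult, Cmod_R, Rabs_pos_eq by lra. field. lra.
Qed.

(** A hyperbolic isometry fixes only the ends of its axis in the closed ball. If both coordinates of
    [v] were nonzero, then c = alpha = beta and |alpha| = 1. Once one of them is zero, the part of
    [v] in E has non-negative norm and vanishes. *)
Lemma axis_eigen (c : C) v : Cmod alpha <> 1 -> inH v -> v <> vzero -> 0 <= fst (B v v) ->
  T v = vscal c v -> propto v eta1 \/ propto v eta2.
Proof.
  intros Ha Hv Hnz Hpos E.
  pose proof (axis_coord1 v Hv) as E1. pose proof (axis_coord2 v Hv) as E2.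
  rewrite E, B_scal_l in E1, E2 by hh.
  assert (F : B v eta1 = RtoC 0 \/ B v eta2 = RtoC 0).
  { destruct (Ceq_dec (B v eta1) (RtoC 0)) as [|N1]; auto.
    destruct (Ceq_dec (B v eta2) (RtoC 0)) as [|N2]; auto. exfalso. apply Ha.
    assert (c = beta).
    { replace c with (Cmult (Cmult c (B v eta1)) (Cinv (B v eta1))) by (field; auto).
      rewrite E1. field. auto. }
    assert (c = alpha).
    { replace c with (Cmult (Cmult c (B v eta2)) (Cinv (B v eta2))) by (field; auto).
      rewrite E2. field. auto. }
    pose proof axis_ab as H1. rewrite <- H, H0, Cmult_conj_self in H1. apply RtoC_inj in H1.
    pose proof axis_mod. nra. }
  assert (Z : perp v = vzero).
  { apply ortho_zero; [now apply ortho_perp|]. rewrite B_decomp in Hpos by auto.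
    destruct F as [F|F]; rewrite F in Hpos; c2r; lra. }
  pose proof (perp_decomp v) as D. rewrite Z in D.
  destruct F as [F|F]; rewrite F in D.
  - left. exists (B v eta2). rewrite D at 1. vext. ring.
  - right. exists (B v eta1). rewrite D at 1. vext. ring.
Qed.

End Pair.

Lemma acosh_1_le x y : 1 <= x -> x <= y -> acosh x <= acosh y.
Proof.
  intros Hx Hy. unfold acosh.
  assert (sqrt (x * x - 1) <= sqrt (y * y - 1)) by (apply sqrt_le_1_alt; nra).
  pose proof (sqrt_pos (x * x - 1)).
  destruct (Req_dec (x + sqrt (x * x - 1)) (y + sqrt (y * y - 1))) as [->|N]; [lra|].
  left. apply ln_increasing; lra.
Qed.

Lemma acosh_mean a : 0 < a -> acosh ((a + / a) / 2) = Rabs (ln a).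
Proof.
  assert (K : forall b, 1 <= b -> acosh ((b + / b) / 2) = Rabs (ln b)).
  { intros b Hb. unfold acosh.
    replace ((b + / b) / 2 * ((b + / b) / 2) - 1) with (((b - / b) / 2) ^ 2) by (field; lra).
    assert (/ b <= 1) by (apply Rmult_le_reg_l with b; [lra | rewrite Rinv_r; lra]).
    rewrite sqrt_pow2 by lra. replace ((b + / b) / 2 + (b - / b) / 2) with b by (field; lra).
    rewrite Rabs_pos_eq; auto. rewrite <- ln_1.
    destruct (Req_dec b 1) as [->|]; [lra|]. left. apply ln_increasing; lra. }
  intro Ha. destruct (Rle_lt_dec 1 a) as [H|H]; auto.
  rewrite <- Rabs_Ropp, <- ln_Rinv by auto. rewrite <- K.
  - rewrite Rinv_inv. f_equal. lra.
  - apply Rmult_le_reg_l with a; [lra | rewrite Rinv_r; lra].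
Qed.

Lemma hdist_self T v : unitaryB T -> posv v ->
  hdist (T v) v = acosh (Cmod (B (T v) v) / fst (B v v)).
Proof.
  intros HT [Hv Hp]. unfold hdist. rewrite uni_B, sqrt_square by (auto; lra). reflexivity.
Qed.

Lemma translen_axis eta1 eta2 T alpha beta : hyp_pair eta1 eta2 -> unitaryB T ->
  T eta1 = vscal alpha eta1 -> T eta2 = vscal beta eta2 ->
  translen T = Finite (Rabs (ln (Cmod alpha))).
Proof.
  intros HP HT T1 T2. pose proof (axis_mod _ _ HP T alpha beta HT T1 T2) as Ha.
  rewrite <- acosh_mean by auto. unfold translen. apply is_glb_Rbar_unique. split.
  - intros r (v & Hv & ->). simpl. rewrite hdist_self by auto.
    pose proof (axis_lower _ _ HP T alpha beta HT T1 T2 v Hv).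
    apply acosh_1_le.
    + apply Rmult_le_reg_r with (2 * Cmod alpha); [lra|].
      replace ((Cmod alpha + / Cmod alpha) / 2 * (2 * Cmod alpha)) with (Cmod alpha * Cmod alpha + 1)
        by (field; lra). pose proof (pow2_ge_0 (Cmod alpha - 1)). lra.
    + destruct Hv as [Hv Hp]. apply Rmult_le_reg_r with (fst (B v v)); auto.
      unfold Rdiv at 2. rewrite Rmult_assoc, Rinv_l, Rmult_1_r by lra. auto.
  (* The infimum is attained on the axis, at the line of [vadd eta1 eta2]. *)
  - intros b Hb. apply Hb. exists (vadd eta1 eta2).
    assert (Hp : posv (vadd eta1 eta2)).
    { split; [|now apply pair_pos]. destruct HP as ((H1 & _) & (H2 & _) & _). hh. }
    split; auto. rewrite hdist_self by auto.
    rewrite (axis_attained _ _ HP T alpha beta HT T1 T2). f_equal. f_equal.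
    destruct HP as ((H1 & _ & E1) & (H2 & _ & E2) & E12). Bexp.
    rewrite E1, E2, E12, (B_conj eta1 eta2), E12. simpl. ring.
Qed.

(** * SU(1,1) as SL(2,R) *)

(* The basis (i xi1, xi2) conjugates SU(1,1) to SL(2,R), and [gLB lam b] to the
   upper triangular matrix with entries [lam, b, 0, / lam]. *)
Definition of_mat (a b c d : R) : SU11 :=
  (((a + d) / 2, (b - c) / 2), ((a - d) / 2, - (b + c) / 2)).
Definition mA (g : SU11) : R := fst (fst g) + fst (snd g).
Definition mB (g : SU11) : R := snd (fst g) - snd (snd g).
Definition mC (g : SU11) : R := - (snd (fst g) + snd (snd g)).
Definition mD (g : SU11) : R := fst (fst g) - fst (snd g).

Lemma SU11_eq (g h : SU11) : mA g = mA h -> mB g = mB h -> mC g = mC h -> mD g = mD h -> g = h.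
Proof.
  destruct g as [[a1 a2] [b1 b2]], h as [[c1 c2] [d1 d2]]. unfold mA, mB, mC, mD. simpl.
  intros. f_equal; f_equal; lra.
Qed.

Lemma mat_of_mat (a b c d : R) :
  mA (of_mat a b c d) = a /\ mB (of_mat a b c d) = b /\
  mC (of_mat a b c d) = c /\ mD (of_mat a b c d) = d.
Proof. unfold mA, mB, mC, mD, of_mat. simpl. repeat split; field. Qed.

Lemma of_mat_eta (g : SU11) : g = of_mat (mA g) (mB g) (mC g) (mD g).
Proof. apply SU11_eq; symmetry; apply mat_of_mat. Qed.

Lemma inSU11_det (g : SU11) : inSU11 g <-> mA g * mD g - mB g * mC g = 1.
Proof.
  unfold inSU11. rewrite !Cmod_sq. destruct g as [[a1 a2] [b1 b2]]. unfold mA, mB, mC, mD. simpl.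
  split; intro; lra.
Qed.

Lemma mA_mul g h : mA (su_mul g h) = mA g * mA h + mB g * mC h.
Proof. destruct g as [[? ?] [? ?]], h as [[? ?] [? ?]]. unfold mA, mB, mC, mD, su_mul. c2r. ring. Qed.
Lemma mB_mul g h : mB (su_mul g h) = mA g * mB h + mB g * mD h.
Proof. destruct g as [[? ?] [? ?]], h as [[? ?] [? ?]]. unfold mA, mB, mC, mD, su_mul. c2r. ring. Qed.
Lemma mC_mul g h : mC (su_mul g h) = mC g * mA h + mD g * mC h.
Proof. destruct g as [[? ?] [? ?]], h as [[? ?] [? ?]]. unfold mA, mB, mC, mD, su_mul. c2r. ring. Qed.
Lemma mD_mul g h : mD (su_mul g h) = mC g * mB h + mD g * mD h.
Proof. destruct g as [[? ?] [? ?]], h as [[? ?] [? ?]]. unfold mA, mB, mC, mD, su_mul. c2r. ring. Qed.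

Lemma inSU11_mul g h : inSU11 g -> inSU11 h -> inSU11 (su_mul g h).
Proof.
  rewrite !inSU11_det, mA_mul, mB_mul, mC_mul, mD_mul. intros H1 H2.
  replace 1 with ((mA g * mD g - mB g * mC g) * (mA h * mD h - mB h * mC h)) by (rewrite H1, H2; ring).
  ring.
Qed.

Lemma gLB_of_mat lam b : gLB lam b = of_mat lam b 0 (/ lam).
Proof. unfold gLB, of_mat. f_equal; f_equal; field || (unfold Rdiv; ring). Qed.

(** The Weyl element, acting on the boundary line by x -> -1/x. *)
Definition suW : SU11 := of_mat 0 (-1) 1 0.

Ltac mats := rewrite ?mA_mul, ?mB_mul, ?mC_mul, ?mD_mul, ?gLB_of_mat;
  unfold mA, mB, mC, mD, of_mat, suW, su_one, su_mone, gLB; simpl.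

Lemma inSU11_gLB lam b : lam <> 0 -> inSU11 (gLB lam b).
Proof. intro H. apply inSU11_det. mats. field. auto. Qed.

Lemma inSU11_W : inSU11 suW.
Proof. apply inSU11_det. mats. field. Qed.

Lemma inSU11_one : inSU11 su_one.
Proof. apply inSU11_det. mats. ring. Qed.

Lemma inSU11_mone : inSU11 su_mone.
Proof. apply inSU11_det. mats. ring. Qed.

Lemma upper_pos g : inSU11 g -> mC g = 0 -> 0 < mA g -> g = gLB (mA g) (mB g).
Proof.
  intros H Hc Ha. apply inSU11_det in H. rewrite Hc in H.
  rewrite (of_mat_eta g) at 1. rewrite gLB_of_mat, Hc. f_equal.
  apply Rmult_eq_reg_l with (mA g); [|lra]. rewrite Rinv_r; lra.
Qed.

Lemma upper_neg g : inSU11 g -> mC g = 0 -> mA g < 0 ->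
  g = su_mul su_mone (gLB (- mA g) (- mB g)).
Proof.
  intros H Hc Ha. apply inSU11_det in H. rewrite Hc in H.
  assert (E : mD g = / mA g) by (apply Rmult_eq_reg_l with (mA g); [rewrite Rinv_r; lra|lra]).
  set (a := mA g) in *. set (b := mB g) in *.
  apply SU11_eq; fold a b; rewrite ?Hc, ?E; mats; field; lra.
Qed.

(** For [g] with entries a, b, c, d, multiplying on the left by the translation by -a/c kills the
    upper left entry; what remains is [suW] times this matrix. *)
Definition upperC (g : SU11) : SU11 := of_mat (mC g) (mD g) 0 (/ mC g).

Lemma upperC_spec g : mC g <> 0 ->
  inSU11 (upperC g) /\ mC (upperC g) = 0.
Proof.
  intro H. unfold upperC. set (c := mC g) in *. set (d := mD g).
  split; [apply inSU11_det|]; mats; field; auto.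
Qed.

Lemma bruhat g : inSU11 g -> mC g <> 0 ->
  g = su_mul (gLB 1 (mA g / mC g)) (su_mul suW (upperC g)).
Proof.
  intros H Hc. apply inSU11_det in H. unfold upperC.
  assert (E : mB g = (mA g * mD g - 1) / mC g).
  { apply Rmult_eq_reg_r with (mC g); auto. unfold Rdiv. rewrite Rmult_assoc, Rinv_l by auto. lra. }
  set (a := mA g) in *. set (b := mB g) in *. set (c := mC g) in *. set (d := mD g) in *.
  apply SU11_eq; fold a b c d; rewrite ?E; mats; field; auto.
Qed.

(** * The homogeneous kernel *)

(** |x|^t, with the value at 0 set by hand because [Rpower], being an exponential, is never 0. *)
Definition pw (t x : R) : R := if Req_dec_T x 0 then 0 else Rpower (Rabs x) t.
(** The Hermitian symmetry K(-x) = conj K(x) is built in, and the value 0 at 0 expresses that eta2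
    is isotropic. *)
Definition phase (k : C) (x : R) : C :=
  if Rlt_dec 0 x then k else if Rlt_dec x 0 then Cconj k else RtoC 0.
Definition kap (k : C) (t x : R) : C := Cmult (RtoC (pw t x)) (phase k x).

Lemma pw_0 t : pw t 0 = 0.
Proof. unfold pw. destruct (Req_dec_T 0 0); lra. Qed.
Lemma pw_nz t x : x <> 0 -> pw t x = Rpower (Rabs x) t.
Proof. intro. unfold pw. destruct (Req_dec_T x 0); [contradiction|reflexivity]. Qed.
Lemma pw_pos t x : x <> 0 -> 0 < pw t x.
Proof. intro. rewrite pw_nz by auto. apply exp_pos. Qed.
Lemma pw_opp t x : pw t (- x) = pw t x.
Proof.
  unfold pw. destruct (Req_dec_T x 0), (Req_dec_T (- x) 0); try lra. now rewrite Rabs_Ropp.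
Qed.
Lemma pw_mult t x y : pw t (x * y) = pw t x * pw t y.
Proof.
  destruct (Req_dec x 0) as [->|Hx]; [rewrite Rmult_0_l, pw_0; ring|].
  destruct (Req_dec y 0) as [->|Hy]; [rewrite Rmult_0_r, pw_0; ring|].
  rewrite !pw_nz by (auto using Rmult_integral_contrapositive_currified).
  rewrite Rabs_mult. symmetry. apply Rpower_mult_distr; now apply Rabs_pos_lt.
Qed.
Lemma pw_1 t : pw t 1 = 1.
Proof. rewrite pw_nz by lra. rewrite Rabs_R1. unfold Rpower. rewrite ln_1, Rmult_0_r. apply exp_0. Qed.
Lemma pw_inv t x : x <> 0 -> pw t (/ x) = / pw t x.
Proof.
  intro H. pose proof (pw_pos t x H). apply Rmult_eq_reg_r with (pw t x); [|lra].
  rewrite <- pw_mult, !Rinv_l by lra. apply pw_1.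
Qed.

Lemma phase_pos k x : 0 < x -> phase k x = k.
Proof. intro. unfold phase. destruct (Rlt_dec 0 x); [reflexivity|lra]. Qed.
Lemma phase_neg k x : x < 0 -> phase k x = Cconj k.
Proof.
  intro. unfold phase. destruct (Rlt_dec 0 x); [lra|]. destruct (Rlt_dec x 0); [reflexivity|lra].
Qed.
Lemma phase_0 k : phase k 0 = RtoC 0.
Proof. unfold phase. destruct (Rlt_dec 0 0); [lra|]. destruct (Rlt_dec 0 0); [lra|reflexivity]. Qed.

Lemma kap_0 k t : kap k t 0 = RtoC 0.
Proof. unfold kap. rewrite phase_0. ring. Qed.
Lemma kap_1 k t : kap k t 1 = k.
Proof. unfold kap. rewrite pw_1, phase_pos by lra. ring. Qed.
Lemma kap_opp k t x : kap k t (- x) = Cconj (kap k t x).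
Proof.
  unfold kap. rewrite pw_opp, Cmult_conj, Cconj_R. f_equal.
  destruct (Rtotal_order x 0) as [H|[->|H]].
  - now rewrite phase_pos, (phase_neg k x), Cconj_conj by lra.
  - rewrite Ropp_0, phase_0. creq.
  - now rewrite phase_neg, (phase_pos k x) by lra.
Qed.
Lemma kap_add k k' t x : kap (Cplus k k') t x = Cplus (kap k t x) (kap k' t x).
Proof.
  unfold kap. destruct (Rtotal_order x 0) as [H|[->|H]].
  - rewrite !phase_neg, Cplus_conj by lra. ring.
  - rewrite !phase_0. ring.
  - rewrite !phase_pos by lra. ring.
Qed.
Lemma kap_scale k t l x : l <> 0 -> kap k t (l * l * x) = Cmult (RtoC (pw t l * pw t l)) (kap k t x).
Proof.
  intro Hl. unfold kap. rewrite !pw_mult, (RtoC_mult _ (pw t x)), <- Cmult_assoc. do 2 f_equal.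
  assert (0 < l * l) by nra.
  destruct (Rtotal_order x 0) as [H1|[->|H1]].
  - rewrite !phase_neg by nra. reflexivity.
  - rewrite Rmult_0_r. reflexivity.
  - rewrite !phase_pos by nra. reflexivity.
Qed.
Lemma kap_fst k t x : fst (kap k t x) = pw t x * fst k.
Proof.
  unfold kap. destruct (Rtotal_order x 0) as [H|[->|H]].
  - rewrite phase_neg by lra. c2r. ring.
  - rewrite phase_0, pw_0. c2r. ring.
  - rewrite phase_pos by lra. c2r. ring.
Qed.
Lemma kap_mod k t x : Cmod (kap k t x) = pw t x * Cmod k.
Proof.
  unfold kap. destruct (Rtotal_order x 0) as [H|[->|H]].
  - rewrite phase_neg, Cmod_mult, Cmod_conj, Cmod_R, Rabs_pos_eq by lra || (left; apply pw_pos; lra). reflexivity.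
  - rewrite phase_0, pw_0, Cmult_0_r, Cmod_0. ring.
  - rewrite phase_pos, Cmod_mult, Cmod_R, Rabs_pos_eq by lra || (left; apply pw_pos; lra). reflexivity.
Qed.

Lemma pw_small t eps : 0 < t -> 0 < eps -> exists d, 0 < d /\ forall x, Rabs x < d -> pw t x < eps.
Proof.
  intros Ht He. exists (Rpower eps (/ t)). split; [apply exp_pos|]. intros x Hx.
  destruct (Req_dec x 0) as [->|N]; [rewrite pw_0; auto|].
  rewrite pw_nz by auto. replace eps with (Rpower (Rpower eps (/ t)) t).
  - unfold Rpower at 1 2. apply exp_increasing. apply Rmult_lt_compat_l; auto.
    apply ln_increasing; auto. now apply Rabs_pos_lt.
  - rewrite Rpower_mult, Rinv_l, Rpower_1; lra.
Qed.

(** * Horospherical data of an irreducible representation *)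

Definition lift (rho : SU11 -> vec -> vec) (g : SU11) (S : vec -> vec) : Prop :=
  exists c : C, Cmod c = 1 /\ forall u, inH u -> S u = vscal c (rho g u).

Section Lifts.
Context (rho : SU11 -> vec -> vec) (Hrep : isRep rho).

Lemma rep_uni g : inSU11 g -> unitaryB (rho g).
Proof. destruct Hrep as (H & _). apply H. Qed.

Lemma lift_self g : lift rho g (rho g).
Proof. exists (RtoC 1). split; [apply Cmod_1|]. intros. now rewrite vscal_1. Qed.

Lemma lift_comp g h S S' : inSU11 g -> inSU11 h -> lift rho g S -> lift rho h S' ->
  lift rho (su_mul g h) (fun u => S (S' u)).
Proof.
  intros Hg Hh (c & Hc & ES) (c' & Hc' & ES').
  destruct Hrep as (_ & Hm & _). destruct (Hm g h Hg Hh) as (d & Hd & E).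
  destruct (unit_conj_l d Hd) as [Hd' Ed].
  exists (Cmult (Cmult c c') (Cconj d)). split.
  - rewrite !Cmod_mult, Hc, Hc', Hd'. ring.
  - intros u Hu. pose proof (rep_uni g Hg). pose proof (rep_uni h Hh).
    rewrite ES', ES, E, uni_vscal, !vscal_vscal by (rewrite ?ES' by auto; hh).
    f_equal. rewrite <- (Cmult_assoc _ (Cconj d)), Ed. ring.
Qed.

(** Two lifts differ by one scalar, so a single nonzero vector decides it. This is how relations
    known only up to scalars become equalities of operators. *)
Lemma lift_unique g S S' x : inSU11 g -> lift rho g S -> lift rho g S' ->
  inH x -> x <> vzero -> S x = S' x -> forall u, inH u -> S u = S' u.
Proof.
  intros Hg (c & Hc & E) (c' & Hc' & E') Hx Hnz Ex u Hu.
  rewrite E, E' in * by auto. f_equal. apply vscal_inj with (rho g x); auto.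
  intro Z. apply Hnz. apply uni_inj with (rho g); [now apply rep_uni|auto|hh|].
  rewrite Z. symmetry. apply uni_vzero. now apply rep_uni.
Qed.

Lemma lift_uni g S : inSU11 g -> lift rho g S -> unitaryB S.
Proof.
  intros Hg (c & Hc & E). pose proof (unitaryB_scal c _ Hc (rep_uni g Hg)) as U.
  apply unitaryB_intro.
  - intros. rewrite E by auto. now apply (uni_inH _ u U).
  - intros. rewrite !E by hh. now apply (uni_lin _ a u v U).
  - intros w Hw. destruct (uni_surj _ w U Hw) as (u & Hu & Eu). exists u. rewrite E; auto.
  - intros. rewrite !E by hh. now apply (uni_B _ u v U).
Qed.

Lemma uni_nz T x : unitaryB T -> inH x -> x <> vzero -> T x <> vzero.
Proof.
  intros HT Hx Hn Z. apply Hn. apply uni_inj with T; hh. now rewrite Z, uni_vzero.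
Qed.

Lemma lift_prod g h u : inSU11 g -> inSU11 h -> inH u ->
  exists c, Cmod c = 1 /\ rho (su_mul g h) u = vscal c (rho g (rho h u)).
Proof.
  intros Hg Hh Hu. destruct Hrep as (_ & Hm & _). destruct (Hm g h Hg Hh) as (c & Hc & E).
  exists c. split; auto.
Qed.

(** Only the modulus of the eigenvalue is independent of the lift, and it is multiplicative in
    [g]. *)
Definition stretch (eta : vec) (g : SU11) (m : R) : Prop :=
  exists z, Cmod z = m /\ rho g eta = vscal z eta.

Lemma stretch_unique eta g m m' : eta <> vzero -> stretch eta g m -> stretch eta g m' -> m = m'.
Proof.
  intros Hn (z & <- & E) (z' & <- & E'). rewrite E in E'. f_equal. now apply vscal_inj with eta.
Qed.

Lemma stretch_mul eta g h m m' : inSU11 g -> inSU11 h -> inH eta ->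
  stretch eta g m -> stretch eta h m' -> stretch eta (su_mul g h) (m * m').
Proof.
  intros Hg Hh He (z & <- & E) (z' & <- & E').
  destruct (lift_prod g h eta Hg Hh He) as (c & Hc & Ec).
  exists (Cmult c (Cmult z' z)). split.
  - rewrite !Cmod_mult, Hc. ring.
  - rewrite Ec, E', uni_vscal, E, !vscal_vscal by (auto using rep_uni). f_equal. ring.
Qed.

Lemma stretch_pos eta g m : inSU11 g -> inH eta -> eta <> vzero -> stretch eta g m -> 0 < m.
Proof.
  intros Hg He Hn (z & <- & E). apply Cmod_gt_0. intros ->.
  apply (uni_nz (rho g) eta); auto using rep_uni. now rewrite E, vscal_0.
Qed.

End Lifts.

Section HorosphericalData.
Context (rho : SU11 -> vec -> vec) (t : R) (eta1 eta2 : vec) (kappa : C).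
Context (Hrep : isRep rho) (Hirr : irreducible rho) (Hell : ellIs rho t)
  (Hdist : distinguished rho eta1 eta2) (HK : K1of rho eta1 eta2 kappa).

Lemma ext_pair : hyp_pair eta1 eta2.
Proof. destruct Hdist as (H1 & H2 & H3 & _). repeat split; auto; first [apply H1|apply H2]. Qed.

Let I1 : inH eta1 := pair_inH1 _ _ ext_pair.
Let I2 : inH eta2 := pair_inH2 _ _ ext_pair.
Let N1 : eta1 <> vzero := pair_nz1 _ _ ext_pair.
Let N2 : eta2 <> vzero := pair_nz2 _ _ ext_pair.
Hint Resolve I1 I2 : inH.
Let U g (H : inSU11 g) : unitaryB (rho g) := rep_uni rho Hrep g H.
Let G lam b (H : lam <> 0) : inSU11 (gLB lam b) := inSU11_gLB lam b H.
Hint Resolve U G inSU11_W inSU11_one inSU11_mone inSU11_mul : inH.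

Lemma one_nz : 1 <> 0. Proof. lra. Qed.
Hint Resolve one_nz : inH.

Lemma t_pos : 0 < t.
Proof. apply Hell. Qed.

Lemma fix_stretch lam b : 0 < lam -> exists m, stretch rho eta1 (gLB lam b) m.
Proof.
  intro H. destruct Hdist as (_ & _ & _ & H4 & _). destruct (H4 lam b H) as [z E].
  exists (Cmod z), z. auto.
Qed.

Lemma stretch_one : stretch rho eta1 (gLB 1 0) 1.
Proof.
  destruct (fix_stretch 1 0 Rlt_0_1) as [m Hm].
  assert (E : su_mul (gLB 1 0) (gLB 1 0) = gLB 1 0) by (apply SU11_eq; mats; field).
  pose proof (stretch_mul rho Hrep eta1 _ _ m m (G 1 0 one_nz) (G 1 0 one_nz) I1 Hm Hm) as H.
  rewrite E in H. pose proof (stretch_unique rho _ _ _ _ N1 Hm H).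
  pose proof (stretch_pos rho Hrep _ _ _ (G 1 0 one_nz) I1 N1 Hm).
  assert (m = 1) as E1 by (apply Rmult_eq_reg_l with m; lra). rewrite E1 in Hm. exact Hm.
Qed.

(** For b = 1 this is contained in the definition of K(1). Conjugation by g(sqrt b, 0) reaches every
    b > 0, the two outer stretches cancelling, and inversion reaches b < 0. *)
Lemma stretch_unip b : stretch rho eta1 (gLB 1 b) 1.
Proof.
  assert (P1 : stretch rho eta1 (gLB 1 1) 1).
  { destruct HK as (c & e & Hc & _ & _ & _ & E & _). exists (Cconj c).
    destruct (unit_conj_l c Hc) as [H1 H2]. split; auto.
    rewrite <- E at 2. rewrite vscal_vscal, H2, vscal_1. reflexivity. }
  assert (P : forall b, 0 < b -> stretch rho eta1 (gLB 1 b) 1).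
  { clear b. intros b Hb. set (l := sqrt b). assert (Hl : 0 < l) by now apply sqrt_lt_R0.
    assert (Hll : l * l = b) by (apply sqrt_sqrt; lra).
    destruct (fix_stretch l 0 Hl) as [m Hm].
    destruct (fix_stretch (/ l) 0) as [m' Hm']; [now apply Rinv_0_lt_compat|].
    assert (Gl : inSU11 (gLB l 0)) by (apply G; lra).
    assert (Gl' : inSU11 (gLB (/ l) 0)) by (apply G, Rinv_neq_0_compat; lra).
    pose proof (stretch_mul rho Hrep _ _ _ _ _ Gl Gl' I1 Hm Hm') as H1.
    replace (su_mul (gLB l 0) (gLB (/ l) 0)) with (gLB 1 0) in H1 by (apply SU11_eq; mats; field; lra).
    pose proof (stretch_unique rho _ _ _ _ N1 stretch_one H1) as H2.
    pose proof (stretch_mul rho Hrep _ _ _ _ _ (inSU11_mul _ _ Gl (G 1 1 one_nz)) Gl' I1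
      (stretch_mul rho Hrep _ _ _ _ _ Gl (G 1 1 one_nz) I1 Hm P1) Hm') as H3.
    replace (su_mul (su_mul (gLB l 0) (gLB 1 1)) (gLB (/ l) 0)) with (gLB 1 b) in H3.
    - assert (m * 1 * m' = 1) as E by lra. rewrite E in H3. exact H3.
    - rewrite <- Hll. apply SU11_eq; mats; field; lra. }
  destruct (Rtotal_order b 0) as [H|[->|H]]; auto; [|apply stretch_one].
  destruct (fix_stretch 1 b Rlt_0_1) as [m Hm].
  pose proof (stretch_mul rho Hrep _ _ _ _ _ (G 1 b one_nz) (G 1 (- b) one_nz) I1 Hm (P (- b) ltac:(lra))) as H1.
  replace (su_mul (gLB 1 b) (gLB 1 (- b))) with (gLB 1 0) in H1 by (apply SU11_eq; mats; field).
  pose proof (stretch_unique rho _ _ _ _ N1 stretch_one H1) as H2.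
  assert (m = 1) as E by lra. rewrite E in Hm. exact Hm.
Qed.

Lemma unip_ex : exists T : R -> vec -> vec,
  forall b, lift rho (gLB 1 b) (T b) /\ T b eta1 = eta1.
Proof.
  assert (H : forall b, exists S, lift rho (gLB 1 b) S /\ S eta1 = eta1).
  { intro b. destruct (stretch_unip b) as (z & Hz & E). destruct (unit_conj_l z Hz) as [H1 H2].
    exists (fun u => vscal (Cconj z) (rho (gLB 1 b) u)). split.
    - exists (Cconj z). auto.
    - rewrite E, vscal_vscal, H2, vscal_1. reflexivity. }
  exists (fun b => proj1_sig (constructive_indefinite_description _ (H b))).
  intro b. apply (proj2_sig (constructive_indefinite_description _ (H b))).
Qed.

Context (T : R -> vec -> vec)
  (Tlift : forall b, lift rho (gLB 1 b) (T b)) (T1 : forall b, T b eta1 = eta1).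

Lemma T_uni b : unitaryB (T b).
Proof. apply (lift_uni rho Hrep (gLB 1 b)); hh. Qed.
Hint Resolve T_uni : inH.

(** An equality without scalar, since both sides are lifts of the same element fixing eta1. *)
Lemma T_add b b' u : inH u -> T (b + b') u = T b (T b' u).
Proof.
  intro Hu. apply (lift_unique rho Hrep (gLB 1 (b + b')) (T (b + b')) (fun u => T b (T b' u)) eta1); hh.
  - replace (gLB 1 (b + b')) with (su_mul (gLB 1 b) (gLB 1 b')) by (apply SU11_eq; mats; field).
    apply lift_comp; hh.
  - now rewrite !T1.
Qed.

Lemma T_zero u : inH u -> T 0 u = u.
Proof.
  intro Hu. apply uni_inj with (T 0); hh. rewrite <- T_add by auto. f_equal. ring.
Qed.

Definition Kp (b : R) : C := B (T b eta2) eta2.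

Lemma T_eta1 b : B (T b eta2) eta1 = RtoC 1.
Proof. rewrite <- (T1 b), uni_B by hh. exact (pair_21 _ _ ext_pair). Qed.

Lemma B_T_diff x y : B (T x eta2) (T y eta2) = Kp (x - y).
Proof.
  unfold Kp. rewrite <- (uni_B (T y) (T (x - y) eta2)), <- T_add by hh. do 2 f_equal. ring.
Qed.

Lemma Kp_opp b : Kp (- b) = Cconj (Kp b).
Proof.
  unfold Kp at 2. rewrite <- B_conj. rewrite <- (T_zero eta2) at 1 by hh.
  rewrite B_T_diff. f_equal. ring.
Qed.

Lemma Kp_zero : Kp 0 = RtoC 0.
Proof. unfold Kp. rewrite T_zero by hh. exact (pair_22 _ _ ext_pair). Qed.

Lemma Kp_one : Kp 1 = kappa.
Proof.
  destruct HK as (c & e & Hc & He & E1 & E2 & F1 & F2). unfold Kp.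
  assert (L : lift rho (gLB 1 1) (fun u => vscal c (rho (gLB 1 1) u))) by (exists c; auto).
  rewrite (lift_unique rho Hrep (gLB 1 1) (T 1) _ eta1 (G 1 1 one_nz) (Tlift 1) L) by (rewrite ?T1; hh).
  rewrite F2. Bexp. rewrite (pair_12 _ _ ext_pair), (pair_22 _ _ ext_pair), E2. ring.
Qed.

Definition cvec (b : R) : vec := perp eta1 eta2 (T b eta2).

Lemma cvec_ortho b : ortho eta1 eta2 (cvec b).
Proof. apply ortho_perp; [exact ext_pair | hh]. Qed.

Lemma cvec_gram x y : B (cvec x) (cvec y) = Cminus (Cminus (Kp (x - y)) (Kp x)) (Cconj (Kp y)).
Proof.
  rewrite <- B_T_diff, (B_decomp _ _ ext_pair (T x eta2)), !T_eta1 by hh.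
  fold (Kp x) (Kp y) (cvec x) (cvec y). rewrite Cconj_R. ring.
Qed.

Lemma hyperbolic lam : 0 < lam -> exists alpha beta,
  rho (gLB lam 0) eta1 = vscal alpha eta1 /\ rho (gLB lam 0) eta2 = vscal beta eta2 /\
  Rabs (ln (Cmod alpha)) = t * Rabs (ln lam).
Proof.
  intro Hl. destruct Hdist as (_ & _ & _ & H4 & H5).
  destruct (H4 lam 0 Hl) as [a Ea]. destruct (H5 lam Hl) as [b Eb].
  exists a, b. repeat split; auto. destruct Hell as [_ HL]. specialize (HL lam Hl).
  rewrite (translen_axis _ _ _ a b ext_pair (U _ (G lam 0 ltac:(lra))) Ea Eb) in HL.
  now injection HL.
Qed.

(** With A = rho(g(lam,0)), the normalisation at eta1 gives T_(lam^2 b) A = A T_b exactly. Applied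
    to eta2 and paired with eta2 this reads beta K(lam^2 b) = alpha K(b), and alpha = |alpha|^2
    beta. *)
Lemma Kp_scale lam m b : 0 < lam -> stretch rho eta1 (gLB lam 0) m ->
  Kp (lam * lam * b) = Cmult (RtoC (m * m)) (Kp b).
Proof.
  intros Hl (z & <- & Ez). destruct (hyperbolic lam Hl) as (a & be & Ea & Eb & _).
  assert (z = a) as -> by (apply (vscal_inj z a eta1 N1); congruence).
  assert (Gl : inSU11 (gLB lam 0)) by (apply G; lra).
  set (A := rho (gLB lam 0)) in *. assert (UA : unitaryB A) by (apply U, Gl).
  assert (E : forall u, inH u -> T (lam * lam * b) (A u) = A (T b u)).
  { apply (lift_unique rho Hrep (gLB lam (lam * b)) (fun u => T (lam * lam * b) (A u)) (fun u => A (T b u)) eta1);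
      auto; try (apply G; lra).
    - replace (gLB lam (lam * b)) with (su_mul (gLB 1 (lam * lam * b)) (gLB lam 0))
        by (apply SU11_eq; mats; field; lra).
      apply lift_comp; hh. apply lift_self.
    - replace (gLB lam (lam * b)) with (su_mul (gLB lam 0) (gLB 1 b))
        by (apply SU11_eq; mats; field; lra).
      apply lift_comp; hh. apply lift_self.
    - rewrite Ea, uni_vscal, !T1 by hh. auto. }
  specialize (E eta2 I2). rewrite Eb, uni_vscal in E by hh.
  pose proof (f_equal (fun v => B v eta2) E) as E'. cbv beta in E'.
  rewrite B_scal_l in E' by hh.
  rewrite (axis_coord2 _ _ ext_pair A a be UA Ea Eb) in E' by hh. fold (Kp b) (Kp (lam * lam * b)) in E'.
  pose proof (axis_beta _ _ ext_pair A a be UA Ea Eb) as Ebe.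
  pose proof (axis_alpha_nz _ _ ext_pair A a be UA Ea Eb) as Na.
  pose proof (axis_mod _ _ ext_pair A a be UA Ea Eb) as Ma.
  apply Ceq_minus.
  assert (F : Cmult a (Cminus (Kp (lam * lam * b)) (Cmult (RtoC (Cmod a * Cmod a)) (Kp b))) = RtoC 0).
  { replace a with (Cmult (RtoC (Cmod a ^ 2)) be) at 1.
    - replace (Cmod a ^ 2) with (Cmod a * Cmod a) by ring.
      transitivity (Cmult (RtoC (Cmod a * Cmod a)) (Cminus (Cmult be (Kp (lam * lam * b)))
        (Cmult (Cmult (RtoC (Cmod a * Cmod a)) be) (Kp b)))); [ring|].
      replace (Cmult (RtoC (Cmod a * Cmod a)) be) with a; [rewrite E'; ring|].
      rewrite Ebe. rewrite Cmult_assoc, <- RtoC_mult.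
      replace (Cmod a * Cmod a * / Cmod a ^ 2) with 1 by (field; lra). ring.
    - rewrite Ebe at 1. rewrite Cmult_assoc, <- RtoC_mult.
      replace (Cmod a ^ 2 * / Cmod a ^ 2) with 1 by (field; lra). ring. }
  destruct (Ceq_dec (Cminus (Kp (lam * lam * b)) (Cmult (RtoC (Cmod a * Cmod a)) (Kp b))) (RtoC 0)) as [Z|Z]; auto.
  exfalso. now apply (Cmult_neq_0 _ _ Na Z).
Qed.

Lemma upper_fix g : inSU11 g -> mC g = 0 -> fixes (rho g) eta1.
Proof.
  intros Hg Hc. destruct Hdist as (_ & _ & _ & H4 & _).
  destruct (Rtotal_order (mA g) 0) as [H|[H|H]].
  - rewrite (upper_neg g Hg Hc H).
    destruct (lift_prod rho Hrep su_mone (gLB (- mA g) (- mB g)) eta1) as (c & Hcc & E);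
      [hh|apply G; lra|hh|].
    destruct (H4 (- mA g) (- mB g)) as [z Ez]; [lra|].
    assert (HR := Hrep). destruct HR as (_ & _ & (d & Hd & Ed) & _).
    exists (Cmult c (Cmult d z)). rewrite E, Ez, Ed, !vscal_vscal by hh. f_equal. ring.
  - exfalso. apply inSU11_det in Hg. rewrite H, Hc in Hg. lra.
  - rewrite (upper_pos g Hg Hc H). now apply H4.
Qed.

(** Since [suW] conjugates g(2,0) to its inverse, the image of eta1 is again an eigenvector of the
    hyperbolic operator of g(2,0), hence lies on eta1 or eta2. *)
Lemma weyl_swap : propto (rho suW eta1) eta2.
Proof.
  set (v := rho suW eta1). assert (Hv : inH v) by (unfold v; hh).
  assert (Nv : v <> vzero) by (apply uni_nz; hh).
  assert (Bv : B v v = RtoC 0) by (unfold v; rewrite uni_B by hh; exact (pair_11 _ _ ext_pair)).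
  assert (G2 : inSU11 (gLB 2 0)) by (apply G; lra).
  assert (Gh : inSU11 (gLB (/ 2) 0)) by (apply G; lra).
  assert (E : exists z, rho (gLB 2 0) v = vscal z v).
  { destruct (lift_prod rho Hrep (gLB 2 0) suW eta1) as (c & Hc & Ec); hh.
    destruct (lift_prod rho Hrep suW (gLB (/ 2) 0) eta1) as (c' & Hc' & Ec'); hh.
    replace (su_mul suW (gLB (/ 2) 0)) with (su_mul (gLB 2 0) suW) in Ec' by (apply SU11_eq; mats; field).
    destruct Hdist as (_ & _ & _ & H4 & _). destruct (H4 (/ 2) 0 ltac:(lra)) as [z Ez].
    rewrite Ez, uni_vscal, vscal_vscal in Ec' by hh.
    exists (Cmult (Cconj c) (Cmult c' z)). fold v in Ec, Ec'.
    rewrite <- vscal_vscal, <- Ec', Ec, vscal_vscal.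
    destruct (unit_conj_l c Hc) as [_ ->]. now rewrite vscal_1. }
  destruct E as [z Ez]. destruct (hyperbolic 2 ltac:(lra)) as (a & be & Ea & Eb & El).
  assert (Ha : Cmod a <> 1).
  { intro F. rewrite F, ln_1, Rabs_R0 in El. pose proof ln_lt_2. pose proof t_pos.
    rewrite Rabs_pos_eq in El by lra. nra. }
  destruct (axis_eigen _ _ ext_pair (rho (gLB 2 0)) a be (U _ G2) Ea Eb z v Ha Hv Nv) as [P|P]; auto.
  { rewrite Bv. simpl. lra. }
  exfalso. destruct P as [w Ew].
  (* If the Weyl element fixed the line of eta1, then so would the whole group by the Bruhat
     decomposition, against non-elementarity. *)
  destruct Hirr as [[NE _] _]. apply NE. exists eta1. repeat split; auto.
  - rewrite (pair_11 _ _ ext_pair). simpl. lra.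
  - intros g Hg. destruct (Req_dec (mC g) 0) as [Hc|Hc]; [now apply upper_fix|].
    destruct (upperC_spec g Hc) as [Hp1 Hp2].
    rewrite (bruhat g Hg Hc).
    destruct (lift_prod rho Hrep (gLB 1 (mA g / mC g)) (su_mul suW (upperC g)) eta1) as (c1 & _ & F1); hh.
    destruct (lift_prod rho Hrep suW (upperC g) eta1) as (c2 & _ & F2); hh.
    destruct (upper_fix _ Hp1 Hp2) as [y Ey].
    destruct Hdist as (_ & _ & _ & H4 & _). destruct (H4 1 (mA g / mC g) Rlt_0_1) as [x Ex].
    exists (Cmult c1 (Cmult c2 (Cmult y (Cmult w x)))).
    rewrite F1, F2, Ey, (uni_vscal (rho suW)) by hh. fold v.
    rewrite Ew, !(uni_vscal (rho (gLB 1 _))), Ex, !vscal_vscal by hh.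
    f_equal. ring.
Qed.

Lemma orbit_eta1 g : inSU11 g ->
  propto (rho g eta1) eta1 \/ exists x, propto (rho g eta1) (T x eta2).
Proof.
  intro Hg. destruct (Req_dec (mC g) 0) as [Hc|Hc]; [left; now apply upper_fix|right].
  exists (mA g / mC g). set (x := mA g / mC g).
  destruct (upperC_spec g Hc) as [Hp1 Hp2].
  rewrite (bruhat g Hg Hc). fold x.
  destruct (lift_prod rho Hrep (gLB 1 x) (su_mul suW (upperC g)) eta1) as (c1 & _ & F1); hh.
  destruct (lift_prod rho Hrep suW (upperC g) eta1) as (c2 & _ & F2); hh.
  destruct (upper_fix _ Hp1 Hp2) as [y Ey]. destruct weyl_swap as [w Ew].
  destruct (Tlift x) as (d & Hd & Ed). destruct (unit_conj_l d Hd) as [_ Hdd].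
  exists (Cmult (Cmult c1 (Cmult c2 (Cmult y w))) (Cconj d)).
  rewrite F1, F2, Ey, (uni_vscal (rho suW)), Ew, !(uni_vscal (rho (gLB 1 x))), !vscal_vscal, Ed, vscal_vscal by hh.
  f_equal. rewrite <- (Cmult_assoc _ (Cconj d)), Hdd. ring.
Qed.

(** The double orthogonal [W] of the orbit of eta1 is closed and invariant. It contains the positive
    vector eta1 + eta2, so it is a hyperbolic subspace, and irreducibility makes it everything. *)
Lemma orbit_total z : inH z -> (forall g, inSU11 g -> B (rho g eta1) z = RtoC 0) -> z = vzero.
Proof.
  intros Hz HO.
  pose (W := fun u => inH u /\ forall z, inH z ->
     (forall g, inSU11 g -> B (rho g eta1) z = RtoC 0) -> B u z = RtoC 0).
  assert (WO : forall g, inSU11 g -> W (rho g eta1)) by (intros g Hg; split; auto; hh).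
  assert (Wlin : forall a u v, W u -> W v -> W (vadd (vscal a u) v)).
  { intros a u v [Hu1 Hu] [Hv1 Hv]. split; [hh|]. intros y Hy HyO. Bexp. rewrite Hu, Hv by auto. ring. }
  assert (W0 : W vzero) by (split; [hh|]; intros; apply B_vzero_l; auto).
  assert (Wscal : forall a u, W u -> W (vscal a u)).
  { intros. rewrite <- (vadd_0_r (vscal a u)). now apply Wlin. }
  assert (Wc : closedSubspace W).
  { split; [|split; [|split]]; auto.
    - intros u [H _]; exact H.
    - intros s u Hs Hu Hlim. split; auto. intros y Hy HyO.
      apply Cmod_sq_small with (4 * nsq y). intros eps He.
      apply is_lim_seq_spec in Hlim. destruct (Hlim (mkposreal _ (sqrt_lt_R0 _ He))) as [N HN].
      specialize (HN N (le_n N)). simpl in HN. rewrite Rminus_0_r, hnorm_nsq, vsub_vdiff in HN.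
      destruct (Hs N) as [Hs1 Hs2].
      assert (Hd : inH (vdiff (s N) u)) by hh.
      assert (nsq (vdiff (s N) u) < eps).
      { rewrite Rabs_pos_eq in HN by apply sqrt_pos. now apply sqrt_lt_0_alt. }
      replace (Cmod (B u y)) with (Cmod (B (vdiff (s N) u) y)).
      + pose proof (B_bound _ _ Hd Hy). pose proof (nsq_ge_0 _ Hd). pose proof (nsq_ge_0 _ Hy). nra.
      + rewrite B_vdiff_l, (Hs2 y Hy HyO) by hh. replace (Cminus 0 (B u y)) with (Copp (B u y)) by ring.
        apply Cmod_opp. }
  assert (W1 : W eta1).
  { destruct (stretch_unip 0) as (c & Hc & Ec). destruct (unit_conj_l c Hc) as [_ H].
    replace eta1 with (vscal (Cconj c) (rho (gLB 1 0) eta1)) by (now rewrite Ec, vscal_vscal, H, vscal_1).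
    apply Wscal, WO. hh. }
  assert (W2 : W eta2).
  { destruct weyl_swap as [w Ew].
    assert (w <> RtoC 0).
    { intros ->. rewrite vscal_0 in Ew. revert Ew. apply uni_nz; hh. }
    replace eta2 with (vscal (Cinv w) (rho suW eta1)).
    - apply Wscal, WO. hh.
    - rewrite Ew, vscal_vscal, Cinv_l, vscal_1; auto. }
  assert (Winv : forall g, inSU11 g -> forall u, W u -> W (rho g u)).
  { intros g Hg u [Hu HuO]. split; [hh|]. intros y Hy HyO.
    destruct (uni_surj (rho g) y (U g Hg) Hy) as (y' & Hy' & <-).
    rewrite uni_B by hh. apply HuO; auto. intros h Hh.
    destruct (lift_prod rho Hrep g h eta1 Hg Hh I1) as (c & Hc & Ec).
    rewrite <- (uni_B (rho g)) by hh. destruct (unit_conj_l c Hc) as [_ Hcc].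
    replace (rho g (rho h eta1)) with (vscal (Cconj c) (rho (su_mul g h) eta1)).
    - assert (inSU11 (su_mul g h)) by hh. rewrite B_scal_l, HyO by hh. ring.
    - rewrite Ec, vscal_vscal, Hcc, vscal_1. reflexivity. }
  assert (Wall : forall u, inH u -> W u).
  { intros u Hu. destruct (classic (W u)) as [|NW]; auto. exfalso.
    destruct Hirr as [_ NI]. apply NI. exists W. split; [|split; eauto].
    split; auto. exists (vadd eta1 eta2). split; [|split].
    - rewrite <- (vscal_1 eta1). now apply Wlin.
    - apply pair_pos, ext_pair.
    - intros w [Hw _] Hort Hnz. apply Rnot_le_lt. intro H. apply Hnz.
      apply B_neg with (vadd eta1 eta2); hh. apply pair_pos, ext_pair. }
  apply B_nondeg. intro m. rewrite B_conj.
  destruct (Wall (delta m) (inH_delta m)) as [_ H]. rewrite H by auto. creq.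
Qed.

Lemma cvec_nondeg z : inH z -> B z eta1 = RtoC 0 -> B z eta2 = RtoC 0 ->
  (forall x, B z (cvec x) = RtoC 0) -> z = vzero.
Proof.
  intros Hz Z1 Z2 Zc.
  assert (Z1' : B eta1 z = RtoC 0) by (rewrite B_conj, Z1; creq).
  assert (ZT : forall x, B (T x eta2) z = RtoC 0).
  { intro x. rewrite (perp_decomp eta1 eta2 (T x eta2)). fold (cvec x).
    assert (Hc : inH (cvec x)) by apply cvec_ortho.
    Bexp. rewrite Z1', (B_conj z eta2), (B_conj z (cvec x)), Z2, Zc, Cconj_R. ring. }
  apply orbit_total; auto. intros g Hg.
  destruct (orbit_eta1 g Hg) as [[c ->]|[x [c ->]]]; rewrite B_scal_l by hh;
    rewrite ?Z1', ?ZT; ring.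
Qed.

(** B(c(x),c(x)) = -2 Re K(x) <= 0 gives the weak inequality. If Re K(1) = 0, scaling makes every
    c(x) null, hence zero; by totality E would be zero, yet two vectors always leave a nonzero
    common orthogonal. *)
Lemma kappa_re_pos : 0 < fst kappa.
Proof.
  assert (F : forall x, fst (B (cvec x) (cvec x)) = - 2 * fst (Kp x)).
  { intro x. rewrite cvec_gram. rewrite Rminus_diag, Kp_zero. c2r. ring. }
  assert (Hk : 0 <= fst kappa).
  { pose proof (ortho_nonpos _ _ ext_pair _ (cvec_ortho 1)) as H. rewrite F, Kp_one in H. lra. }
  destruct Hk as [|Hk]; auto. exfalso.
  assert (P : forall x, 0 < x -> fst (Kp x) = 0).
  { intros x Hx. set (l := sqrt x). assert (Hl : 0 < l) by now apply sqrt_lt_R0.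
    destruct (fix_stretch l 0 Hl) as [m Hm].
    replace x with (l * l * 1) by (rewrite Rmult_1_r; apply sqrt_sqrt; lra).
    rewrite (Kp_scale l m 1 Hl Hm), Kp_one. c2r. rewrite <- Hk. ring. }
  assert (Z : forall x, cvec x = vzero).
  { intro x. apply (ortho_zero _ _ ext_pair); [apply cvec_ortho|]. rewrite F.
    destruct (Rtotal_order x 0) as [H|[->|H]].
    - replace x with (- - x) by ring. rewrite Kp_opp.
      pose proof (P (- x) ltac:(lra)) as H1. c2r. rewrite H1. lra.
    - rewrite Kp_zero. simpl. lra.
    - rewrite P by auto. lra. }
  assert (D : forall z, inH z -> ortho eta1 eta2 z -> z = vzero).
  { intros z Hz (_ & Z1 & Z2). apply cvec_nondeg; auto. intro x. rewrite Z. now apply B_vzero_r. }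
  destruct (exists_orthogonal (eta1 :: eta2 :: nil)) as (z & Hz & Nz & Oz).
  { intros w [<-|[<-|[]]]; hh. }
  apply Nz, D; auto. split; [auto|]. split; apply Oz; simpl; auto.
Qed.

(** Orbital continuity at the point eta1 + eta2, where cosh of the displacement by T_b is |2 +
    K(b)|/2. *)
Lemma Kp_bounded : exists d, 0 < d /\ forall b, Rabs b < d -> fst (Kp b) <= 4.
Proof.
  set (v := vadd eta1 eta2).
  assert (Hv : inH v) by (unfold v; hh).
  assert (Bv : B v v = RtoC 2).
  { unfold v. Bexp. rewrite (pair_11 _ _ ext_pair), (pair_12 _ _ ext_pair),
      (pair_21 _ _ ext_pair), (pair_22 _ _ ext_pair). creq. }
  assert (Hp : posv v) by (split; auto; rewrite Bv; simpl; lra).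
  assert (HR := Hrep). destruct HR as (_ & _ & _ & Hc).
  destruct (Hc v Hp (gLB 1 0) (G 1 0 one_nz) 1 Rlt_0_1) as (d & Hd & H).
  exists d. split; auto. intros b Hb.
  assert (Cm : forall y, Cmod (0, y) = Rabs y).
  { intro y. replace (0, y) with (Cmult Ci (RtoC y)) by creq. rewrite Cmod_mult, Cmod_Ci, Cmod_R. ring. }
  assert (Hb2 : Rabs (b / 2) < d).
  { unfold Rdiv. rewrite Rabs_mult, (Rabs_pos_eq (/ 2)) by lra. pose proof (Rabs_pos b). lra. }
  specialize (H (gLB 1 b) (G 1 b one_nz)).
  assert (H1 : hdist (rho (gLB 1 b) v) (rho (gLB 1 0) v) < 1).
  { apply H.
    - replace (Cminus _ _) with ((0, b / 2) : C) by (unfold gLB; creq; field). now rewrite Cm.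
    - replace (Cminus _ _) with ((0, - (b / 2)) : C) by (unfold gLB; creq; field).
      now rewrite Cm, Rabs_Ropp. }
  clear H. unfold hdist in H1. rewrite !uni_B, Bv in H1 by hh.
  cbn [fst RtoC] in H1. rewrite sqrt_square in H1 by lra.
  assert (E : Cmod (B (rho (gLB 1 b) v) (rho (gLB 1 0) v)) = Cmod (Cplus (RtoC 2) (Kp b))).
  { destruct (Tlift b) as (c & Hc1 & Ec), (Tlift 0) as (c' & Hc2 & Ec').
    replace (Cplus (RtoC 2) (Kp b)) with (B (T b v) (T 0 v)).
    - rewrite Ec, Ec' by hh. Bexp. rewrite !Cmod_mult, Cmod_conj, Hc1, Hc2. ring.
    - rewrite T_zero by auto. unfold v. rewrite (uni_vadd (T b)), T1 by hh. Bexp.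
      rewrite T_eta1, (pair_11 _ _ ext_pair), (pair_12 _ _ ext_pair). fold (Kp b). creq. }
  rewrite E in H1. set (r := Cmod (Cplus (RtoC 2) (Kp b)) / 2) in *.
  (* A displacement below 1 keeps its cosh [r] below e, hence at most 3; then |2 + K(b)| <= 6, which
     is the origin of the bound 4. *)
  assert (Hr : r <= 3).
  { destruct (Rle_lt_dec r 3) as [|L]; auto. exfalso.
    pose proof exp_le_3 as He. pose proof (sqrt_pos (r * r - 1)).
    assert (1 < acosh r).
    { unfold acosh. apply Rle_lt_trans with (ln (exp 1)); [rewrite ln_exp; lra|].
      apply ln_increasing; [apply exp_pos|lra]. }
    lra. }
  pose proof (re_le_Cmod (Cplus (RtoC 2) (Kp b))) as F. unfold Re in F.
  pose proof (Rle_abs (fst (Cplus (RtoC 2) (Kp b)))) as F'. unfold r in Hr.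
  simpl in F'. unfold Cplus, RtoC in *. simpl in *. lra.
Qed.

Lemma stretch_log lam : 0 < lam -> exists m, 0 < m /\ stretch rho eta1 (gLB lam 0) m /\
  Rabs (ln m) = t * Rabs (ln lam).
Proof.
  intro Hl. destruct (hyperbolic lam Hl) as (a & be & Ea & Eb & El).
  assert (S : stretch rho eta1 (gLB lam 0) (Cmod a)) by (exists a; auto).
  exists (Cmod a). split; [|split]; auto.
  apply (stretch_pos rho Hrep _ _ _ (G lam 0 ltac:(lra)) I1 N1 S).
Qed.

Lemma stretch_small : exists l0, 0 < l0 /\ forall lam m, 0 < lam < l0 ->
  stretch rho eta1 (gLB lam 0) m -> ln m = t * ln lam.
Proof.
  destruct Kp_bounded as (d & Hd & Hb). pose proof kappa_re_pos as Hk. pose proof t_pos as Ht.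
  (* if the stretch were [lam^-t], then [fst (Kp (lam^2)) = lam^(-2t) * fst kappa] would be unbounded *)
  set (q := 1 + 4 / fst kappa).
  assert (Hq : 1 < q) by (unfold q; assert (0 < 4 / fst kappa) by (apply Rdiv_lt_0_compat; lra); lra).
  (* Below this threshold the wrong sign would force m = lam^(-t) > q, and the choice of [q] makes q
     * Re kappa exceed 4. *)
  set (l1 := exp (- (ln q / t))).
  exists (Rmin 1 (Rmin d l1)). split.
  { repeat apply Rmin_glb_lt; try lra. apply exp_pos. }
  intros lam m [Hl1 Hl2] Hm.
  pose proof (Rmin_l 1 (Rmin d l1)). pose proof (Rmin_r 1 (Rmin d l1)).
  pose proof (Rmin_l d l1). pose proof (Rmin_r d l1).
  destruct (stretch_log lam Hl1) as (m' & Hm'0 & Hm' & E).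
  rewrite <- (stretch_unique rho _ _ _ _ N1 Hm Hm') in *. clear Hm' m'.
  assert (Ll : ln lam < 0) by (rewrite <- ln_1; apply ln_increasing; lra).
  rewrite (Rabs_left (ln lam)) in E by auto.
  destruct (Rle_lt_dec (ln m) 0) as [Lm|Lm].
  - rewrite Rabs_left1 in E by auto. lra.
  - exfalso. rewrite Rabs_pos_eq in E by lra.
    assert (Hmq : q < m).
    { rewrite <- (exp_ln q), <- (exp_ln m) by lra. apply exp_increasing. rewrite E.
      assert (ln lam < - (ln q / t)).
      { rewrite <- (ln_exp (- (ln q / t))). apply ln_increasing; auto. fold l1. lra. }
      replace (ln q) with (t * (ln q / t)) by (field; lra). nra. }
    pose proof (Kp_scale lam m 1 Hl1 Hm) as S. rewrite Rmult_1_r, Kp_one in S.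
    assert (Bd : fst (Kp (lam * lam)) <= 4).
    { apply Hb. rewrite Rabs_pos_eq by nra. nra. }
    rewrite S in Bd. assert (Bd' : m * m * fst kappa <= 4) by (c2r; lra).
    assert (q * fst kappa > 4).
    { unfold q. replace ((1 + 4 / fst kappa) * fst kappa) with (fst kappa + 4) by (field; lra). lra. }
    assert (q * q < m * m) by nra. assert (q < q * q) by nra.
    assert (q * fst kappa < m * m * fst kappa) by (apply Rmult_lt_compat_r; lra). lra.
Qed.

Lemma stretch_value lam : 0 < lam -> stretch rho eta1 (gLB lam 0) (pw t lam).
Proof.
  intro Hl. destruct stretch_small as (l0 & Hl0 & H).
  destruct (stretch_log lam Hl) as (m & Hm0 & Hm & _).
  (* Both [mu] and [mu * lam] lie in the range where the sign is known, and the stretch of [lam] is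
     the quotient of theirs. *)
  set (mu := Rmin (l0 / 2) (l0 / (2 * lam))).
  assert (Q1 : 0 < l0 / 2) by lra.
  assert (Q2 : 0 < l0 / (2 * lam)) by (apply Rdiv_lt_0_compat; lra).
  assert (Hmu : 0 < mu) by (apply Rmin_glb_lt; auto).
  assert (Hmu1 : mu < l0) by (pose proof (Rmin_l (l0 / 2) (l0 / (2 * lam))); unfold mu; lra).
  assert (Hmu2 : mu * lam < l0).
  { pose proof (Rmin_r (l0 / 2) (l0 / (2 * lam))) as R. fold mu in R.
    apply Rle_lt_trans with (l0 / (2 * lam) * lam); [apply Rmult_le_compat_r; lra|].
    replace (l0 / (2 * lam) * lam) with (l0 / 2) by (field; lra). lra. }
  destruct (stretch_log mu Hmu) as (n & Hn0 & Hn & _).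
  pose proof (stretch_mul rho Hrep _ _ _ _ _ (G mu 0 ltac:(lra)) (G lam 0 ltac:(lra)) I1 Hn Hm) as P.
  replace (su_mul (gLB mu 0) (gLB lam 0)) with (gLB (mu * lam) 0) in P by (apply SU11_eq; mats; field; lra).
  assert (0 < mu * lam) by nra.
  pose proof (H (mu * lam) _ ltac:(lra) P) as E1. pose proof (H mu _ ltac:(lra) Hn) as E2.
  rewrite !ln_mult in E1 by auto.
  replace (pw t lam) with m; auto.
  rewrite pw_nz by lra. rewrite Rabs_pos_eq by lra. unfold Rpower. rewrite <- (exp_ln m) by auto.
  f_equal. lra.
Qed.

Lemma Kp_kap x : Kp x = kap kappa t x.
Proof.
  assert (P : forall x, 0 < x -> Kp x = kap kappa t x).
  { clear x. intros x Hx. set (l := sqrt x). assert (Hl : 0 < l) by now apply sqrt_lt_R0.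
    replace x with (l * l * 1) by (rewrite Rmult_1_r; apply sqrt_sqrt; lra).
    rewrite (Kp_scale l (pw t l) 1 Hl (stretch_value l Hl)), Kp_one, kap_scale, kap_1 by lra.
    reflexivity. }
  destruct (Rtotal_order x 0) as [H|[->|H]]; auto.
  - replace x with (- - x) by ring. rewrite Kp_opp, kap_opp, P by lra. reflexivity.
  - now rewrite Kp_zero, kap_0.
Qed.

End HorosphericalData.

(** All that the construction retains of a representation. The last clause says that the c(x) are
    total in E, from which infinite dimensionality will be derived. *)
Theorem horospherical_data rho t eta1 eta2 kappa :
  isRep rho -> irreducible rho -> ellIs rho t -> distinguished rho eta1 eta2 ->
  K1of rho eta1 eta2 kappa ->
  0 < fst kappa /\ exists c : R -> vec, (forall x, ortho eta1 eta2 (c x)) /\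
    (forall x y, B (c x) (c y) =
      Cminus (Cminus (kap kappa t (x - y)) (kap kappa t x)) (Cconj (kap kappa t y))) /\
    (forall z, inH z -> B z eta1 = RtoC 0 -> B z eta2 = RtoC 0 ->
       (forall x, B z (c x) = RtoC 0) -> z = vzero).
Proof.
  intros Hrep Hirr Hell Hdist HK.
  destruct (unip_ex rho eta1 eta2 kappa Hrep Hdist HK) as [T HT].
  assert (Tl : forall b, lift rho (gLB 1 b) (T b)) by apply HT.
  assert (T1 : forall b, T b eta1 = eta1) by apply HT.
  split; [apply (kappa_re_pos rho t eta1 eta2 kappa) with T; auto|].
  exists (cvec eta1 eta2 T). split; [|split].
  - intro x. apply (cvec_ortho rho eta1 eta2); auto.
  - intros x y. rewrite (cvec_gram rho eta1 eta2) by auto.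
    rewrite !(Kp_kap rho t eta1 eta2 kappa) by auto. reflexivity.
  - intros z Hz. apply (cvec_nondeg rho t eta1 eta2 kappa); auto.
Qed.

(** * A Hilbert space model of the sum of two kernels *)

(** An enumeration of the rationals as (p - q)/(b + 1), by two Cantor pairings; Gram-Schmidt needs a
    sequence, while the kernel is indexed by the reals. *)
Definition dense_seq (j : nat) : R :=
  let (a, b) := of_nat j in let (p, q) := of_nat a in (INR p - INR q) / (INR b + 1).

Lemma dense_seq_spec (x eps : R) : 0 < eps -> exists j, Rabs (x - dense_seq j) < eps.
Proof.
  intro He. destruct (INR_unbounded (/ eps)) as [b Hb].
  assert (Hi : 0 < / eps) by now apply Rinv_0_lt_compat.
  set (m := INR b + 1). assert (Hm : / eps < m) by (unfold m; lra).
  destruct (archimed (x * m)) as [Z1 Z2]. set (z := up (x * m)) in *.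
  assert (E : exists p q, IZR z = INR p - INR q).
  { destruct (Z.le_gt_cases 0 z) as [H|H].
    - exists (Z.to_nat z), O. rewrite (INR_IZR_INZ (Z.to_nat z)), Z2Nat.id by lia. simpl. ring.
    - exists O, (Z.to_nat (- z)). rewrite (INR_IZR_INZ (Z.to_nat (- z))), Z2Nat.id by lia.
      rewrite opp_IZR. simpl. ring. }
  destruct E as (p & q & E). exists (to_nat (to_nat (p, q), b)).
  unfold dense_seq. rewrite !cancel_of_to. fold m. rewrite <- E.
  replace (x - IZR z / m) with (- ((IZR z - x * m) / m)) by (field; lra).
  rewrite Rabs_Ropp, Rabs_pos_eq.
  - apply Rle_lt_trans with (1 / m).
    + apply Rmult_le_compat_r; [left; apply Rinv_0_lt_compat; lra | lra].
    + unfold Rdiv. rewrite Rmult_1_l, <- (Rinv_inv eps). apply Rinv_lt_contravar; auto. nra.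
  - apply Rmult_le_pos; [lra | left; apply Rinv_0_lt_compat; lra].
Qed.

Definition smul {I : Type} (a : C) (l : list (C * I)) : list (C * I) :=
  map (fun p => (Cmult a (fst p), snd p)) l.

Lemma lincomb_smul {I : Type} (v : I -> vec) a l : lincomb v (smul a l) = vscal a (lincomb v l).
Proof.
  induction l as [|p l IH]; [symmetry; apply vscal_vzero|].
  change (smul a (p :: l)) with ((Cmult a (fst p), snd p) :: smul a l).
  rewrite !lincomb_cons, IH. vext. simpl. ring.
Qed.

Lemma lincomb_single {I : Type} (v : I -> vec) a i : lincomb v ((a, i) :: nil) = vscal a (v i).
Proof. apply vadd_0_r. Qed.

Lemma ortho_lincomb {I : Type} eta1 eta2 (c : I -> vec) l : inH eta1 -> inH eta2 ->
  (forall i, ortho eta1 eta2 (c i)) -> ortho eta1 eta2 (lincomb c l).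
Proof.
  intros I1 I2 Hc. assert (forall i, inH (c i)) by apply Hc.
  repeat split; hh; rewrite B_conj, B_lincomb_r by hh.
  - rewrite (krow_ext _ (fun _ => RtoC 0)) by (intro i; rewrite B_conj; destruct (Hc i) as (_ & -> & _); creq).
    induction l; simpl; [|rewrite <- (Cconj_conj (krow _ l)), IHl]; creq.
  - rewrite (krow_ext _ (fun _ => RtoC 0)) by (intro i; rewrite B_conj; destruct (Hc i) as (_ & _ & ->); creq).
    induction l; simpl; [|rewrite <- (Cconj_conj (krow _ l)), IHl]; creq.
Qed.

Section Model.
Context (eta1 eta2 : vec) (t : R) (k1 k2 : C) (c1 c2 : R -> vec).
Context (Hpair : hyp_pair eta1 eta2) (Ht : 0 < t) (Hk1 : 0 < fst k1) (Hk2 : 0 < fst k2).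
Context (O1 : forall x, ortho eta1 eta2 (c1 x)) (O2 : forall x, ortho eta1 eta2 (c2 x)).
Context (G1 : forall x y, B (c1 x) (c1 y) =
      Cminus (Cminus (kap k1 t (x - y)) (kap k1 t x)) (Cconj (kap k1 t y))).
Context (G2 : forall x y, B (c2 x) (c2 y) =
      Cminus (Cminus (kap k2 t (x - y)) (kap k2 t x)) (Cconj (kap k2 t y))).
Context (D1 : forall z, inH z -> B z eta1 = RtoC 0 -> B z eta2 = RtoC 0 ->
       (forall x, B z (c1 x) = RtoC 0) -> z = vzero).

Let I1 : inH eta1 := pair_inH1 _ _ Hpair.
Let I2 : inH eta2 := pair_inH2 _ _ Hpair.
Let Ic1 x : inH (c1 x) := proj1 (O1 x).
Let Ic2 x : inH (c2 x) := proj1 (O2 x).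
Hint Resolve I1 I2 Ic1 Ic2 : inH.

Let X : Type := list (C * R).
(** Minus the Gram form of the vectors (c1(x), c2(x)) in the sum of two copies of E, hence positive
    semidefinite. On single points it is K(x) + conj K(y) - K(x - y) for K = K1 + K2. *)
Let f (l l' : X) : C :=
  Copp (Cplus (B (lincomb c1 l) (lincomb c1 l')) (B (lincomb c2 l) (lincomb c2 l'))).
Let s (j : nat) : X := (RtoC 1, dense_seq j) :: nil.

Lemma form_add x y z : f (x ++ y) z = Cplus (f x z) (f y z).
Proof. unfold f. rewrite !lincomb_app. Bexp. ring. Qed.

Lemma form_scal a x z : f (smul a x) z = Cmult a (f x z).
Proof. unfold f. rewrite !lincomb_smul. Bexp. ring. Qed.

Lemma form_conj x y : f y x = Cconj (f x y).
Proof.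
  unfold f. rewrite (B_conj (lincomb c1 x)), (B_conj (lincomb c2 x)). now conjs.
Qed.

Lemma form_pos x : 0 <= fst (f x x).
Proof.
  pose proof (ortho_nonpos _ _ Hpair _ (ortho_lincomb _ _ c1 x I1 I2 O1)).
  pose proof (ortho_nonpos _ _ Hpair _ (ortho_lincomb _ _ c2 x I1 I2 O2)).
  unfold f, Copp, Cplus. cbn [fst snd]. lra.
Qed.

Lemma gram_diff (k : C) (c : R -> vec) x y : (forall x, inH (c x)) ->
  (forall x y, B (c x) (c y) = Cminus (Cminus (kap k t (x - y)) (kap k t x)) (Cconj (kap k t y))) ->
  fst (B (vdiff (c x) (c y)) (vdiff (c x) (c y))) = - 2 * (pw t (x - y) * fst k).
Proof.
  intros Ic G. rewrite <- kap_fst. unfold vdiff. Bexp. rewrite !G, !Rminus_diag, !kap_0.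
  replace (y - x) with (- (x - y)) by ring. rewrite kap_opp, Cconj_R. c2r. ring.
Qed.

(** Otherwise each rational point has a null residual for the sum of the forms, hence also for the
    first form, both being semidefinite of the same sign. A nonzero z in E orthogonal to the vectors
    of [es] under [c1] is then orthogonal to c1 at rationals, by continuity to every c1(x), and
    totality gives z = 0. *)
Lemma form_free es : exists j, 0 < fst (f (residual (@app _) smul f es (s j)) (residual (@app _) smul f es (s j))).
Proof.
  apply NNPP. intro N.
  destruct (exists_orthogonal (eta1 :: eta2 :: map (lincomb c1) es)) as (z & Hz & Nz & Oz).
  { intros w [<-|[<-|H]]; hh. apply in_map_iff in H. destruct H as (l & <- & _). hh. }
  assert (Z1 : B z eta1 = RtoC 0) by (apply Oz; simpl; auto).
  assert (Z2 : B z eta2 = RtoC 0) by (apply Oz; simpl; auto).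
  assert (R : forall x, B z (lincomb c1 (residual (@app _) smul f es x)) = B z (lincomb c1 x)).
  { intro x. assert (Ze : forall e, In e es -> B z (lincomb c1 e) = RtoC 0).
    { intros e He. apply Oz. right. right. now apply in_map. }
    clear N Oz. induction es as [|e es' IH]; [reflexivity|]. simpl residual.
    rewrite lincomb_app, lincomb_smul. Bexp. rewrite (Ze e), IH; simpl; auto.
    - ring.
    - intros e' He'. apply Ze. now right. }
  assert (Zd : forall j, B z (c1 (dense_seq j)) = RtoC 0).
  { intro j. rewrite <- (vscal_1 (c1 (dense_seq j))), <- lincomb_single. fold (s j).
    rewrite <- R. set (r := residual _ _ _ _ _).
    assert (E : lincomb c1 r = vzero).
    { apply (ortho_zero _ _ Hpair); [now apply ortho_lincomb|].
      apply Rnot_lt_le. intro L. apply N. exists j. fold r.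
      pose proof (ortho_nonpos _ _ Hpair _ (ortho_lincomb _ _ c2 r I1 I2 O2)).
      unfold f, Copp, Cplus. cbn [fst snd]. lra. }
    rewrite E. now apply B_vzero_r. }
  apply Nz, D1; auto. intro x.
  apply Cmod_sq_small with (- fst (B z z) * (2 * fst k1)). intros eps He.
  destruct (pw_small t eps Ht He) as (d & Hd & Hpw).
  destruct (dense_seq_spec x d Hd) as [j Hj]. specialize (Hpw _ Hj).
  replace (B z (c1 x)) with (B z (vdiff (c1 x) (c1 (dense_seq j)))).
  - assert (Oz' : ortho eta1 eta2 z) by (split; auto).
    assert (Od : ortho eta1 eta2 (vdiff (c1 x) (c1 (dense_seq j)))).
    { destruct (O1 x) as (A1 & A2 & A3), (O1 (dense_seq j)) as (A4 & A5 & A6).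
      split; [hh|]. split; rewrite B_vdiff_l by hh; [rewrite A2, A5|rewrite A3, A6]; ring. }
    eapply Rle_trans; [apply (ortho_cs _ _ Hpair _ _ Oz' Od)|].
    rewrite (gram_diff k1) by auto. pose proof (ortho_nonpos _ _ Hpair _ Oz').
    replace (fst (B z z) * (-2 * (pw t (x - dense_seq j) * fst k1)))
      with ((- fst (B z z) * (2 * fst k1)) * pw t (x - dense_seq j)) by ring.
    apply Rmult_le_compat_l; [|lra]. apply Rmult_le_pos; lra.
  - unfold vdiff. Bexp. rewrite Zd. ring.
Qed.

(** The squared distance between the generators at x and y is 2 |x - y|^t Re(k1 + k2), so rational
    points approximate the others. *)
Lemma form_approx x : approximable (@app _) smul f s ((RtoC 1, x) :: nil).
Proof.
  intros eps He. set (M := 2 * (fst k1 + fst k2)). assert (HM : 0 < M) by (unfold M; lra).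
  destruct (pw_small t (eps / M) Ht ltac:(apply Rdiv_lt_0_compat; lra)) as (d & Hd & Hpw).
  destruct (dense_seq_spec x d Hd) as [j Hj]. specialize (Hpw _ Hj). exists j.
  assert (E : forall c : R -> vec, lincomb c (((RtoC 1, x) :: nil) ++ smul (RtoC (-1)) (s j)) =
     vdiff (c x) (c (dense_seq j))).
  { intro c. rewrite lincomb_app, lincomb_smul. unfold s. rewrite !lincomb_single, !vscal_1. reflexivity. }
  unfold f. rewrite !E. unfold Cplus, Copp. cbn [fst snd].
  rewrite (gram_diff k1 c1), (gram_diff k2 c2) by auto.
  apply Rmult_lt_compat_r with (r := M) in Hpw; auto.
  replace (eps / M * M) with eps in Hpw by (field; lra). unfold M in Hpw. lra.
Qed.

Theorem kernel_model : exists ch : R -> vec,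
  (forall x, inH (ch x)) /\
  (forall n, exists l, delta n = lincomb ch l) /\
  (forall x y, ip (ch x) (ch y) =
     Cminus (Cplus (kap (Cplus k1 k2) t x) (Cconj (kap (Cplus k1 k2) t y)))
            (kap (Cplus k1 k2) t (x - y))).
Proof.
  destruct (hilbert_coordinates (@app _) smul f form_add form_scal form_conj form_pos s form_free)
    as (crd & H1 & H2 & H3 & H4 & H5).
  exists (fun x => crd ((RtoC 1, x) :: nil)). split; [|split]; auto.
  - intro n. destruct (H4 n) as [l ->]. exists l. induction l as [|[a x] l IH].
    (* The empty list equals its own multiple by 0, so homogeneity of [crd] sends it to zero. *)
    + change (@nil (C * R)) with (smul (RtoC 0) (@nil (C * R))) at 1. rewrite H3. apply vscal_0.
    + rewrite lincomb_cons, <- IH. cbn [fst snd]. rewrite <- H3, <- H2. simpl. do 3 f_equal. ring.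
  - intros x y. rewrite H5 by apply form_approx. unfold f. rewrite !lincomb_single, !vscal_1.
    rewrite G1, G2, !kap_add. conjs. ring.
Qed.

End Model.

(** * The orbit of the fixed point in the model *)

(** The factor 1/2 in [e2] normalises the pairing with [e1] to 1. *)
Definition e1 : vec := vadd (delta 0) (delta 1).
Definition e2 : vec := vscal (RtoC (/ 2)) (vdiff (delta 0) (delta 1)).
Definition shift1 (u : vec) : vec := fun n => match n with O => RtoC 0 | S m => u m end.
(** The copy of l^2 carried by the coordinates from 2 on is the complement E of the pair, where B is
    minus the inner product. *)
Definition shift2 (u : vec) : vec := shift1 (shift1 u).

Lemma inH_shift1 u : inH u -> inH (shift1 u).
Proof. intro H. apply (ex_series_incr_1 (fun n => Cmod (shift1 u n) ^ 2)). exact H. Qed.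

Lemma inH_shift2 u : inH u -> inH (shift2 u).
Proof. intro. now apply inH_shift1, inH_shift1. Qed.

Lemma inH_e1 : inH e1.
Proof. unfold e1. hh. Qed.
Lemma inH_e2 : inH e2.
Proof. unfold e2. hh. Qed.
#[local] Hint Resolve inH_shift2 inH_e1 inH_e2 : inH.

Lemma ip_shift1 u v : ip (shift1 u) (shift1 v) = ip u v.
Proof.
  unfold ip, CSeries. apply C_eq; cbn [fst snd]; rewrite Series_incr_1_aux; try reflexivity;
    simpl; ring.
Qed.

Lemma B_shift2 u v : B (shift2 u) (shift2 v) = Copp (ip u v).
Proof. rewrite B_ip. change (vtail (shift2 u)) with (shift1 u). change (vtail (shift2 v)) with (shift1 v).
  rewrite ip_shift1. simpl. creq. Qed.

Lemma shift2_lincomb {I : Type} (v : I -> vec) l :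
  shift2 (lincomb v l) = lincomb (fun i => shift2 (v i)) l.
Proof.
  induction l as [|p l IH].
  - apply functional_extensionality. intros [|[|n]]; reflexivity.
  - rewrite !lincomb_cons, <- IH. apply functional_extensionality.
    intros [|[|n]]; unfold vadd, vscal; simpl; ring.
Qed.

Lemma B_e1 u : inH u -> B u e1 = Cminus (u 0%nat) (u 1%nat).
Proof. intro. unfold e1. Bexp. rewrite !B_delta. simpl. creq. Qed.
Lemma B_e2 u : inH u -> B u e2 = Cmult (RtoC (/ 2)) (Cplus (u 0%nat) (u 1%nat)).
Proof. intro. unfold e2, vdiff. Bexp. rewrite !B_delta. simpl. rewrite !Cconj_R. creq. Qed.

Lemma e_pair : hyp_pair e1 e2.
Proof.
  assert (N : forall u : vec, u 0%nat <> RtoC 0 -> u <> vzero) by (intros u H E; apply H; now rewrite E).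
  repeat split; hh.
  - apply N. unfold e1, vadd. rewrite delta_eq, delta_neq by lia. intro E. apply C1_nz. rewrite <- E. ring.
  - rewrite B_e1 by hh. unfold e1, vadd. rewrite !delta_eq, !delta_neq by lia. ring.
  - apply N. unfold e2, vdiff, vadd, vscal. rewrite delta_eq, delta_neq by lia.
    intro E. apply (f_equal fst) in E. simpl in E. lra.
  - rewrite B_e2 by hh. unfold e2, vdiff, vadd, vscal. rewrite !delta_eq, !delta_neq by lia. creq.
  - rewrite B_e2 by hh. unfold e1, vadd. rewrite !delta_eq, !delta_neq by lia. creq. field.
Qed.

Lemma delta0_e : delta 0 = vadd (vscal (RtoC (/ 2)) e1) e2.
Proof. unfold e1, e2. vext. unfold vdiff, vadd, vscal. creq; field. Qed.
Lemma delta1_e : delta 1 = vadd (vscal (RtoC (/ 2)) e1) (vscal (RtoC (-1)) e2).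
Proof. unfold e1, e2. vext. unfold vdiff, vadd, vscal. creq; field. Qed.

Lemma B_shift2_e1 u : inH u -> B (shift2 u) e1 = RtoC 0.
Proof. intro. rewrite B_e1 by hh. simpl. ring. Qed.
Lemma B_shift2_e2 u : inH u -> B (shift2 u) e2 = RtoC 0.
Proof. intro. rewrite B_e2 by hh. simpl. ring. Qed.

Definition spanned {I : Type} (v : I -> vec) (u : vec) : Prop := exists l, u = lincomb v l.

Lemma spanned_lin {I : Type} (v : I -> vec) a u w :
  spanned v u -> spanned v w -> spanned v (vadd (vscal a u) w).
Proof.
  intros [l ->] [l' ->]. exists (smul a l ++ l'). now rewrite lincomb_app, lincomb_smul.
Qed.
Lemma spanned_in {I : Type} (v : I -> vec) i : spanned v (v i).
Proof. exists ((RtoC 1, i) :: nil). now rewrite lincomb_single, vscal_1. Qed.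
Lemma spanned_vzero {I : Type} (v : I -> vec) : spanned v vzero.
Proof. now exists nil. Qed.
Lemma spanned_scal {I : Type} (v : I -> vec) a u : spanned v u -> spanned v (vscal a u).
Proof. intro H. rewrite <- (vadd_0_r (vscal a u)). apply spanned_lin; auto. apply spanned_vzero. Qed.
Lemma spanned_trans {I J : Type} (v : I -> vec) (w : J -> vec) u :
  (forall i, spanned w (v i)) -> spanned v u -> spanned w u.
Proof.
  intros H [l ->]. induction l as [|p l IH]; [apply spanned_vzero|].
  rewrite lincomb_cons. apply spanned_lin; auto.
Qed.

(* Agreement on a spanning family suffices, since the coordinates of [S u - T u] are
   bounded functionals vanishing on every [delta m]. *)
Lemma unitary_ext {I : Type} (S T : vec -> vec) (v : I -> vec) :
  unitaryB S -> unitaryB T -> (forall i, inH (v i)) -> (forall m, spanned v (delta m)) ->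
  (forall i, S (v i) = T (v i)) -> forall u, inH u -> S u = T u.
Proof.
  intros HS HT Hv Hs E u Hu. apply vdiff_0, B_nondeg. intro m.
  pose proof (nsq_ge_0 _ (uni_inH S _ HS (inH_delta 0))) as PS.
  pose proof (nsq_ge_0 _ (uni_inH T _ HT (inH_delta 0))) as PT.
  set (MS := nsq (S (delta 0))) in PS. set (MT := nsq (T (delta 0))) in PT.
  apply functional_zero with (phi := fun u => B (vdiff (S u) (T u)) (delta m))
    (M := 4 * (2 * (8 * MS + 1) + 2 * (8 * MT + 1)) * nsq (delta m)); auto.
  - intros. rewrite (uni_lin S), (uni_lin T) by hh. unfold vdiff. Bexp. ring.
  - intros x Hx. eapply Rle_trans; [apply B_bound; hh|].
    pose proof (nsq_ge_0 _ (inH_delta m)). pose proof (nsq_ge_0 _ Hx).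
    assert (nsq (vdiff (S x) (T x)) <= (2 * (8 * MS + 1) + 2 * (8 * MT + 1)) * nsq x).
    { unfold vdiff. eapply Rle_trans; [apply nsq_add; hh|]. rewrite nsq_scal, Cmod_R.
      rewrite <- Rsqr_pow2, <- Rsqr_abs. unfold Rsqr.
      pose proof (uni_bound S x HS Hx). pose proof (uni_bound T x HT Hx). unfold MS, MT. lra. }
    apply (Rmult_le_compat_r (nsq (delta m))) in H1; auto. lra.
  - intro n. destruct (Hs n) as [l ->]. rewrite (uni_lincomb S), (uni_lincomb T) by auto.
    replace (lincomb (fun i => S (v i)) l) with (lincomb (fun i => T (v i)) l).
    + unfold vdiff. Bexp. creq.
    + induction l as [|p l IH]; [reflexivity|]. rewrite !lincomb_cons, IH, E. reflexivity.
Qed.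

Section Family.
Context (k : C) (t : R) (ch : R -> vec) (Hk : 0 < fst k) (Ht : 0 < t).
Context (Hch : forall x, inH (ch x)) (Sch : forall n, exists l, delta n = lincomb ch l)
  (Gch : forall x y, ip (ch x) (ch y) =
     Cminus (Cplus (kap k t x) (Cconj (kap k t y))) (kap k t (x - y))).
Hint Resolve Hch : inH.

(** The boundary circle: [None] is the point at infinity, and the vector at x has the shape K(x)
    eta1 + eta2 + c(x) of T_x eta2. *)
Definition V (i : option R) : vec :=
  match i with
  | None => e1
  | Some x => vadd (vadd (vscal (kap k t x) e1) e2) (shift2 (ch x))
  end.

Lemma inH_V i : inH (V i).
Proof. destruct i; simpl; hh. Qed.
Hint Resolve inH_V : inH.

Definition ker (i j : option R) : C :=
  match i, j with
  | None, None => RtoC 0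
  | Some x, Some y => kap k t (x - y)
  | _, _ => RtoC 1
  end.

Lemma V_gram i j : B (V i) (V j) = ker i j.
Proof.
  assert (P := e_pair).
  pose proof (pair_11 _ _ P) as E11. pose proof (pair_12 _ _ P) as E12.
  pose proof (pair_21 _ _ P) as E21. pose proof (pair_22 _ _ P) as E22.
  destruct i as [x|], j as [y|]; simpl; Bexp;
    rewrite ?E11, ?E12, ?E21, ?E22, ?B_shift2, ?B_shift2_e1, ?B_shift2_e2 by hh.
  - rewrite (B_conj (shift2 (ch y)) e1), (B_conj (shift2 (ch y)) e2), B_shift2_e1, B_shift2_e2, Gch, Cconj_R by hh. ring.
  - ring.
  - rewrite (B_conj (shift2 (ch y)) e1), B_shift2_e1, Cconj_R by hh. ring.
  - reflexivity.
Qed.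

Lemma ch_0 : ch 0 = vzero.
Proof.
  apply nsq_eq_0; auto. right. apply RtoC_inj. rewrite <- ip_self, Gch, Rminus_diag, kap_0. creq.
Qed.

Lemma V_0 : V (Some 0) = e2.
Proof.
  simpl. rewrite kap_0, ch_0. apply functional_extensionality.
  intros [|[|n]]; unfold vadd, vscal, shift2, shift1, vzero; ring.
Qed.

Lemma V_span m : spanned V (delta m).
Proof.
  assert (S1 : spanned V e1) by apply (spanned_in V None).
  assert (S2 : spanned V e2) by (rewrite <- V_0; apply spanned_in).
  destruct m as [|[|m]].
  - rewrite delta0_e. now apply spanned_lin.
  - rewrite delta1_e. apply spanned_lin; auto. now apply spanned_scal.
  - replace (delta (S (S m))) with (shift2 (delta m)).
    + destruct (Sch m) as [l ->]. rewrite shift2_lincomb.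
      apply spanned_trans with (v := fun x => shift2 (ch x)); [|now exists l].
      intro x. replace (shift2 (ch x)) with
        (vadd (vscal (RtoC (-1)) (vadd (vscal (kap k t x) e1) e2)) (V (Some x))).
      * apply spanned_lin; [now apply spanned_lin | apply spanned_in].
      * simpl. vext. creq.
    + apply functional_extensionality. intros [|[|n]]; unfold delta; reflexivity.
Qed.

Lemma k_nz : k <> RtoC 0.
Proof. intros E. rewrite E in Hk. simpl in Hk. lra. Qed.
Lemma k_mod : 0 < Cmod k.
Proof. apply Cmod_gt_0, k_nz. Qed.

Lemma kap_nz x : x <> 0 -> kap k t x <> RtoC 0.
Proof.
  intros Hx E. pose proof (kap_fst k t x) as F. rewrite E in F. simpl in F.
  pose proof (pw_pos t x Hx). nra.
Qed.

Lemma ker_nz i j : i <> j -> ker i j <> RtoC 0.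
Proof.
  destruct i as [x|], j as [y|]; simpl; intro H; try apply C1_nz; try congruence.
  apply kap_nz. intro E. apply H. f_equal. lra.
Qed.

Lemma ker_diag i : ker i i = RtoC 0.
Proof. destruct i; simpl; [|reflexivity]. rewrite Rminus_diag. apply kap_0. Qed.

Lemma V_not_propto i j : i <> j -> ~ propto (V i) (V j).
Proof.
  intros H [c E]. apply (ker_nz _ _ H). rewrite <- V_gram, E. Bexp.
  rewrite V_gram, ker_diag. ring.
Qed.

Lemma V_nz i : V i <> vzero.
Proof.
  intro E. apply (V_not_propto i (match i with None => Some 0 | _ => None end)).
  - destruct i; discriminate.
  - exists (RtoC 0). now rewrite vscal_0.
Qed.

Lemma V_nz_image T i : unitaryB T -> T (V i) <> vzero.
Proof.
  intros HT E. apply (V_nz i). apply uni_inj with T; hh. now rewrite E, uni_vzero.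
Qed.

(** A permutation of the boundary points which changes the kernel only by multipliers carries the
    family to one with the same Gram matrix and the same span; nonzero multipliers keep the span. *)
Lemma move_unitary (sg : option R -> option R) (f : option R -> C) :
  (forall i j, Cmult (f i) (Cmult (Cconj (f j)) (ker (sg i) (sg j))) = ker i j) ->
  (forall j, exists i, sg i = j /\ f i <> RtoC 0) ->
  exists T, unitaryB T /\ forall i, T (V i) = vscal (f i) (V (sg i)).
Proof.
  intros H Hs. apply gram_unitary; hh.
  - intros i j. Bexp. rewrite !V_gram, H. reflexivity.
  - apply V_span.
  - intro m. apply (spanned_trans V); [|apply V_span]. intro j.
    destruct (Hs j) as (i & <- & Hf).
    replace (V (sg i)) with (vscal (Cinv (f i)) (vscal (f i) (V (sg i)))).
    + apply spanned_scal. exact (spanned_in (fun i => vscal (f i) (V (sg i))) i).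
    + rewrite vscal_vscal, Cinv_l, vscal_1; auto.
Qed.

(** * Translations, dilations and the inversion *)

Definition trans_pt (b : R) (i : option R) : option R := option_map (fun x => x + b) i.
Definition dil_pt (l : R) (i : option R) : option R := option_map (fun x => l * l * x) i.
(** Finite points need the multiplier l^(-t) to absorb K(l^2 x) = l^(2t) K(x); the pairing 1 with
    the point at infinity then forces l^t there. *)
Definition dil_fac (l : R) (i : option R) : C :=
  match i with None => RtoC (pw t l) | Some _ => RtoC (/ pw t l) end.

Lemma trans_ex b : exists T, unitaryB T /\ forall i, T (V i) = V (trans_pt b i).
Proof.
  destruct (move_unitary (trans_pt b) (fun _ => RtoC 1)) as (T & HT & E).
  - intros [x|] [y|]; simpl; rewrite Cconj_R; try ring.
    replace (x + b - (y + b)) with (x - y) by ring. ring.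
  - intros [y|].
    + exists (Some (y - b)). split; [simpl; f_equal; ring | apply C1_nz].
    + exists None. split; [reflexivity | apply C1_nz].
  - exists T. split; auto. intro i. now rewrite E, vscal_1.
Qed.

Lemma dil_ex l : l <> 0 -> exists T, unitaryB T /\
  forall i, T (V i) = vscal (dil_fac l i) (V (dil_pt l i)).
Proof.
  intro Hl. pose proof (pw_pos t l Hl) as Hp. apply move_unitary.
  - intros [x|] [y|]; simpl; rewrite ?Cconj_R.
    + replace (l * l * x - l * l * y) with (l * l * (x - y)) by ring.
      rewrite kap_scale, !Cmult_assoc, <- !RtoC_mult by auto.
      replace (/ pw t l * / pw t l * (pw t l * pw t l)) with 1 by (field; lra). ring.
    + rewrite Cmult_1_r, <- RtoC_mult, Rinv_l by lra. reflexivity.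
    + rewrite Cmult_1_r, <- RtoC_mult, Rinv_r by lra. reflexivity.
    + ring.
  - intros [y|].
    + exists (Some (y / (l * l))). split; [simpl; f_equal; field; auto |].
      simpl. intro E. apply RtoC_inj in E. pose proof (Rinv_0_lt_compat _ Hp). lra.
    + exists None. split; [reflexivity|]. simpl. intro E. apply RtoC_inj in E. lra.
Qed.

Definition weyl_pt (i : option R) : option R :=
  match i with
  | None => Some 0
  | Some x => if Req_dec_T x 0 then None else Some (- / x)
  end.
(** Forced up to a common unit: pairing infinity with x requires f(inf) conj f(x) K(1/x) = 1,
    pairing it with 0 requires f(inf) conj f(0) = 1, and two finite points fix |f(inf)| = 1/|k|. *)
Definition weyl_fac (i : option R) : C :=
  match i with
  | None => RtoC (/ Cmod k)
  | Some x => if Req_dec_T x 0 then RtoC (Cmod k) else Cmult (RtoC (/ Cmod k)) (kap k t x)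
  end.

(* With [k] normalised to modulus 1, this is the homogeneity of [kap] under
   [- / x + / y = (x - y) / (x y)], the phases cancelling in each of the possible sign patterns. *)
Lemma kap_inversion x y : x <> 0 -> y <> 0 ->
  Cmult (kap k t x) (Cmult (Cconj (kap k t y)) (kap k t (- / x - - / y))) =
  Cmult (RtoC (Cmod k ^ 2)) (kap k t (x - y)).
Proof.
  intros Hx Hy.
  replace (- / x - - / y) with ((x - y) * (/ x * / y)) by (field; auto).
  destruct (Req_dec x y) as [->|Hxy].
  { rewrite Rminus_diag, Rmult_0_l, kap_0. ring. }
  assert (E : Cmult (phase k x) (Cmult (Cconj (phase k y)) (phase k ((x - y) * (/ x * / y)))) =
    Cmult (RtoC (Cmod k ^ 2)) (phase k (x - y))).
  { rewrite <- Cmult_conj_self.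
    assert (S : forall z, z <> 0 -> 0 < z /\ 0 < / z \/ z < 0 /\ / z < 0).
    { intros z Hz. destruct (Rtotal_order z 0) as [H|[H|H]]; [right|contradiction|left].
      - split; auto. now apply Rinv_lt_0_compat.
      - split; auto. now apply Rinv_0_lt_compat. }
    destruct (S x Hx) as [[X1 X2]|[X1 X2]], (S y Hy) as [[Y1 Y2]|[Y1 Y2]],
      (S (x - y) ltac:(lra)) as [[Z1 _]|[Z1 _]]; try lra.
    - rewrite !phase_pos by (repeat apply Rmult_lt_0_compat; auto). ring.
    - assert (0 < / x * / y) by nra. rewrite (phase_pos k x), (phase_pos k y), !phase_neg by nra. ring.
    - assert (/ x * / y < 0) by nra.
      rewrite (phase_pos k x), (phase_neg k y), (phase_neg k (_ * _)), phase_pos, Cconj_conj by nra. ring.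
    - assert (/ x * / y < 0) by nra.
      rewrite (phase_neg k x), (phase_pos k y), (phase_pos k (_ * _)), phase_neg by nra. ring.
    - assert (0 < / x * / y) by nra.
      rewrite (phase_neg k x), (phase_neg k y), !phase_pos, Cconj_conj by nra. ring.
    - assert (0 < / x * / y) by nra.
      rewrite !phase_neg, Cconj_conj by nra. ring. }
  unfold kap. rewrite !pw_mult, !pw_inv, Cmult_conj, Cconj_R by auto.
  pose proof (pw_pos t x Hx). pose proof (pw_pos t y Hy).
  transitivity (Cmult (RtoC (pw t x * pw t y * (pw t (x - y) * (/ pw t x * / pw t y))))
    (Cmult (phase k x) (Cmult (Cconj (phase k y)) (phase k ((x - y) * (/ x * / y)))))).
  { rewrite !RtoC_mult. ring. }
  rewrite E. replace (pw t x * pw t y * (pw t (x - y) * (/ pw t x * / pw t y)))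
    with (pw t (x - y)) by (field; lra).
  ring.
Qed.

Lemma weyl_ex : exists T, unitaryB T /\ forall i, T (V i) = vscal (weyl_fac i) (V (weyl_pt i)).
Proof.
  pose proof k_mod as Hm. assert (Hi := Rinv_0_lt_compat _ Hm).
  assert (Fs : forall i, weyl_fac i <> RtoC 0).
  { intros [x|]; simpl; [destruct (Req_dec_T x 0) as [E|E]|].
    - intro F. apply RtoC_inj in F. lra.
    - apply Cmult_neq_0; [|now apply kap_nz]. intro F. apply RtoC_inj in F. lra.
    - intro F. apply RtoC_inj in F. lra. }
  assert (N : forall x, x <> 0 -> Cmult (kap k t x) (Cmult (Cconj (RtoC (/ Cmod k))) (RtoC (Cmod k))) = kap k t x).
  { intros. rewrite Cconj_R, <- RtoC_mult, Rinv_l by lra. ring. }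
  apply move_unitary.
  (* Conjugate symmetry of the kernel exchanges [i] and [j], which halves the case analysis over 0,
     infinity and the other points. *)
  - assert (R : forall i j, Cmult (weyl_fac i) (Cmult (Cconj (weyl_fac j)) (ker (weyl_pt i) (weyl_pt j))) = ker i j ->
      Cmult (weyl_fac j) (Cmult (Cconj (weyl_fac i)) (ker (weyl_pt j) (weyl_pt i))) = ker j i).
    { intros i j H. rewrite <- !V_gram in *. rewrite (B_conj (V i) (V j)), <- H, (B_conj (V (weyl_pt i))).
      conjs. ring. }
    assert (P : forall x, x <> 0 -> Cmult (RtoC (/ Cmod k)) (Cmult (Cconj (kap k t x)) (Cmult (RtoC (/ Cmod k)) (kap k t (/ x)))) = RtoC 1).
    { intros x Hx. rewrite <- kap_opp. pose proof (pw_pos t x Hx) as Hp.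
      replace (Cmult (kap k t (- x)) (Cmult (RtoC (/ Cmod k)) (kap k t (/ x)))) with
        (RtoC (Cmod k)).
      - rewrite <- RtoC_mult, Rinv_l by lra. reflexivity.
      - transitivity (Cmult (RtoC (/ Cmod k)) (Cmult (phase k (- x)) (phase k (/ x)))).
        + replace (Cmult (phase k (- x)) (phase k (/ x))) with (RtoC (Cmod k ^ 2)).
          * rewrite <- RtoC_mult. f_equal. field. lra.
          * rewrite <- Cmult_conj_self. destruct (Rtotal_order x 0) as [H|[H|H]]; [|contradiction|].
            -- assert (/ x < 0) by now apply Rinv_lt_0_compat.
               rewrite phase_pos, phase_neg by lra. reflexivity.
            -- assert (0 < / x) by now apply Rinv_0_lt_compat.
               rewrite phase_neg, phase_pos by lra. ring.
        + unfold kap. rewrite pw_opp, pw_inv by auto.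
          transitivity (Cmult (RtoC (pw t x * / pw t x)) (Cmult (RtoC (/ Cmod k)) (Cmult (phase k (- x)) (phase k (/ x))))).
          * rewrite Rinv_r by lra. ring.
          * rewrite RtoC_mult. ring. }
    assert (Q : forall x, Cmult (weyl_fac None) (Cmult (Cconj (weyl_fac (Some x))) (ker (weyl_pt None) (weyl_pt (Some x)))) = ker None (Some x)).
    { intro x. simpl. destruct (Req_dec_T x 0) as [->|E]; simpl.
      - rewrite Cconj_R, Cmult_1_r, <- RtoC_mult, Rinv_l by lra. reflexivity.
      - rewrite <- (P x E). replace (0 - - / x) with (/ x) by ring. rewrite Cmult_conj, Cconj_R. ring. }
    assert (Q0 : forall x, Cmult (weyl_fac (Some x)) (Cmult (Cconj (weyl_fac (Some 0))) (ker (weyl_pt (Some x)) (weyl_pt (Some 0)))) = ker (Some x) (Some 0)).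
    { intro x. simpl. destruct (Req_dec_T 0 0) as [_|F]; [|lra]. destruct (Req_dec_T x 0) as [->|E]; simpl.
      - rewrite Rminus_diag, kap_0. ring.
      - rewrite Rminus_0_r, Cconj_R.
        transitivity (Cmult (RtoC (/ Cmod k * Cmod k)) (kap k t x)); [rewrite RtoC_mult; ring|].
        rewrite Rinv_l by lra. ring. }
    intros [x|] [y|]; [| | |simpl; rewrite Rminus_diag, kap_0; ring].
    + destruct (Req_dec y 0) as [->|Hy]; [apply Q0|]. destruct (Req_dec x 0) as [->|Hx]; [apply R, Q0|].
      simpl. destruct (Req_dec_T x 0) as [F|_]; [contradiction|]. destruct (Req_dec_T y 0) as [F|_]; [contradiction|].
      simpl. rewrite Cmult_conj, Cconj_R.
      transitivity (Cmult (RtoC (/ Cmod k * / Cmod k)) (Cmult (kap k t x) (Cmult (Cconj (kap k t y)) (kap k t (- / x - - / y))))).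
      * rewrite RtoC_mult. ring.
      * rewrite kap_inversion, Cmult_assoc, <- RtoC_mult by auto.
        replace (/ Cmod k * / Cmod k * Cmod k ^ 2) with 1 by (field; lra). ring.
    + apply R, Q.
    + apply Q.
  - intros [y|].
    + destruct (Req_dec y 0) as [->|Hy].
      * exists None. split; auto.
      * exists (Some (- / y)). split; auto. simpl.
        assert (/ y <> 0) by now apply Rinv_neq_0_compat.
        destruct (Req_dec_T (- / y) 0) as [F|_]; [lra|]. f_equal. field. auto.
    + exists (Some 0). split; auto. simpl. destruct (Req_dec_T 0 0); [reflexivity|lra].
Qed.

(** * The action of SU(1,1) *)

Definition pt (p q : R) : option R := if Req_dec_T q 0 then None else Some (p / q).

Lemma pt_inf p : pt p 0 = None.
Proof. unfold pt. destruct (Req_dec_T 0 0); [reflexivity|lra]. Qed.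
Lemma pt_fin p q : q <> 0 -> pt p q = Some (p / q).
Proof. intro. unfold pt. destruct (Req_dec_T q 0); [contradiction|reflexivity]. Qed.
Lemma pt_scale a p q : a <> 0 -> pt (a * p) (a * q) = pt p q.
Proof.
  intro Ha. destruct (Req_dec q 0) as [->|Hq].
  - now rewrite Rmult_0_r, !pt_inf.
  - rewrite !pt_fin by (auto using Rmult_integral_contrapositive_currified). f_equal. field. auto.
Qed.

(** Points are given by homogeneous coordinates [p : q], so that infinity needs no separate
    treatment in products. The multiplier is left unspecified: composition works without tracking a
    cocycle. *)
Definition acts (T : vec -> vec) (g : SU11) : Prop :=
  unitaryB T /\ forall p q, ~ (p = 0 /\ q = 0) -> exists c,
    T (V (pt p q)) = vscal c (V (pt (mA g * p + mB g * q) (mC g * p + mD g * q))).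

Lemma acts_comp S T g h : inSU11 h -> acts S g -> acts T h -> acts (fun u => S (T u)) (su_mul g h).
Proof.
  intros Hh [HS S1] [HT T1]. split; [now apply unitaryB_comp|]. intros p q Hpq.
  destruct (T1 p q Hpq) as [c Ec].
  destruct (S1 (mA h * p + mB h * q) (mC h * p + mD h * q)) as [d Ed].
  { intros [E1 E2]. apply inSU11_det in Hh. apply Hpq. split.
    - replace p with ((mA h * mD h - mB h * mC h) * p) by (rewrite Hh; ring).
      replace ((mA h * mD h - mB h * mC h) * p) with
        (mD h * (mA h * p + mB h * q) - mB h * (mC h * p + mD h * q)) by ring.
      rewrite E1, E2. ring.
    - replace q with ((mA h * mD h - mB h * mC h) * q) by (rewrite Hh; ring).
      replace ((mA h * mD h - mB h * mC h) * q) with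
        (mA h * (mC h * p + mD h * q) - mC h * (mA h * p + mB h * q)) by ring.
      rewrite E1, E2. ring. }
  exists (Cmult c d). rewrite Ec, (uni_vscal S), Ed, vscal_vscal by hh. do 2 f_equal.
  rewrite mA_mul, mB_mul, mC_mul, mD_mul. f_equal; ring.
Qed.

Lemma acts_mone : acts (fun u => u) su_mone.
Proof.
  split; [apply unitaryB_id|]. intros p q _. exists (RtoC 1). rewrite vscal_1. f_equal.
  rewrite <- (pt_scale (-1)) by lra. mats. f_equal; ring.
Qed.

Lemma acts_trans T b : unitaryB T -> (forall i, T (V i) = V (trans_pt b i)) -> acts T (gLB 1 b).
Proof.
  intros HT E. split; auto. intros p q Hpq. exists (RtoC 1). rewrite vscal_1, E. f_equal.
  destruct (mat_of_mat 1 b 0 (/ 1)) as (E1 & E2 & E3 & E4). rewrite gLB_of_mat, E1, E2, E3, E4.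
  rewrite Rinv_1, Rmult_0_l, Rplus_0_l, !Rmult_1_l.
  destruct (Req_dec q 0) as [->|Hq].
  - now rewrite !pt_inf.
  - rewrite !pt_fin by auto. simpl. f_equal. field. auto.
Qed.

Lemma acts_dil T l : l <> 0 -> unitaryB T ->
  (forall i, T (V i) = vscal (dil_fac l i) (V (dil_pt l i))) -> acts T (of_mat l 0 0 (/ l)).
Proof.
  intros Hl HT E. split; auto. intros p q Hpq. exists (dil_fac l (pt p q)). rewrite E. do 2 f_equal.
  destruct (mat_of_mat l 0 0 (/ l)) as (E1 & E2 & E3 & E4). rewrite E1, E2, E3, E4.
  assert (/ l <> 0) by now apply Rinv_neq_0_compat.
  destruct (Req_dec q 0) as [->|Hq].
  - replace (0 * p + / l * 0) with 0 by ring. rewrite !pt_inf. reflexivity.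
  - rewrite !Rmult_0_l, Rplus_0_l, Rplus_0_r, !pt_fin by (auto using Rmult_integral_contrapositive_currified).
    simpl. f_equal. field. auto.
Qed.

Lemma acts_weyl T : unitaryB T -> (forall i, T (V i) = vscal (weyl_fac i) (V (weyl_pt i))) ->
  acts T suW.
Proof.
  intros HT E. split; auto. intros p q Hpq. exists (weyl_fac (pt p q)). rewrite E. do 2 f_equal.
  destruct (mat_of_mat 0 (-1) 1 0) as (E1 & E2 & E3 & E4). unfold suW. rewrite E1, E2, E3, E4.
  replace (0 * p + -1 * q) with (- q) by ring. replace (1 * p + 0 * q) with p by ring.
  destruct (Req_dec q 0) as [->|Hq].
  - rewrite pt_inf. assert (p <> 0) by tauto. rewrite pt_fin by auto. simpl. f_equal. field. auto.
  - rewrite pt_fin by auto. simpl. destruct (Req_dec_T (p / q) 0) as [F|F].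
    + replace p with (p / q * q) by (field; auto). rewrite F, Rmult_0_l, pt_inf. reflexivity.
    + assert (p <> 0) by (intros ->; apply F; unfold Rdiv; ring). rewrite pt_fin by auto.
      f_equal. field. auto.
Qed.

Lemma inSU11_diag l : l <> 0 -> inSU11 (of_mat l 0 0 (/ l)).
Proof. intro H. apply inSU11_det. destruct (mat_of_mat l 0 0 (/ l)) as (-> & -> & -> & ->). field. auto. Qed.

(** The upper factor of [bruhat] is split so that only translations, dilations and [suW] occur. For
    g near [suW] all factors but [suW] are near the identity, which the continuity proof
    exploits. *)
Lemma big_cell g : inSU11 g -> mC g <> 0 ->
  g = su_mul (gLB 1 (mA g / mC g)) (su_mul (of_mat (/ mC g) 0 0 (/ / mC g))
        (su_mul suW (gLB 1 (mD g / mC g)))).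
Proof.
  intros H Hc. apply inSU11_det in H.
  assert (E : mB g = (mA g * mD g - 1) / mC g).
  { apply Rmult_eq_reg_r with (mC g); auto. unfold Rdiv. rewrite Rmult_assoc, Rinv_l by auto. lra. }
  set (a := mA g) in *. set (b := mB g) in *. set (c := mC g) in *. set (d := mD g) in *.
  apply SU11_eq; fold a b c d; rewrite ?E; mats; field; auto.
Qed.

Lemma upper_cell g : inSU11 g -> mC g = 0 ->
  g = su_mul (gLB 1 (mB g * mA g)) (of_mat (mA g) 0 0 (/ mA g)) /\ mA g <> 0.
Proof.
  intros H Hc. apply inSU11_det in H. rewrite Hc in H.
  assert (Ha : mA g <> 0) by (intro Z; rewrite Z in H; lra). split; auto.
  assert (E : mD g = / mA g) by (apply Rmult_eq_reg_l with (mA g); [rewrite Rinv_r; lra|lra]).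
  set (a := mA g) in *. set (b := mB g) in *.
  apply SU11_eq; fold a b; rewrite ?Hc, ?E; mats; field; auto.
Qed.

Lemma acts_ex g : inSU11 g -> exists T, acts T g.
Proof.
  intro Hg. assert (N1 : 1 <> 0) by lra. destruct (Req_dec (mC g) 0) as [Hc|Hc].
  - destruct (upper_cell g Hg Hc) as [E Ha].
    destruct (trans_ex (mB g * mA g)) as (T1 & U1 & F1). destruct (dil_ex (mA g) Ha) as (T2 & U2 & F2).
    exists (fun u => T1 (T2 u)). rewrite E.
    apply acts_comp; [now apply inSU11_diag | now apply acts_trans | now apply acts_dil].
  - assert (Hi : / mC g <> 0) by now apply Rinv_neq_0_compat.
    destruct (trans_ex (mA g / mC g)) as (T1 & U1 & F1). destruct (dil_ex (/ mC g) Hi) as (T2 & U2 & F2).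
    destruct weyl_ex as (T3 & U3 & F3). destruct (trans_ex (mD g / mC g)) as (T4 & U4 & F4).
    exists (fun u => T1 (T2 (T3 (T4 u)))). rewrite (big_cell g Hg Hc).
    assert (G4 : inSU11 (gLB 1 (mD g / mC g))) by now apply inSU11_gLB.
    assert (G3 := inSU11_mul _ _ inSU11_W G4).
    apply (acts_comp T1 (fun u => T2 (T3 (T4 u)))); [|now apply acts_trans|].
    { apply inSU11_mul; auto. now apply inSU11_diag. }
    apply (acts_comp T2 (fun u => T3 (T4 u))); [auto|now apply acts_dil|].
    apply (acts_comp T3 T4); [auto|now apply acts_weyl|now apply acts_trans].
Qed.

Lemma pt_surj i : exists p q, ~ (p = 0 /\ q = 0) /\ pt p q = i.
Proof.
  destruct i as [x|].
  - exists x, 1. split; [lra|]. rewrite pt_fin by lra. f_equal. field.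
  - exists 1, 0. split; [lra|]. apply pt_inf.
Qed.

(* The ratio [r] of the multipliers of two operators acting as [g] satisfies [r i * conj (r j) = 1]
   for [i <> j], because [ker i j <> 0]; three points force it to be a constant unit. *)
Lemma acts_unique S T g : acts S g -> acts T g ->
  exists c, Cmod c = 1 /\ forall u, inH u -> S u = vscal c (T u).
Proof.
  intros [HS S1] [HT T1].
  assert (Q : forall i, exists r, S (V i) = vscal r (T (V i))).
  { intro i. destruct (pt_surj i) as (p & q & Hpq & <-).
    destruct (S1 p q Hpq) as [b Eb], (T1 p q Hpq) as [a Ea].
    assert (Na : a <> RtoC 0).
    { intros ->. rewrite vscal_0 in Ea. revert Ea. apply V_nz_image; auto. }
    exists (Cmult b (Cinv a)). rewrite Eb, Ea, vscal_vscal. f_equal. field. auto. }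
  assert (Q2 : forall i j r r', i <> j -> S (V i) = vscal r (T (V i)) -> S (V j) = vscal r' (T (V j)) ->
     Cmult r (Cconj r') = RtoC 1).
  { intros i j r r' Hij E E'. pose proof (uni_B S (V i) (V j) HS (inH_V i) (inH_V j)) as F.
    rewrite E, E' in F. rewrite B_scal_l, B_scal_r, (uni_B T) in F by hh. rewrite V_gram in F.
    pose proof (ker_nz i j Hij) as N.
    replace (Cmult r (Cconj r')) with (Cdiv (Cmult r (Cmult (Cconj r') (ker i j))) (ker i j)) by (field; auto).
    rewrite F. field. auto. }
  destruct (Q None) as [r Er], (Q (Some 0)) as [r0 Er0], (Q (Some 1)) as [r1 Er1].
  assert (N01 : Some 0 <> Some 1) by (intro E; injection E; intro; lra).
  pose proof (Q2 None (Some 0) _ _ ltac:(discriminate) Er Er0) as A.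
  pose proof (Q2 None (Some 1) _ _ ltac:(discriminate) Er Er1) as A1.
  pose proof (Q2 _ _ _ _ N01 Er0 Er1) as A2.
  assert (Can : forall a b c : C, Cmult a c = RtoC 1 -> Cmult b c = RtoC 1 -> a = b).
  { intros a b c H H'. transitivity (Cmult (Cmult b c) a); [rewrite H'; ring|].
    transitivity (Cmult b (Cmult a c)); [ring|]. rewrite H. ring. }
  assert (r = r0) as <- by (eapply Can; eauto).
  assert (Cmod r = 1).
  { rewrite Cmult_conj_self in A. apply RtoC_inj in A. pose proof (Cmod_ge_0 r). nra. }
  exists r. split; auto.
  apply (unitary_ext S (fun u => vscal r (T u)) V); hh.
  - now apply unitaryB_scal.
  - apply V_span.
  - intros [x|]; auto. destruct (Req_dec x 0) as [->|Hx]; auto.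
    destruct (Q (Some x)) as [rx Ex]. rewrite Ex. f_equal.
    assert (Nx : Some x <> Some 0) by congruence.
    pose proof (Q2 _ _ _ _ Nx Ex Er0) as A3. eapply Can; eauto.
Qed.


(** * Orbital continuity *)

Lemma kap_mul_pos l x : 0 < l -> kap k t (l * x) = Cmult (RtoC (pw t l)) (kap k t x).
Proof.
  intro Hl. unfold kap. rewrite pw_mult, RtoC_mult, <- Cmult_assoc. do 2 f_equal.
  destruct (Rtotal_order x 0) as [H1|[->|H1]].
  - rewrite !phase_neg by nra. reflexivity.
  - rewrite Rmult_0_r. reflexivity.
  - rewrite !phase_pos by nra. reflexivity.
Qed.

Lemma pw_near_1 eps : 0 < eps -> exists d, 0 < d <= 1 /\
  forall l, Rabs (l - 1) < d -> 0 < l /\ Rabs (pw t l - 1) < eps.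
Proof.
  intro He.
  assert (Hc : continuity_pt (fun x => Rpower x t) 1).
  { apply derivable_continuous_pt. exists (t * Rpower 1 (t - 1)).
    apply derivable_pt_lim_power. lra. }
  destruct (Hc eps He) as (a & Ha & H). exists (Rmin a 1). split.
  { split; [apply Rmin_glb_lt; lra | apply Rmin_r]. }
  intros l Hl. pose proof (Rmin_l a 1). pose proof (Rmin_r a 1).
  assert (Hl0 : 0 < l) by (apply Rabs_lt_between in Hl; lra). split; auto.
  destruct (Req_dec l 1) as [->|N].
  - rewrite pw_1, Rminus_diag, Rabs_R0. exact He.
  - rewrite <- (pw_1 t), !pw_nz, (Rabs_pos_eq l), Rabs_R1 by lra.
    apply (H l). split; [split; [exact I|auto]|]. simpl. unfold Rdist. lra.
Qed.

Lemma kap_cont x eps : 0 < eps -> exists d, 0 < d /\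
  forall y, Rabs (y - x) < d -> Cmod (Cminus (kap k t y) (kap k t x)) < eps.
Proof.
  intro He. pose proof k_mod as Hm. destruct (Req_dec x 0) as [->|Hx].
  - destruct (pw_small t (eps / Cmod k) Ht) as (d & Hd & H); [now apply Rdiv_lt_0_compat|].
    exists d. split; auto. intros y Hy. rewrite Rminus_0_r in Hy. specialize (H y Hy).
    rewrite kap_0. replace (Cminus (kap k t y) 0) with (kap k t y) by ring. rewrite kap_mod.
    apply Rmult_lt_compat_r with (r := Cmod k) in H; auto.
    replace (eps / Cmod k * Cmod k) with eps in H by (field; lra). exact H.
  - assert (HK : 0 < Cmod (kap k t x)) by now apply Cmod_gt_0, kap_nz.
    destruct (pw_near_1 (eps / Cmod (kap k t x))) as (d & Hd & H); [now apply Rdiv_lt_0_compat|].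
    pose proof (Rabs_pos_lt x Hx) as Hax.
    exists (d * Rabs x). split; [nra|]. intros y Hy.
    destruct (H (y / x)) as [L1 L2].
    { replace (y / x - 1) with ((y - x) * / x) by (field; auto). rewrite Rabs_mult, Rabs_inv.
      apply Rmult_lt_reg_r with (Rabs x); auto. rewrite Rmult_assoc, Rinv_l, Rmult_1_r; lra. }
    replace (kap k t y) with (kap k t (y / x * x)) by (f_equal; field; auto).
    rewrite kap_mul_pos by auto.
    replace (Cminus (Cmult (pw t (y / x)) (kap k t x)) (kap k t x))
      with (Cmult (RtoC (pw t (y / x) - 1)) (kap k t x)) by (rewrite RtoC_minus; ring).
    rewrite Cmod_mult, Cmod_R. apply Rmult_lt_compat_r with (r := Cmod (kap k t x)) in L2; auto.
    replace (eps / Cmod (kap k t x) * Cmod (kap k t x)) with eps in L2 by (field; lra). exact L2.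
Qed.

Lemma nsq_shift2 u : nsq (shift2 u) = nsq u.
Proof.
  apply RtoC_inj. rewrite <- !ip_self. unfold shift2. now rewrite !ip_shift1.
Qed.

Lemma nsq_ch_diff x y : nsq (vdiff (ch y) (ch x)) = 2 * (pw t (y - x) * fst k).
Proof.
  rewrite <- kap_fst. apply RtoC_inj. rewrite <- ip_self.
  unfold vdiff. rewrite ip_add_l, ip_scal_l by hh.
  rewrite (ip_conj _ (ch y)), (ip_conj _ (ch x)), !ip_add_l, !ip_scal_l by hh.
  rewrite !Gch, !Rminus_diag, !kap_0. replace (x - y) with (- (y - x)) by ring. rewrite kap_opp.
  generalize (kap k t x) (kap k t y) (kap k t (y - x)). intros [a b] [c d] [p q]. creq.
Qed.

(** The e1-component varies with K, and the E-component satisfies |c(y) - c(x)|^2 = 2 |y - x|^t Re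
    k. *)
Lemma V_cont x eps : 0 < eps -> exists d, 0 < d /\
  forall y, Rabs (y - x) < d -> nsq (vdiff (V (Some y)) (V (Some x))) < eps.
Proof.
  intro He. pose proof (nsq_ge_0 e1 inH_e1) as N1.
  set (M := nsq e1 + 1). assert (HM : 0 < M) by (unfold M; lra).
  set (a := eps / (8 * M)). assert (Ha : 0 < a) by (apply Rdiv_lt_0_compat; lra).
  destruct (kap_cont x (sqrt a) (sqrt_lt_R0 _ Ha)) as (d1 & Hd1 & H1).
  destruct (pw_small t (eps / (8 * fst k)) Ht) as (d2 & Hd2 & H2); [apply Rdiv_lt_0_compat; lra|].
  exists (Rmin d1 d2). split; [now apply Rmin_glb_lt|]. intros y Hy.
  pose proof (Rmin_l d1 d2). pose proof (Rmin_r d1 d2).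
  specialize (H1 y ltac:(lra)). specialize (H2 (y - x) ltac:(lra)).
  replace (vdiff (V (Some y)) (V (Some x))) with
    (vadd (vscal (Cminus (kap k t y) (kap k t x)) e1) (shift2 (vdiff (ch y) (ch x)))).
  - eapply Rle_lt_trans; [apply nsq_add; hh|]. rewrite nsq_scal, nsq_shift2, nsq_ch_diff.
    assert (Cmod (Cminus (kap k t y) (kap k t x)) ^ 2 <= a).
    { rewrite <- (pow2_sqrt a) by lra. apply pow_incr. split; [apply Cmod_ge_0|lra]. }
    assert (Cmod (Cminus (kap k t y) (kap k t x)) ^ 2 * nsq e1 <= a * M).
    { apply Rmult_le_compat; auto; [apply pow2_ge_0 | unfold M; lra]. }
    assert (a * M = eps / 8) by (unfold a; field; lra).
    apply Rmult_lt_compat_r with (r := 8 * fst k) in H2; [|lra].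
    replace (eps / (8 * fst k) * (8 * fst k)) with eps in H2 by (field; lra). lra.
  - simpl. apply functional_extensionality. intros [|[|n]]; unfold vdiff, vadd, vscal, shift2, shift1; creq.
Qed.

Section StrongContinuity.
Context (P : R -> (vec -> vec) -> Prop).
Context (P_uni : forall d T, P d T -> unitaryB T)
  (P_mono : forall d d' T, d <= d' -> P d T -> P d' T)
  (P_V : forall i eps, 0 < eps -> exists d, 0 < d /\ forall T, P d T -> nsq (vdiff (T (V i)) (V i)) < eps).

(** [P d] plays the part of the d-neighbourhood of the identity. It is a predicate on operators
    rather than on group elements, so the scalar ambiguity of lifts does not enter. *)
Let good (u : vec) : Prop :=
  forall eps, 0 < eps -> exists d, 0 < d /\ forall T, P d T -> nsq (vdiff (T u) u) < eps.

Lemma good_lin a u v : inH u -> inH v -> good u -> good v -> good (vadd (vscal a u) v).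
Proof.
  intros Hu Hv Gu Gv eps He. pose proof (pow2_ge_0 (Cmod a)) as Ha.
  set (M := Cmod a ^ 2 + 1). set (e := eps / (4 * M)).
  assert (Hee : 0 < e) by (apply Rdiv_lt_0_compat; unfold M; lra).
  destruct (Gu e Hee) as (d1 & Hd1 & H1), (Gv e Hee) as (d2 & Hd2 & H2).
  exists (Rmin d1 d2). split; [now apply Rmin_glb_lt|]. intros T HT.
  pose proof (P_uni _ _ HT) as UT.
  specialize (H1 T (P_mono _ _ T (Rmin_l _ _) HT)). specialize (H2 T (P_mono _ _ T (Rmin_r _ _) HT)).
  rewrite (uni_lin T) by hh.
  replace (vdiff (vadd (vscal a (T u)) (T v)) (vadd (vscal a u) v)) with
    (vadd (vscal a (vdiff (T u) u)) (vdiff (T v) v)) by (unfold vdiff; vext; creq).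
  eapply Rle_lt_trans; [apply nsq_add; hh|]. rewrite nsq_scal.
  assert (Cmod a ^ 2 * nsq (vdiff (T u) u) <= Cmod a ^ 2 * e) by (apply Rmult_le_compat_l; lra).
  assert (M * e = eps / 4) by (unfold e; field; unfold M; lra). unfold M in *. lra.
Qed.

Lemma good_vzero : good vzero.
Proof.
  intros eps He. exists 1. split; [lra|]. intros T HT. rewrite (uni_vzero T (P_uni _ _ HT)).
  replace (vdiff vzero vzero) with (vscal (RtoC 0) vzero) by (unfold vdiff; vext; creq).
  rewrite nsq_scal, Cmod_0. lra.
Qed.

Lemma good_lincomb {I : Type} (v : I -> vec) l :
  (forall i, inH (v i)) -> (forall i, good (v i)) -> good (lincomb v l).
Proof.
  intros Hv Gv. induction l as [|p l IH]; [apply good_vzero|].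
  rewrite lincomb_cons. apply good_lin; hh.
Qed.

Lemma good_delta m : good (delta m).
Proof. destruct (V_span m) as [l ->]. apply good_lincomb; hh. Qed.

Lemma nsq_delta m : nsq (delta m) = 1.
Proof. apply RtoC_inj. rewrite <- ip_self, ip_delta, delta_eq. reflexivity. Qed.

(** Continuity at [delta 0] alone gives nsq(T delta_0) <= 4, and the explicit operator bound turns
    this into 8 * 4 + 1 = 33. *)
Lemma uniform_bound : exists d, 0 < d /\ forall T w, P d T -> inH w -> nsq (T w) <= 33 * nsq w.
Proof.
  destruct (good_delta 0 1 Rlt_0_1) as (d & Hd & H). exists d. split; auto. intros T w HT Hw.
  pose proof (P_uni _ _ HT) as UT. specialize (H T HT).
  assert (nsq (T (delta 0)) <= 4).
  { replace (T (delta 0)) with (vadd (vdiff (T (delta 0)) (delta 0)) (delta 0)) by (unfold vdiff; vext; creq).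
    eapply Rle_trans; [apply nsq_add; hh|]. rewrite nsq_delta. lra. }
  eapply Rle_trans; [apply (uni_bound T w UT Hw)|]. pose proof (nsq_ge_0 w Hw). nra.
Qed.

Lemma strong_continuity u : inH u -> good u.
Proof.
  intros Hu eps He. destruct uniform_bound as (d0 & Hd0 & Hb).
  (* Continuity on the truncation, a finite combination, plus the uniform bound on the rest: the
     total is 66/200 + 4/8 + 4/200 of [eps], below [eps]. *)
  destruct (trunc_approx u (eps / 200) Hu ltac:(lra)) as [N HN].
  assert (Gt : good (trunc N u)).
  { rewrite <- lincomb_coords. apply good_lincomb; [hh | apply good_delta]. }
  destruct (Gt (eps / 8) ltac:(lra)) as (d1 & Hd1 & H1).
  exists (Rmin d0 d1). split; [now apply Rmin_glb_lt|]. intros T HT.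
  pose proof (P_uni _ _ HT) as UT.
  specialize (H1 T (P_mono _ _ T (Rmin_r _ _) HT)).
  pose proof (Hb T (vdiff u (trunc N u)) (P_mono _ _ T (Rmin_l _ _) HT) ltac:(hh)) as H2.
  replace (vdiff (T u) u) with (vadd (T (vdiff u (trunc N u)))
    (vadd (vdiff (T (trunc N u)) (trunc N u)) (vscal (RtoC (-1)) (vdiff u (trunc N u))))).
  - eapply Rle_lt_trans; [apply nsq_add; hh|].
    pose proof (nsq_add (vdiff (T (trunc N u)) (trunc N u)) (vscal (RtoC (-1)) (vdiff u (trunc N u))) ltac:(hh) ltac:(hh)) as H3.
    rewrite nsq_scal, Cmod_R, <- Rsqr_pow2, <- Rsqr_abs in H3. unfold Rsqr in H3. lra.
  - rewrite (uni_vdiff T) by hh. unfold vdiff. vext. creq.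
Qed.

End StrongContinuity.

Definition near_trans (d : R) (T : vec -> vec) : Prop :=
  unitaryB T /\ exists b, Rabs b < d /\ forall i, T (V i) = V (trans_pt b i).
Definition near_dil (d : R) (T : vec -> vec) : Prop :=
  unitaryB T /\ exists l, Rabs (l - 1) < d /\ forall i, T (V i) = vscal (dil_fac l i) (V (dil_pt l i)).

Lemma near_trans_uni d T : near_trans d T -> unitaryB T.
Proof. intro H. apply H. Qed.
Lemma near_dil_uni d T : near_dil d T -> unitaryB T.
Proof. intro H. apply H. Qed.
Lemma near_trans_mono d d' T : d <= d' -> near_trans d T -> near_trans d' T.
Proof. intros Hd (H & b & Hb & E). split; auto. exists b. split; auto. lra. Qed.
Lemma near_dil_mono d d' T : d <= d' -> near_dil d T -> near_dil d' T.
Proof. intros Hd (H & b & Hb & E). split; auto. exists b. split; auto. lra. Qed.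

Lemma near_trans_V i eps : 0 < eps ->
  exists d, 0 < d /\ forall T, near_trans d T -> nsq (vdiff (T (V i)) (V i)) < eps.
Proof.
  intro He. destruct i as [x|].
  - destruct (V_cont x eps He) as (d & Hd & H). exists d. split; auto.
    intros T (_ & b & Hb & E). rewrite E. apply H. replace (x + b - x) with b by ring. auto.
  - exists 1. split; [lra|]. intros T (_ & b & Hb & E). rewrite E. simpl.
    replace (vdiff e1 e1) with (vscal (RtoC 0) e1) by (unfold vdiff; vext; creq).
    rewrite nsq_scal, Cmod_0. lra.
Qed.

Lemma near_dil_V i eps : 0 < eps ->
  exists d, 0 < d /\ forall T, near_dil d T -> nsq (vdiff (T (V i)) (V i)) < eps.
Proof.
  intro He. pose proof (nsq_ge_0 (V i) (inH_V i)) as Ni. set (M := nsq (V i) + 1).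
  assert (HM : 0 < M) by (unfold M; lra).
  (* The bound 1/2 keeps l^t above 1/2, so its inverse is at most 2; the square root makes a^2 M at
     most eps / 32. *)
  set (a := Rmin (/ 2) (sqrt (eps / (32 * M)))).
  assert (Q : 0 < eps / (32 * M)) by (apply Rdiv_lt_0_compat; lra).
  assert (Ha : 0 < a) by (apply Rmin_glb_lt; [lra | now apply sqrt_lt_R0]).
  assert (Ha2 : a <= / 2) by apply Rmin_l.
  assert (Ha3 : a ^ 2 * M <= eps / 32).
  { assert (a ^ 2 <= eps / (32 * M)).
    { rewrite <- (pow2_sqrt (eps / (32 * M))) by lra. apply pow_incr. split; [lra|apply Rmin_r]. }
    apply Rmult_le_compat_r with (r := M) in H; [|lra].
    replace (eps / (32 * M) * M) with (eps / 32) in H by (field; lra). exact H. }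
  destruct (pw_near_1 a Ha) as (d1 & Hd1 & H1).
  destruct i as [x|].
  - destruct (V_cont x (eps / 32) ltac:(lra)) as (d2 & Hd2 & H2).
    exists (Rmin d1 (d2 / (4 * (Rabs x + 1)))). pose proof (Rabs_pos x) as Hx.
    assert (Hq : 0 < d2 / (4 * (Rabs x + 1))) by (apply Rdiv_lt_0_compat; lra).
    split; [apply Rmin_glb_lt; lra|]. intros T (_ & l & Hl & E). rewrite E. simpl dil_fac. simpl dil_pt.
    pose proof (Rmin_l d1 (d2 / (4 * (Rabs x + 1)))). pose proof (Rmin_r d1 (d2 / (4 * (Rabs x + 1)))).
    destruct (H1 l ltac:(lra)) as [Hl0 Hp]. apply Rabs_lt_between in Hp.
    assert (Hl1 : Rabs (l - 1) < 1) by lra.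
    assert (Hy : Rabs (l * l * x - x) < d2).
    { replace (l * l * x - x) with ((l - 1) * ((l + 1) * x)) by ring. rewrite !Rabs_mult.
      apply Rabs_lt_between in Hl1. rewrite (Rabs_pos_eq (l + 1)) by lra.
      apply Rle_lt_trans with (d2 / (4 * (Rabs x + 1)) * (3 * (Rabs x + 1))).
      - apply Rmult_le_compat; try lra; [apply Rabs_pos | nra | nra].
      - replace (d2 / (4 * (Rabs x + 1)) * (3 * (Rabs x + 1))) with (d2 * (3 / 4)) by (field; lra). lra. }
    specialize (H2 _ Hy). pose proof (pw_pos t l ltac:(lra)) as Hpp.
    set (p := pw t l) in *.
    replace (vdiff (vscal (RtoC (/ p)) (V (Some (l * l * x)))) (V (Some x))) with
      (vadd (vscal (RtoC (/ p)) (vdiff (V (Some (l * l * x))) (V (Some x))))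
            (vscal (RtoC (/ p - 1)) (V (Some x)))).
    + eapply Rle_lt_trans; [apply nsq_add; hh|]. rewrite !nsq_scal, !Cmod_R, <- !Rsqr_pow2, <- !Rsqr_abs.
      assert (Hip : 0 < / p <= 2).
      { split; [now apply Rinv_0_lt_compat|]. apply Rmult_le_reg_r with p; auto. rewrite Rinv_l; lra. }
      assert (Rsqr (/ p) <= 4) by (unfold Rsqr; nra).
      assert (Rsqr (/ p - 1) <= 4 * a ^ 2).
      { replace (/ p - 1) with (/ p * (1 - p)) by (field; lra). rewrite Rsqr_mult.
        apply Rmult_le_compat; auto; try apply Rle_0_sqr. unfold Rsqr. nra. }
      assert (0 <= nsq (vdiff (V (Some (l * l * x))) (V (Some x)))) by (apply nsq_ge_0; hh).
      assert (Rsqr (/ p) * nsq (vdiff (V (Some (l * l * x))) (V (Some x))) <= 4 * (eps / 32)).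
      { apply Rmult_le_compat; auto; [apply Rle_0_sqr | lra]. }
      assert (Rsqr (/ p - 1) * nsq (V (Some x)) <= 4 * a ^ 2 * M).
      { apply Rmult_le_compat; auto; [apply Rle_0_sqr | unfold M; lra]. }
      lra.
    + unfold vdiff. generalize (V (Some x)) (V (Some (l * l * x))). intros u w. vext. creq.
  - exists d1. split; [lra|]. intros T (_ & l & Hl & E). rewrite E. simpl dil_fac. simpl dil_pt.
    destruct (H1 l Hl) as [Hl0 Hp]. apply Rabs_lt_between in Hp.
    replace (vdiff (vscal (RtoC (pw t l)) (V None)) (V None)) with (vscal (RtoC (pw t l - 1)) (V None))
      by (unfold vdiff; vext; creq).
    rewrite nsq_scal, Cmod_R, <- Rsqr_pow2, <- Rsqr_abs.
    assert (Rsqr (pw t l - 1) <= a ^ 2) by (unfold Rsqr; nra).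
    assert (Rsqr (pw t l - 1) * nsq (V None) <= a ^ 2 * M).
    { apply Rmult_le_compat; auto; [apply Rle_0_sqr | unfold M; lra]. }
    lra.
Qed.

Lemma near_weyl (Tw : vec -> vec) v eps : unitaryB Tw -> inH v -> 0 < eps ->
  exists d, 0 < d /\ forall T1 T2 T4, near_trans d T1 -> near_dil d T2 -> near_trans d T4 ->
    nsq (vdiff (T1 (T2 (Tw (T4 v)))) (Tw v)) < eps.
Proof.
  intros HTw Hv He. set (M := 8 * nsq (Tw (delta 0)) + 1).
  assert (HM : 0 < M).
  { pose proof (nsq_ge_0 _ (uni_inH Tw _ HTw (inH_delta 0))). unfold M. lra. }
  (* The difference telescopes into three terms. With 33 as bound for T1 and for T2 and M for Tw,
     they contribute 2 * 33 * 33 * M = 2178 M, 4 * 33 = 132 and 4; the last unit is slack. *)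
  set (e := eps / (2178 * M + 137)). assert (Hee : 0 < e) by (apply Rdiv_lt_0_compat; lra).
  assert (Ee : (2178 * M + 137) * e = eps) by (unfold e; field; lra).
  assert (Hy : inH (Tw v)) by hh.
  pose proof near_trans_uni as A1. pose proof near_trans_mono as A2. pose proof near_trans_V as A3.
  pose proof near_dil_uni as B1. pose proof near_dil_mono as B2. pose proof near_dil_V as B3.
  destruct (strong_continuity near_trans A1 A2 A3 v Hv e Hee) as (d1 & Hd1 & H1).
  destruct (strong_continuity near_trans A1 A2 A3 (Tw v) Hy e Hee) as (d2 & Hd2 & H2).
  destruct (strong_continuity near_dil B1 B2 B3 (Tw v) Hy e Hee) as (d3 & Hd3 & H3).
  destruct (uniform_bound near_trans A1 A2 A3) as (d4 & Hd4 & H4).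
  destruct (uniform_bound near_dil B1 B2 B3) as (d5 & Hd5 & H5).
  assert (Dm : exists d, 0 < d /\ d <= d1 /\ d <= d2 /\ d <= d3 /\ d <= d4 /\ d <= d5).
  { exists (Rmin d1 (Rmin d2 (Rmin d3 (Rmin d4 d5)))). split; [repeat apply Rmin_glb_lt; auto|].
    repeat split; repeat (apply Rmin_l || (eapply Rle_trans; [apply Rmin_r|]) || apply Rle_refl). }
  destruct Dm as (d & Hd & L1 & L2 & L3 & L4 & L5). exists d. split; auto.
  intros T1 T2 T4 N1 N2 N4.
  pose proof (A1 _ _ N1) as U1. pose proof (B1 _ _ N2) as U2. pose proof (A1 _ _ N4) as U4.
  specialize (H1 T4 (A2 _ _ _ L1 N4)). specialize (H2 T1 (A2 _ _ _ L2 N1)).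
  specialize (H3 T2 (B2 _ _ _ L3 N2)).
  pose proof (fun w => H4 T1 w (A2 _ _ _ L4 N1)) as H4'. pose proof (fun w => H5 T2 w (B2 _ _ _ L5 N2)) as H5'.
  replace (vdiff (T1 (T2 (Tw (T4 v)))) (Tw v)) with
    (vadd (T1 (T2 (Tw (vdiff (T4 v) v)))) (vadd (T1 (vdiff (T2 (Tw v)) (Tw v))) (vdiff (T1 (Tw v)) (Tw v)))).
  - assert (Q : nsq (Tw (vdiff (T4 v) v)) <= M * e).
    { eapply Rle_trans; [apply (uni_bound Tw); hh|]. fold M. apply Rmult_le_compat_l; lra. }
    pose proof (H4' (T2 (Tw (vdiff (T4 v) v))) ltac:(hh)) as Q1.
    pose proof (H5' (Tw (vdiff (T4 v) v)) ltac:(hh)) as Q2.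
    pose proof (H4' (vdiff (T2 (Tw v)) (Tw v)) ltac:(hh)) as Q3.
    eapply Rle_lt_trans; [apply nsq_add; hh|].
    pose proof (nsq_add (T1 (vdiff (T2 (Tw v)) (Tw v))) (vdiff (T1 (Tw v)) (Tw v)) ltac:(hh) ltac:(hh)).
    lra.
  - rewrite (uni_vdiff Tw), (uni_vdiff T2), !(uni_vdiff T1) by hh. unfold vdiff. vext. creq.
Qed.

(** With E = exp eps - 1, the choice of [d] makes r at most 1 + E/4 and sqrt(r^2 - 1) at most E/2,
    so their sum stays below exp eps. For r < 1 the square root is 0. *)
Lemma acosh_near_1 eps : 0 < eps -> exists d, 0 < d <= 1 /\ forall r, Rabs (r - 1) < d -> acosh r < eps.
Proof.
  intro He. set (E := exp eps - 1). assert (HE : 0 < E).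
  { unfold E. rewrite <- exp_0. pose proof (exp_increasing 0 eps He). rewrite exp_0 in *. lra. }
  set (d := Rmin 1 (Rmin (E / 4) ((E / 4) ^ 2))). exists d.
  assert (D1 : d <= 1) by apply Rmin_l.
  assert (D2 : d <= E / 4) by (eapply Rle_trans; [apply Rmin_r|apply Rmin_l]).
  assert (D3 : d <= (E / 4) ^ 2) by (eapply Rle_trans; [apply Rmin_r|apply Rmin_r]).
  assert (D0 : 0 < d) by (repeat apply Rmin_glb_lt; try lra; apply pow_lt; lra).
  split; auto. intros r Hr. apply Rabs_lt_between in Hr.
  assert (S : sqrt (r * r - 1) <= 2 * (E / 4)).
  { rewrite <- (sqrt_pow2 (2 * (E / 4))) by lra. apply sqrt_le_1_alt. nra. }
  unfold acosh. pose proof (sqrt_pos (r * r - 1)).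
  rewrite <- (ln_exp eps). apply ln_increasing; [lra|]. unfold E in *. lra.
Qed.

Section Representation.
Context (rho : SU11 -> vec -> vec) (Hrho : forall g, inSU11 g -> acts (rho g) g).

Lemma rho_uni g : inSU11 g -> unitaryB (rho g).
Proof. intro H. apply (Hrho g H). Qed.
Hint Resolve rho_uni inSU11_W inSU11_one inSU11_mone inSU11_mul : inH.

Lemma rho_mul g h : inSU11 g -> inSU11 h -> exists c, Cmod c = 1 /\
  forall u, inH u -> rho (su_mul g h) u = vscal c (rho g (rho h u)).
Proof.
  intros Hg Hh. apply acts_unique with (T := fun u => rho g (rho h u)) (g := su_mul g h).
  - apply Hrho. hh.
  - apply acts_comp; auto.
Qed.

Lemma rho_mone : exists c, Cmod c = 1 /\ forall u, inH u -> rho su_mone u = vscal c u.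
Proof.
  apply (acts_unique (rho su_mone) (fun u => u) su_mone); [apply Hrho; hh | apply acts_mone].
Qed.

Lemma Cmod_B_unit c c' u w : Cmod c = 1 -> Cmod c' = 1 -> inH u -> inH w ->
  Cmod (B (vscal c u) (vscal c' w)) = Cmod (B u w).
Proof.
  intros Hc Hc' Hu Hw. Bexp. rewrite !Cmod_mult, Cmod_conj, Hc, Hc'. ring.
Qed.

(* The element [su_mul suW g0^-1] moves [g0] to the Weyl element, near which the big cell
   gives [g = n a w n'] with [n], [a], [n'] close to the identity. *)
Lemma rho_cont v : posv v -> forall g0, inSU11 g0 -> forall eps, 0 < eps ->
  exists d, 0 < d /\ forall g, inSU11 g ->
    Cmod (Cminus (fst g) (fst g0)) < d -> Cmod (Cminus (snd g) (snd g0)) < d ->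
    hdist (rho g v) (rho g0 v) < eps.
Proof.
  intros [Hv Hpos] g0 Hg0 eps He.
  set (be := fst (B v v)) in *.
  destruct (acosh_near_1 eps He) as (r & Hr & HA).
  destruct weyl_ex as (Tw & Uw & Ew).
  pose proof (acts_weyl Tw Uw Ew) as Aw.
  assert (NT := nsq_ge_0 _ (uni_inH Tw v Uw Hv)).
  (* The 8 dominates the factor 4 of [B_bound], and the added 1 keeps the denominator positive. *)
  set (m := (be * r) ^ 2 / (8 * (nsq (Tw v) + 1))).
  assert (Hm : 0 < m) by (apply Rdiv_lt_0_compat; [apply pow_lt; nra | lra]).
  destruct (near_weyl Tw v m Uw Hv Hm) as (d & Hd & HN).
  set (kk := of_mat (mC g0) (- mA g0) (mD g0) (- mB g0)).
  destruct (mat_of_mat (mC g0) (- mA g0) (mD g0) (- mB g0)) as (K1 & K2 & K3 & K4). fold kk in K1, K2, K3, K4.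
  assert (Dg0 := proj1 (inSU11_det g0) Hg0).
  assert (Hkk : inSU11 kk) by (apply inSU11_det; rewrite K1, K2, K3, K4; lra).
  assert (Ek0 : su_mul kk g0 = suW).
  { destruct (mat_of_mat 0 (-1) 1 0) as (W1 & W2 & W3 & W4). unfold suW.
    apply SU11_eq; rewrite ?mA_mul, ?mB_mul, ?mC_mul, ?mD_mul, ?K1, ?K2, ?K3, ?K4, ?W1, ?W2, ?W3, ?W4; lra. }
  (* [S] dominates the entries of [kk], so perturbing each entry of g0 by at most 2q moves the
     entries of [su_mul kk g] by at most 2 S q. *)
  set (S := 1 + Rabs (mA g0) + Rabs (mB g0) + Rabs (mC g0) + Rabs (mD g0)).
  pose proof (Rabs_pos (mA g0)). pose proof (Rabs_pos (mB g0)).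
  pose proof (Rabs_pos (mC g0)). pose proof (Rabs_pos (mD g0)).
  assert (HS : 1 <= S) by (unfold S; lra).
  (* The first bound keeps the lower left entry of [h] above 1/2; dividing by it at most doubles,
     and the second bound keeps all three parameters below [d]. *)
  set (d' := Rmin (/ 2) (d / 4)). assert (Hd' : 0 < d') by (apply Rmin_glb_lt; lra).
  assert (Hd'1 : d' <= / 2) by apply Rmin_l. assert (Hd'2 : d' <= d / 4) by apply Rmin_r.
  exists (d' / (4 * S)). split; [apply Rdiv_lt_0_compat; lra|].
  intros g Hg C1 C2. set (q := d' / (4 * S)) in *.
  assert (Eq : 4 * S * q = d') by (unfold q; field; lra).
  assert (Hq : 0 < q) by (apply Rdiv_lt_0_compat; lra).
  assert (Q : Rabs (mA g - mA g0) <= 2 * q /\ Rabs (mB g - mB g0) <= 2 * q /\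
              Rabs (mC g - mC g0) <= 2 * q /\ Rabs (mD g - mD g0) <= 2 * q).
  { pose proof (Rmax_Cmod (Cminus (fst g) (fst g0))) as R1. pose proof (Rmax_Cmod (Cminus (snd g) (snd g0))) as R2.
    pose proof (Rmax_l (Rabs (fst (Cminus (fst g) (fst g0)))) (Rabs (snd (Cminus (fst g) (fst g0))))).
    pose proof (Rmax_r (Rabs (fst (Cminus (fst g) (fst g0)))) (Rabs (snd (Cminus (fst g) (fst g0))))).
    pose proof (Rmax_l (Rabs (fst (Cminus (snd g) (snd g0)))) (Rabs (snd (Cminus (snd g) (snd g0))))).
    pose proof (Rmax_r (Rabs (fst (Cminus (snd g) (snd g0)))) (Rabs (snd (Cminus (snd g) (snd g0))))).
    set (x1 := fst (Cminus (fst g) (fst g0))) in *. set (x2 := snd (Cminus (fst g) (fst g0))) in *.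
    set (x3 := fst (Cminus (snd g) (snd g0))) in *. set (x4 := snd (Cminus (snd g) (snd g0))) in *.
    assert (X1 : Rabs x1 <= q) by lra. assert (X2 : Rabs x2 <= q) by lra.
    assert (X3 : Rabs x3 <= q) by lra. assert (X4 : Rabs x4 <= q) by lra.
    apply Rabs_le_between in X1, X2, X3, X4. clear - X1 X2 X3 X4.
    repeat split; apply Rabs_le; unfold mA, mB, mC, mD, x1, x2, x3, x4 in *; c2r; lra. }
  destruct Q as (QA & QB & QC & QD).
  set (h := su_mul kk g). assert (Hh : inSU11 h) by (unfold h; hh).
  assert (PA : Rabs (mA h) <= d').
  { unfold h. rewrite mA_mul, K1, K2.
    replace (mC g0 * mA g + - mA g0 * mC g) with (mC g0 * (mA g - mA g0) + - mA g0 * (mC g - mC g0)) by ring.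
    eapply Rle_trans; [apply Rabs_triang|]. rewrite !Rabs_mult, Rabs_Ropp. rewrite <- Eq. unfold S. nra. }
  assert (PC : Rabs (mC h - 1) <= d').
  { unfold h. rewrite mC_mul, K3, K4.
    replace (mD g0 * mA g + - mB g0 * mC g - 1) with (mD g0 * (mA g - mA g0) + - mB g0 * (mC g - mC g0))
      by (rewrite <- Dg0; ring).
    eapply Rle_trans; [apply Rabs_triang|]. rewrite !Rabs_mult, Rabs_Ropp. rewrite <- Eq. unfold S. nra. }
  assert (PD : Rabs (mD h) <= d').
  { unfold h. rewrite mD_mul, K3, K4.
    replace (mD g0 * mB g + - mB g0 * mD g) with (mD g0 * (mB g - mB g0) + - mB g0 * (mD g - mD g0)) by ring.
    eapply Rle_trans; [apply Rabs_triang|]. rewrite !Rabs_mult, Rabs_Ropp. rewrite <- Eq. unfold S. nra. }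
  apply Rabs_le_between in PC.
  assert (Hc : / 2 <= mC h) by lra. assert (Hc0 : mC h <> 0) by lra.
  assert (Hic : 0 < / mC h <= 2).
  { split; [apply Rinv_0_lt_compat; lra|]. apply Rmult_le_reg_r with (mC h); [lra|]. rewrite Rinv_l; lra. }
  assert (Lq : forall x, Rabs x <= d' -> Rabs (x / mC h) < d).
  { intros x Hx. pose proof (Rabs_pos x). unfold Rdiv. rewrite Rabs_mult, (Rabs_pos_eq (/ mC h)) by lra.
    apply Rle_lt_trans with (d' * 2); [apply Rmult_le_compat; lra | lra]. }
  assert (Hi : / mC h <> 0) by now apply Rinv_neq_0_compat.
  destruct (trans_ex (mA h / mC h)) as (T1 & U1 & F1). destruct (dil_ex (/ mC h) Hi) as (T2 & U2 & F2).
  destruct (trans_ex (mD h / mC h)) as (T4 & U4 & F4).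
  assert (N : nsq (vdiff (T1 (T2 (Tw (T4 v)))) (Tw v)) < m).
  { apply HN; split; auto.
    - exists (mA h / mC h). auto.
    - exists (/ mC h). split; auto. replace (/ mC h - 1) with ((1 - mC h) / mC h) by (field; auto).
      apply Lq. apply Rabs_le. lra.
    - exists (mD h / mC h). auto. }
  assert (AX : acts (fun u => T1 (T2 (Tw (T4 u)))) h).
  { assert (O1 : 1 <> 0) by lra. rewrite (big_cell h Hh Hc0).
    assert (G4 : inSU11 (gLB 1 (mD h / mC h))) by now apply inSU11_gLB.
    assert (G3 := inSU11_mul _ _ inSU11_W G4).
    apply (acts_comp T1 (fun u => T2 (Tw (T4 u)))); [|now apply acts_trans|].
    { apply inSU11_mul; auto. now apply inSU11_diag. }
    apply (acts_comp T2 (fun u => Tw (T4 u))); [auto|now apply acts_dil|].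
    apply (acts_comp Tw T4); [auto|auto|now apply acts_trans]. }
  set (Xv := T1 (T2 (Tw (T4 v)))) in *.
  assert (IX : inH Xv) by (unfold Xv; hh). assert (Iw : inH (Tw v)) by hh.
  assert (Ug := rho_uni g Hg). assert (Ug0 := rho_uni g0 Hg0). assert (Uk := rho_uni kk Hkk).
  (* Applying [rho kk] to both vectors changes nothing, and all four scalars relating lifts have
     modulus 1, so |B| can be computed on the explicit operators. *)
  assert (EB : Cmod (B (rho g v) (rho g0 v)) = Cmod (B Xv (Tw v))).
  { destruct (rho_mul kk g Hkk Hg) as (c1 & Hc1 & E1). destruct (rho_mul kk g0 Hkk Hg0) as (c2 & Hc2 & E2).
    destruct (acts_unique _ _ h (Hrho h Hh) AX) as (c3 & Hc3 & E3).
    destruct (acts_unique _ _ suW (Hrho suW inSU11_W) Aw) as (c4 & Hc4 & E4).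
    specialize (E1 v Hv). specialize (E2 v Hv). specialize (E3 v Hv). specialize (E4 v Hv).
    fold h in E1. fold Xv in E3. rewrite Ek0 in E2.
    rewrite <- (uni_B (rho kk)) by hh.
    rewrite <- (Cmod_B_unit c1 c2), <- E1, <- E2, E3, E4 by hh. apply Cmod_B_unit; hh. }
  unfold hdist. rewrite !uni_B by hh. fold be. rewrite sqrt_square by lra. rewrite EB.
  apply HA.
  assert (EW : B (Tw v) (Tw v) = RtoC be) by (rewrite uni_B by hh; apply B_self_fst).
  assert (D1 : Cmod (B (vdiff Xv (Tw v)) (Tw v)) < be * r).
  { apply Rlt_le_trans with (sqrt ((be * r) ^ 2)).
    - apply Rle_lt_trans with (sqrt (4 * (nsq (vdiff Xv (Tw v)) * nsq (Tw v)))).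
      + apply Cmod_le_sqrt, B_bound; hh.
      + apply sqrt_lt_1_alt.
        pose proof (nsq_ge_0 (vdiff Xv (Tw v)) ltac:(hh)) as P0. split; [nra|].
        assert (Em : m * (8 * (nsq (Tw v) + 1)) = (be * r) ^ 2) by (unfold m; field; lra).
        rewrite <- Em. nra.
    - rewrite sqrt_pow2 by nra. lra. }
  assert (D2 : Rabs (Cmod (B Xv (Tw v)) - be) < be * r).
  { rewrite B_vdiff_l, EW in D1 by hh.
    pose proof (Cmod_triangle (Cminus (B Xv (Tw v)) (RtoC be)) (RtoC be)) as Tr1.
    pose proof (Cmod_triangle (Copp (Cminus (B Xv (Tw v)) (RtoC be))) (B Xv (Tw v))) as Tr2.
    rewrite Cmod_opp in Tr2.
    replace (Cplus (Cminus (B Xv (Tw v)) be) be) with (B Xv (Tw v)) in Tr1 by ring.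
    replace (Cplus (Copp (Cminus (B Xv (Tw v)) be)) (B Xv (Tw v))) with (RtoC be) in Tr2 by ring.
    rewrite Cmod_R, (Rabs_pos_eq be) in * by lra. apply Rabs_lt_between. lra. }
  replace (Cmod (B Xv (Tw v)) / be - 1) with ((Cmod (B Xv (Tw v)) - be) * / be) by (field; lra).
  rewrite Rabs_mult, (Rabs_pos_eq (/ be)) by (left; apply Rinv_0_lt_compat; lra).
  apply Rmult_lt_reg_r with be; [lra|]. rewrite Rmult_assoc, Rinv_l by lra. lra.
Qed.

Lemma rho_isRep : isRep rho.
Proof.
  split; [exact rho_uni|]. split; [exact rho_mul|]. split; [exact rho_mone | exact rho_cont].
Qed.

(** * Distinguished points, translation lengths and K(1) of the new representation *)

Lemma rho_gLB_fix lam b : lam <> 0 -> fixes (rho (gLB lam b)) e1.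
Proof.
  intro Hl. destruct (Hrho _ (inSU11_gLB lam b Hl)) as [_ H].
  destruct (H 1 0 ltac:(lra)) as [c E]. exists c.
  destruct (mat_of_mat lam b 0 (/ lam)) as (E1 & E2 & E3 & E4).
  rewrite gLB_of_mat in E at 2. rewrite gLB_of_mat, E1, E2, E3, E4 in E.
  replace (0 * 1 + / lam * 0) with 0 in E by ring. rewrite !pt_inf in E.
  rewrite gLB_of_mat. exact E.
Qed.

Lemma rho_dil lam : 0 < lam -> exists c, Cmod c = 1 /\
  rho (gLB lam 0) e1 = vscal (Cmult c (RtoC (pw t lam))) e1 /\
  rho (gLB lam 0) e2 = vscal (Cmult c (RtoC (/ pw t lam))) e2.
Proof.
  intro Hl. assert (Hl0 : lam <> 0) by lra. destruct (dil_ex lam Hl0) as (T & UT & E).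
  pose proof (acts_dil T lam Hl0 UT E) as A. rewrite <- gLB_of_mat in A.
  destruct (acts_unique _ _ _ (Hrho _ (inSU11_gLB lam 0 Hl0)) A) as (c & Hc & Ec).
  exists c. split; auto. split.
  - change e1 with (V None). rewrite Ec, E, vscal_vscal by hh. reflexivity.
  - rewrite <- V_0, Ec, E, vscal_vscal by hh. simpl dil_pt. rewrite Rmult_0_r. reflexivity.
Qed.

Lemma rho_distinguished : distinguished rho e1 e2.
Proof.
  destruct e_pair as (H1 & H2 & H3). repeat split; auto; try apply H1; try apply H2.
  - intros. apply rho_gLB_fix. lra.
  - intros lam Hl. destruct (rho_dil lam Hl) as (c & _ & _ & E). eexists. exact E.
Qed.

Lemma pw_log lam : 0 < lam -> ln (pw t lam) = t * ln lam.
Proof. intro H. rewrite pw_nz, Rabs_pos_eq by lra. unfold Rpower. apply ln_exp. Qed.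

Lemma rho_ell : ellIs rho t.
Proof.
  split; auto. intros lam Hl. destruct (rho_dil lam Hl) as (c & Hc & E1 & E2).
  rewrite (translen_axis e1 e2 _ _ _ e_pair (rho_uni _ (inSU11_gLB lam 0 ltac:(lra))) E1 E2).
  pose proof (pw_pos t lam ltac:(lra)).
  rewrite Cmod_mult, Hc, Rmult_1_l, Cmod_R, (Rabs_pos_eq (pw t lam)), pw_log by lra.
  rewrite Rabs_mult, (Rabs_pos_eq t) by lra. reflexivity.
Qed.

Lemma rho_trans b : exists c, Cmod c = 1 /\
  forall i, rho (gLB 1 b) (V i) = vscal c (V (trans_pt b i)).
Proof.
  destruct (trans_ex b) as (T & UT & E).
  destruct (acts_unique _ _ _ (Hrho _ (inSU11_gLB 1 b ltac:(lra))) (acts_trans T b UT E)) as (c & Hc & Ec).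
  exists c. split; auto. intro i. rewrite Ec, E by hh. reflexivity.
Qed.

Lemma rho_weyl_inf : exists c, rho suW e1 = vscal c e2.
Proof.
  destruct weyl_ex as (T & UT & E).
  destruct (acts_unique _ _ _ (Hrho _ inSU11_W) (acts_weyl T UT E)) as (c & Hc & Ec).
  eexists. change e1 with (V None). rewrite Ec, E, vscal_vscal by hh. simpl weyl_pt. rewrite V_0. reflexivity.
Qed.

Lemma rho_K1 : K1of rho e1 e2 k.
Proof.
  destruct (rho_trans 1) as (c & Hc & E). destruct (unit_conj_l c Hc) as [H1 H2].
  exists (Cconj c), (shift2 (ch 1)). split; [exact H1|].
  repeat split; hh; try (apply B_shift2_e1; hh); try (apply B_shift2_e2; hh).
  - change e1 with (V None). rewrite E, vscal_vscal, H2. apply vscal_1.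
  - rewrite <- V_0 at 1. rewrite E, vscal_vscal, H2, vscal_1. simpl. rewrite Rplus_0_l, kap_1.
    reflexivity.
Qed.

(** * Non-elementarity and irreducibility *)

Lemma rho_hyperbolic lam z v : 1 < lam -> inH v -> v <> vzero -> 0 <= fst (B v v) ->
  rho (gLB lam 0) v = vscal z v -> propto v e1 \/ propto v e2.
Proof.
  intros Hl Hv Hn Hp E. destruct (rho_dil lam ltac:(lra)) as (c & Hc & E1 & E2).
  apply (axis_eigen e1 e2 e_pair (rho (gLB lam 0)) _ _ (rho_uni _ (inSU11_gLB lam 0 ltac:(lra))) E1 E2 z); auto.
  pose proof (pw_pos t lam ltac:(lra)).
  rewrite Cmod_mult, Hc, Rmult_1_l, Cmod_R, Rabs_pos_eq by lra.
  intro F. pose proof (pw_log lam ltac:(lra)) as L. rewrite F, ln_1 in L.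
  assert (0 < ln lam) by (rewrite <- ln_1; apply ln_increasing; lra). nra.
Qed.

Lemma e2_not_fixed : ~ fixes (rho (gLB 1 1)) e2.
Proof.
  intros [z Ez]. destruct (rho_trans 1) as (c & Hc & E). rewrite <- V_0, E in Ez.
  destruct (unit_conj_l c Hc) as [H1 H2].
  apply (V_not_propto (trans_pt 1 (Some 0)) (Some 0)).
  - simpl. intro F. injection F. intro. lra.
  - exists (Cmult (Cconj c) z). rewrite <- vscal_vscal, <- Ez, vscal_vscal, H2, vscal_1. reflexivity.
Qed.

Lemma e1_not_fixed : ~ fixes (rho suW) e1.
Proof.
  intros [z Ez]. destruct rho_weyl_inf as [c E].
  assert (Nc : c <> RtoC 0).
  { intros ->. rewrite vscal_0 in E. revert E. apply (V_nz_image (rho suW) None). hh. }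
  apply (V_not_propto (Some 0) None); [discriminate|].
  exists (Cmult (Cinv c) z). rewrite V_0. simpl V. rewrite <- vscal_vscal, <- Ez, E, vscal_vscal, Cinv_l, vscal_1; auto.
Qed.

Lemma fixes_propto T v w : unitaryB T -> inH w -> v <> vzero -> propto v w -> fixes T v -> fixes T w.
Proof.
  intros HT Hw Hv [c ->] [z E].
  assert (Nc : c <> RtoC 0) by (intros ->; apply Hv, vscal_0).
  exists z. rewrite (uni_vscal T), vscal_vscal in E by hh.
  apply (f_equal (vscal (Cinv c))) in E. rewrite !vscal_vscal in E.
  replace (Cmult (Cinv c) (Cmult z c)) with z in E by (field; auto).
  rewrite Cinv_l, vscal_1 in E by auto. exact E.
Qed.

(** A vector fixed by all elements is fixed by g(2,0), hence lies on e1 or e2, which [suW] and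
    g(1,1) move. For an invariant pair, squares fix both members; g(4,0) and g(1,1) are squares, so
    the two distinct lines are among e1 and e2, and the one on e2 is moved by g(1,1). *)
Lemma rho_nonElementary : nonElementary rho.
Proof.
  assert (G1 : inSU11 (gLB 1 1)) by (apply inSU11_gLB; lra). split.
  - intros (v & Hv & Hn & Hp & Hfix).
    destruct (Hfix (gLB 2 0) (inSU11_gLB 2 0 ltac:(lra))) as [z Ez].
    destruct (rho_hyperbolic 2 z v ltac:(lra) Hv Hn Hp Ez) as [P|P].
    + apply e1_not_fixed. apply (fixes_propto (rho suW) v); hh.
    + apply e2_not_fixed. apply (fixes_propto (rho (gLB 1 1)) v); hh.
  - intros (v & w & (Hv & Nv & Bv) & (Hw & Nw & Bw) & Hvw & Hpair).
    assert (Sq : forall g, inSU11 g -> fixes (rho (su_mul g g)) v /\ fixes (rho (su_mul g g)) w).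
    { intros g Hg. destruct (rho_mul g g Hg Hg) as (c & _ & Ec).
      destruct (Hpair g Hg) as [[[a Ea] [b Eb]]|[[a Ea] [b Eb]]].
      - split.
        + exists (Cmult c (Cmult a a)). rewrite Ec, Ea, (uni_vscal (rho g)), Ea, !vscal_vscal by hh. f_equal; ring.
        + exists (Cmult c (Cmult b b)). rewrite Ec, Eb, (uni_vscal (rho g)), Eb, !vscal_vscal by hh. f_equal; ring.
      - split.
        + exists (Cmult c (Cmult a b)). rewrite Ec, Ea, (uni_vscal (rho g)), Eb, !vscal_vscal by hh. f_equal; ring.
        + exists (Cmult c (Cmult b a)). rewrite Ec, Eb, (uni_vscal (rho g)), Ea, !vscal_vscal by hh. f_equal; ring. }
    assert (A : su_mul (gLB 2 0) (gLB 2 0) = gLB 4 0) by (apply SU11_eq; mats; field).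
    assert (T : su_mul (gLB 1 (/ 2)) (gLB 1 (/ 2)) = gLB 1 1) by (apply SU11_eq; mats; field).
    destruct (Sq _ (inSU11_gLB 2 0 ltac:(lra))) as [[a Ea] [b Eb]]. rewrite A in Ea, Eb.
    destruct (Sq _ (inSU11_gLB 1 (/ 2) ltac:(lra))) as [Fv Fw]. rewrite T in Fv, Fw.
    assert (Pv := rho_hyperbolic 4 a v ltac:(lra) Hv Nv ltac:(rewrite Bv; simpl; lra) Ea).
    assert (Pw := rho_hyperbolic 4 b w ltac:(lra) Hw Nw ltac:(rewrite Bw; simpl; lra) Eb).
    destruct Pv as [Pv|Pv]; [destruct Pw as [Pw|Pw]|].
    + apply Hvw. destruct Pv as [x ->], Pw as [y ->].
      assert (Nx : x <> RtoC 0) by (intros ->; apply Nv, vscal_0).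
      exists (Cmult y (Cinv x)). rewrite vscal_vscal. f_equal. field. auto.
    + apply e2_not_fixed. apply (fixes_propto (rho (gLB 1 1)) w); hh.
    + apply e2_not_fixed. apply (fixes_propto (rho (gLB 1 1)) v); hh.
Qed.

Lemma sqrt_nsq_lim (s : nat -> vec) (u : vec) :
  is_lim_seq (fun n => nsq (vdiff (s n) u)) 0 -> is_lim_seq (fun n => hnorm (vsub (s n) u)) 0.
Proof.
  intro H. apply is_lim_seq_ext with (fun n => sqrt (nsq (vdiff (s n) u))).
  - intro n. now rewrite hnorm_nsq, vsub_vdiff.
  - rewrite <- sqrt_0. apply is_lim_seq_continuous; auto. apply continuity_pt_sqrt. lra.
Qed.

Lemma closed_total W : closedSubspace W -> (forall m, W (delta m)) -> forall u, inH u -> W u.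
Proof.
  intros (W1 & W2 & W3 & W4) Hd u Hu. apply (W4 (fun N => trunc N u)); auto.
  - intro N. rewrite <- lincomb_coords. induction (coords N u) as [|p l IH]; auto.
    rewrite lincomb_cons. auto.
  - apply sqrt_nsq_lim. apply is_lim_seq_ext with (fun N => nsq (vdiff u (trunc N u))).
    + intro N. replace (vdiff (trunc N u) u) with (vscal (RtoC (-1)) (vdiff u (trunc N u))).
      * rewrite nsq_scal, Cmod_R, <- Rsqr_pow2, <- Rsqr_abs. unfold Rsqr. ring.
      * unfold vdiff. vext. creq.
    + now apply nsq_trunc_lim.
Qed.

Lemma nsq_ortho e : ortho e1 e2 e -> nsq e = - fst (B e e).
Proof.
  intros (H & H1 & H2). rewrite nsq_B by auto.
  replace (e 0%nat) with (RtoC 0).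
  - rewrite Cmod_0. ring.
  - transitivity (B e (delta 0)); [|rewrite B_delta; simpl; ring].
    rewrite delta0_e. Bexp. rewrite H1, H2. ring.
Qed.

(* [pw t lam ^-1 * A_lam u] tends to the component of [u] along [e1] as [lam] grows. *)
Lemma closed_contains_e1 W u : closedSubspace W ->
  (forall g, inSU11 g -> forall w, W w -> W (rho g w)) ->
  W u -> B u e2 <> RtoC 0 -> W e1.
Proof.
  intros (W1 & W2 & W3 & W4) Winv Hu Np.
  assert (Wscal : forall a w, W w -> W (vscal a w)).
  { intros a w Hw. rewrite <- (vadd_0_r (vscal a w)). auto. }
  assert (Iu : inH u) by auto.
  set (p := B u e2) in *. set (q := B u e1). set (e := perp e1 e2 u).
  assert (Oe : ortho e1 e2 e) by (apply ortho_perp; [apply e_pair|auto]).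
  assert (Ie : inH e) by apply Oe.
  set (M := 2 * (Cmod q ^ 2 * nsq e2) + 2 * nsq e).
  assert (HM : 0 <= M).
  { pose proof (nsq_ge_0 e Ie). pose proof (nsq_ge_0 e2 inH_e2).
    pose proof (pow2_ge_0 (Cmod q)). unfold M. nra. }
  assert (Key : forall n : nat, exists w, W w /\ nsq (vdiff w (vscal p e1)) <= M * / (INR n + 1)).
  { intro n. pose proof (pos_INR n) as Hn. set (x := INR n + 1).
    (* Chosen so that lam^t = n + 1, which gives a convergence rate of 1/(n + 1). *)
    set (lam := Rpower x (/ t)). assert (Hl : 0 < lam) by apply exp_pos.
    assert (Ex : pw t lam = x).
    { rewrite pw_nz, Rabs_pos_eq by lra. unfold lam. rewrite Rpower_mult, Rinv_l, Rpower_1; unfold x; lra. }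
    assert (G : inSU11 (gLB lam 0)) by (apply inSU11_gLB; lra).
    destruct (rho_dil lam Hl) as (c & Hc & E1 & E2). rewrite Ex in E1, E2.
    destruct (unit_conj_l c Hc) as [H1 H2].
    set (A := rho (gLB lam 0)) in *. assert (UA : unitaryB A) by (apply rho_uni, G).
    exists (vscal (Cmult (RtoC (/ x)) (Cconj c)) (A u)). split; [apply Wscal; now apply Winv|].
    assert (OA : ortho e1 e2 (A e)).
    { unfold e. rewrite <- (axis_perp e1 e2 e_pair A _ _ UA E1 E2) by auto. apply ortho_perp; [apply e_pair|hh]. }
    replace (vdiff (vscal (Cmult (RtoC (/ x)) (Cconj c)) (A u)) (vscal p e1)) with
      (vadd (vscal (Cmult (RtoC (/ x * / x)) q) e2) (vscal (Cmult (RtoC (/ x)) (Cconj c)) (A e))).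
    - eapply Rle_trans; [apply nsq_add; hh|].
      rewrite !nsq_scal, !Cmod_sq_mult, Cmod_conj, Hc, !Cmod_R, <- !Rsqr_pow2, <- !Rsqr_abs.
      rewrite (nsq_ortho (A e)), (uni_B A), <- (nsq_ortho e) by hh.
      assert (Hx : 0 < / x <= 1).
      { split; [apply Rinv_0_lt_compat; unfold x; lra|]. apply Rmult_le_reg_r with x; [unfold x; lra|].
        rewrite Rinv_l; unfold x; lra. }
      set (y := / x) in *. unfold Rsqr, M.
      pose proof (nsq_ge_0 e Ie). pose proof (nsq_ge_0 e2 inH_e2). pose proof (pow2_ge_0 (Cmod q)).
      assert (Z : 0 <= Cmod q ^ 2 * nsq e2) by now apply Rmult_le_pos.
      set (z := Cmod q ^ 2) in *. assert (y * y <= y) by nra. assert (y * y * (y * y) <= y) by nra.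
      fold z in Z. assert (y * y * (y * y) * (z * nsq e2) <= y * (z * nsq e2)) by (apply Rmult_le_compat_r; auto).
      assert (y * y * nsq e <= y * nsq e) by (apply Rmult_le_compat_r; auto).
      unfold z in *. lra.
    - rewrite (perp_decomp e1 e2 u). fold p q e.
      rewrite !(uni_vadd A), !(uni_vscal A), E1, E2 by hh.
      unfold vdiff. vext.
      transitivity (Cplus (Cplus (Cmult (Cmult (Cmult (Cconj c) c) (RtoC (/ x * x))) (Cmult p (e1 x0)))
           (Cmult (Cmult (Cmult (Cconj c) c) (RtoC (/ x * / x))) (Cmult q (e2 x0))))
           (Cplus (Cmult (Cmult (RtoC (/ x)) (Cconj c)) (A e x0)) (Cmult (RtoC (-1)) (Cmult p (e1 x0)))));
        [|rewrite !RtoC_mult; ring].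
      rewrite H2, Rinv_l by (unfold x; lra). creq. }
  assert (Ks : exists s : nat -> vec, forall n, W (s n) /\ nsq (vdiff (s n) (vscal p e1)) <= M * / (INR n + 1)).
  { exists (fun n => proj1_sig (constructive_indefinite_description _ (Key n))).
    intro n. apply (proj2_sig (constructive_indefinite_description _ (Key n))). }
  destruct Ks as [s Hs].
  assert (Wp : W (vscal p e1)).
  { apply (W4 s); [intro n; apply Hs | hh |]. apply sqrt_nsq_lim.
    apply (is_lim_seq_le_le (fun _ => 0) _ (fun n => M * / (INR n + 1))).
    - intro n. split; [|apply Hs]. apply nsq_ge_0. assert (inH (s n)) by apply W1, Hs. hh.
    - apply is_lim_seq_const.
    - replace (Finite 0) with (Rbar_mult (Finite M) (Finite 0)) by (simpl; f_equal; ring).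
      apply is_lim_seq_scal_l. replace (Finite 0) with (Rbar_inv p_infty) by reflexivity.
      apply is_lim_seq_inv; [|discriminate].
      apply is_lim_seq_ext with (fun n => INR (S n)); [intro n; apply S_INR|].
      apply is_lim_seq_incr_1 with (u := INR). apply is_lim_seq_INR. }
  replace e1 with (vscal (Cinv p) (vscal p e1)); auto.
  rewrite vscal_vscal, Cinv_l, vscal_1; auto.
Qed.

(** A positive vector cannot be orthogonal to e2, so an invariant hyperbolic subspace contains e1.
    The Weyl element then brings in e2, the translations every boundary vector, and these span all
    coordinate vectors. *)
Lemma rho_irreducible : irreducible rho.
Proof.
  split; [exact rho_nonElementary|].
  intros (W & [Wc (v & Hv & Hpos & _)] & (u & Hu & Nu) & Winv). apply Nu.
  assert (Wc' := Wc). destruct Wc' as (W1 & W2 & W3 & _).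
  assert (Wscal : forall a w, W w -> W (vscal a w)).
  { intros a w Hw. rewrite <- (vadd_0_r (vscal a w)). auto. }
  assert (We1 : W e1).
  { apply closed_contains_e1 with v; auto. intro E.
    rewrite (B_decomp e1 e2 e_pair v v), E in Hpos by auto.
    pose proof (ortho_nonpos e1 e2 e_pair _ (ortho_perp e1 e2 e_pair v (W1 v Hv))).
    c2r. lra. }
  assert (We2 : W e2).
  { destruct rho_weyl_inf as [c E].
    assert (Nc : c <> RtoC 0).
    { intros ->. rewrite vscal_0 in E. revert E. apply (V_nz_image (rho suW) None). hh. }
    replace e2 with (vscal (Cinv c) (rho suW e1)).
    - apply Wscal, Winv; hh.
    - rewrite E, vscal_vscal, Cinv_l, vscal_1; auto. }
  assert (WV : forall i, W (V i)).
  { intros [x|]; auto. destruct (rho_trans x) as (c & Hc & E). destruct (unit_conj_l c Hc) as [H1 H2].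
    replace (V (Some x)) with (vscal (Cconj c) (rho (gLB 1 x) e2)).
    - apply Wscal, Winv; auto. apply inSU11_gLB. lra.
    - rewrite <- V_0, E, vscal_vscal, H2, vscal_1. simpl trans_pt. now rewrite Rplus_0_l. }
  apply closed_total; auto. intro m. destruct (V_span m) as [l ->].
  induction l as [|p l IH]; auto. rewrite lincomb_cons. auto.
Qed.

End Representation.

End Family.

(** * The argument, and the choice of lifts that assembles the representation *)

Lemma isArg_exists z : 0 < fst z -> exists theta, isArg z theta.
Proof.
  intro H. set (x := snd z / fst z). exists (atan x).
  destruct (atan_bound x) as [A1 A2]. pose proof PI_RGT_0.
  split; [intros E; rewrite E in H; simpl in H; lra|]. split; [lra|].
  assert (Hs : 0 < 1 + x ^ 2) by (pose proof (pow2_ge_0 x); lra).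
  pose proof (sqrt_lt_R0 _ Hs) as Hq.
  assert (Em : Cmod z = fst z * sqrt (1 + x ^ 2)).
  { unfold Cmod. replace (fst z ^ 2 + snd z ^ 2) with (fst z ^ 2 * (1 + x ^ 2)).
    - rewrite sqrt_mult_alt by apply pow2_ge_0. rewrite sqrt_pow2; lra.
    - unfold x. field. lra. }
  rewrite Em, cos_atan, sin_atan, Rsqr_pow2. apply C_eq; cbn [fst snd].
  - field. lra.
  - replace (snd z) with (fst z * x) by (unfold x; field; lra). field. lra.
Qed.

Theorem mainTheorem2 :
  forall (rho1 rho2 : SU11 -> vec -> vec) (t : R) (eta1 eta2 : vec) (K1 K2 : C),
    isRep rho1 -> isRep rho2 ->
    irreducible rho1 -> irreducible rho2 ->
    ellIs rho1 t -> ellIs rho2 t ->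
    distinguished rho1 eta1 eta2 -> distinguished rho2 eta1 eta2 ->
    K1of rho1 eta1 eta2 K1 -> K1of rho2 eta1 eta2 K2 ->
    exists rho : SU11 -> vec -> vec,
      isRep rho /\ irreducible rho /\ ellIs rho t /\
      exists theta, isArg (Cplus K1 K2) theta /\ ArgIs rho theta.
Proof.
  intros rho1 rho2 t eta1 eta2 K1 K2 R1 R2 J1 J2 L1 L2 D1 D2 A1 A2.
  destruct (horospherical_data rho1 t eta1 eta2 K1 R1 J1 L1 D1 A1) as (P1 & c1 & O1 & G1 & N1).
  destruct (horospherical_data rho2 t eta1 eta2 K2 R2 J2 L2 D2 A2) as (P2 & c2 & O2 & G2 & _).
  assert (Ht : 0 < t) by apply L1.
  assert (HP := ext_pair rho1 eta1 eta2 D1).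
  destruct (kernel_model eta1 eta2 t K1 K2 c1 c2) as (ch & Hch & Sch & Gch); auto.
  assert (Hk : 0 < fst (Cplus K1 K2)) by (simpl; lra).
  pose (ex := acts_ex (Cplus K1 K2) t ch Hk Hch Sch Gch).
  (* [SU11] contains all pairs, so a default value, the identity, is needed outside the group. *)
  pose (rho := fun g => match excluded_middle_informative (inSU11 g) with
     | left h => proj1_sig (constructive_indefinite_description _ (ex g h))
     | right _ => fun u => u end).
  assert (Hrho : forall g, inSU11 g -> acts (Cplus K1 K2) t ch (rho g) g).
  { intros g Hg. unfold rho. destruct (excluded_middle_informative (inSU11 g)) as [h|h]; [|contradiction].
    apply (proj2_sig (constructive_indefinite_description _ (ex g h))). }
  exists rho. split; [|split; [|split]].
  - apply (rho_isRep (Cplus K1 K2) t ch); auto.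
  - apply (rho_irreducible (Cplus K1 K2) t ch); auto.
  - apply (rho_ell (Cplus K1 K2) t ch); auto.
  - destruct (isArg_exists _ Hk) as [theta Hth]. exists theta. split; auto.
    exists e1, e2, (Cplus K1 K2). split; [|split; auto].
    + apply (rho_distinguished (Cplus K1 K2) t ch); auto.
    + apply (rho_K1 (Cplus K1 K2) t ch); auto.
Qed.
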